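(* Let $\mathcal{H}$ be a complex Hilbert space. An operator $H\in\mathcal{B}(\mathcal{H})$ is a (norm) limit of differences of orthogonal projections if and only if it satisfies the following two conditions: (a) $-I\le H\le I$; and (b) if $\mathcal{N} := (\ker(H^2-I))^\perp$ and $H_1 := H|_{\mathcal{N}}$, then $H_1$ is approximately unitarily equivalent to $-H_1$.
   Context: $\mathcal{B}(\mathcal{H})$ is the algebra of bounded linear operators on $\mathcal{H}$. An orthogonal projection is $P\in\mathcal{B}(\mathcal{H})$ with $P=P^*=P^2$; a difference of projections is an operator $P-Q$ with $P,Q\in\mathcal{B}(\mathcal{H})$ orthogonal projections. The condition $-I\le H\le I$ includes that $H$ is self-adjoint. Operators $A,B$ on a Hilbert space $\mathcal{N}$ are approximately unitarily equivalent if there is a sequence $(U_n)_n$ of unitary operators in $\mathcal{B}(\mathcal{N})$ such that $B=\lim_n U_n^*AU_n$ in norm. *)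

(* Defs.v *)
From HB Require Export structures.
From mathcomp Require Export all_boot all_order all_algebra.
From mathcomp Require Export sesquilinear complex.
From mathcomp Require Import ring lra.
From mathcomp Require Export boolp classical_sets functions reals topology.
From mathcomp Require Export normedtype sequences.

Set Implicit Arguments.
Unset Strict Implicit.
Unset Printing Implicit Defensive.

Export Order.TTheory GRing.Theory Num.Theory.
Export numFieldNormedType.Exports.

Local Open Scope classical_set_scope.
Local Open Scope complex_scope.
Local Open Scope ring_scope.

(* The inner product of [{dot V for Num.conj}] is linear in its first argument
   and conjugate-linear in its second one. *)
HB.mixin Record isHilbert (R : realType) V & CompleteNormedModule R[i] V := {
  inner : {dot V for Num.conj} ;
  sqr_norm_inner : forall x : V, `|x| ^+ 2 = inner x x
}.

#[short(type="hilbertType")]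
HB.structure Definition Hilbert (R : realType) :=
  {V of CompleteNormedModule R[i] V & isHilbert R V}.

Notation "''[' x , y ]" := (inner x y) : ring_scope.

Section HilbertTheory.
Variables (R : realType) (V : hilbertType R).
Implicit Types (x y z : V).

Lemma inner_conj x y : '[x, y] = ('[y, x])^*%R.
Proof. by rewrite hermC expr0 mul1r. Qed.

Lemma cauchy_schwarz x y : `|'[x, y]| <= `|x| * `|y|.
Proof.
have [->|y0] := eqVneq y 0; first by rewrite linear0 !normr0 mulr0.
have yy : 0 < '[y, y] by apply: neq0_dnorm_gt0.
rewrite -(@ler_pXn2r _ 2%N) ?nnegrE ?mulr_ge0// exprMn !sqr_norm_inner.
pose a := '[x, y] / '[y, y].
have : 0 <= '[x - a *: y, x - a *: y] by rewrite -sqr_norm_inner exprn_ge0.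
rewrite hnormB /= expr0 mul1r -inner_conj !linearZr_LR !linearZl_LR /=.
rewrite [a * '[y, y]]divfK ?gt_eqF// opprD addrA addrK subr_ge0.
by rewrite /a mulrAC ler_pdivrMr// normCK -inner_conj.
Qed.

Lemma inner_sqrD x y :
  '[x + y, x + y] = '[x, x] + '[y, y] + ('[x, y] + ('[x, y])^*%R).
Proof. by rewrite hnormD /= expr0 mul1r. Qed.

End HilbertTheory.

Section BoundedOperators.
Variables (R : realType) (V : normedModType R[i]).

Definition bounded_linear : {pred V -> V} :=
  fun f => `[< linear f /\ continuous f >].

Record bop := Bop { bop_fun :> V -> V ; _ : bop_fun \in bounded_linear }.

HB.instance Definition _ := [isSub for bop_fun].
HB.instance Definition _ := [Choice of bop by <:].

Lemma bopP (T : bop) : linear T /\ continuous T.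
Proof. by have /asboolP := valP T. Qed.

HB.instance Definition _ (T : bop) :=
  GRing.isLinear.Build _ _ _ _ (T : V -> V) (proj1 (bopP T)).

Lemma bop_ext (S T : bop) : S =1 T -> S = T.
Proof. by move=> ST; apply/val_inj/funext. Qed.

Lemma bounded_linear_submod : submod_closed bounded_linear.
Proof.
split.
  apply/asboolP; split; last by move=> x; exact: cvg_cst.
  by move=> a x y /=; rewrite /GRing.zero/= scaler0 addr0.
move=> a f g /asboolP[lf cf] /asboolP[lg cg]; apply/asboolP; split.
  move=> b x y.
  rewrite !fctE/= lf lg !scalerDr !scalerA (mulrC a b).
  by rewrite addrACA.
move=> x; apply: cvgD; last exact: cg.
by apply: cvgZr; exact: cf.
Qed.

HB.instance Definition _ :=
  GRing.isSubmodClosed.Build _ _ bounded_linear bounded_linear_submod.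
HB.instance Definition _ := [SubChoice_isSubLmodule of bop by <:].

Lemma bop_id_subproof : (@idfun V) \in bounded_linear.
Proof. by apply/asboolP; split=> // x; exact: cvg_id. Qed.

Lemma bop_comp_subproof (S T : bop) : S \o T \in bounded_linear.
Proof.
have [lS cS] := bopP S; have [lT cT] := bopP T.
apply/asboolP; split; first by move=> a x y /=; rewrite lT lS.
by move=> x; apply: continuous_comp; [exact: cT|exact: cS].
Qed.

Definition bop_id := Bop bop_id_subproof.
Definition bop_comp (S T : bop) := Bop (bop_comp_subproof S T).

Lemma bop_compA : associative bop_comp.
Proof. by move=> S T U; apply: bop_ext. Qed.
Lemma bop_comp1l : left_id bop_id bop_comp.
Proof. by move=> S; apply: bop_ext. Qed.
Lemma bop_comp1r : right_id bop_id bop_comp.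
Proof. by move=> S; apply: bop_ext. Qed.
Lemma bop_compDl : left_distributive bop_comp +%R.
Proof. by move=> S T U; apply: bop_ext. Qed.
Lemma bop_compDr : right_distributive bop_comp +%R.
Proof.
by move=> S T U; apply: bop_ext => x; apply: (linearD S).
Qed.

HB.instance Definition _ := GRing.Zmodule_isPzRing.Build bop
  bop_compA bop_comp1l bop_comp1r bop_compDl bop_compDr.

(* Norms over [R[i]] take their values in [R[i]], where suprema do not exist;
   hence the real parts. *)
Definition opnorm (T : bop) : R :=
  sup [set complex.Re `|T x| | x in [set x : V | `|x| <= 1]].

Let nre (x : V) : (complex.Re `|x|)%:C = `|x|.
Proof. by rewrite RRe_real ?normr_real. Qed.

Lemma opnorm_has_sup (T : bop) :
  has_sup [set complex.Re `|T x| | x in [set x : V | `|x| <= 1]].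
Proof.
split; first by exists (complex.Re `|T 0|), 0; rewrite //= normr0.
have /linear_bounded_continuous/linear_boundedP := proj2 (bopP T).
move=> /pinfty_ex_gt0[r r0 Hr]; exists (complex.Re r) => _ [x /= x1 <-].
have : `|T x| <= r.
  by rewrite (le_trans (Hr x))// ler_piMr// ltW.
by rewrite lecE => /andP[].
Qed.

Lemma opnorm_ge (T : bop) x : `|T x| <= (opnorm T)%:C * `|x|.
Proof.
have [->|x0] := eqVneq x 0; first by rewrite linear0 !normr0 mulr0.
have nx0 : 0 < `|x| by rewrite normr_gt0.
rewrite -ler_pdivrMr//.
have -> : `|T x| / `|x| = `|T (`|x|^-1 *: x)|.
  by rewrite linearZ normrZ normfV normr_id mulrC.
rewrite -nre lecR; apply: (ub_le_sup (proj2 (opnorm_has_sup T))).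
exists (`|x|^-1 *: x) => //=.
by rewrite normrZ normfV normr_id mulVf// gt_eqF.
Qed.

Lemma opnorm_le (T : bop) (M : R) :
  (forall x, `|x| <= 1 -> `|T x| <= M%:C) -> opnorm T <= M.
Proof.
move=> TM; apply: ge_sup; first exact: (proj1 (opnorm_has_sup T)).
by move=> _ [x /= x1 <-]; rewrite -lecR nre TM.
Qed.

Lemma opnorm_ge0 (T : bop) : 0 <= opnorm T.
Proof.
apply: (ub_le_sup (proj2 (opnorm_has_sup T))).
by exists 0; rewrite /= ?linear0 normr0.
Qed.

Let bop_norm (T : bop) : R[i] := (opnorm T)%:C.

Let bop_norm_ge0 (T : bop) : 0 <= bop_norm T.
Proof. by rewrite ler0c opnorm_ge0. Qed.

Let bop_ler_normD (S T : bop) : bop_norm (S + T) <= bop_norm S + bop_norm T.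
Proof.
rewrite -rmorphD/= lecR; apply: opnorm_le => x x1.
rewrite rmorphD/= (le_trans (ler_normD _ _))// lerD//;
  by rewrite (le_trans (opnorm_ge _ _))// ler_piMr// bop_norm_ge0.
Qed.

Let bop_normr0_eq0 (T : bop) : bop_norm T = 0 -> T = 0.
Proof.
move=> T0; apply: bop_ext => x; apply/eqP; rewrite -normr_le0.
by rewrite (le_trans (opnorm_ge _ _))// -/(bop_norm T) T0 mul0r.
Qed.

Let bop_normrZ_le (a : R[i]) (T : bop) : bop_norm (a *: T) <= `|a| * bop_norm T.
Proof.
have aE : `|a| = (complex.Re `|a|)%:C by rewrite RRe_real ?normr_real.
move: (complex.Re `|a|) aE => r aE.
rewrite aE -rmorphM/= lecR; apply: opnorm_le => x x1.
rewrite rmorphM/= -aE normrZ ler_wpM2l//.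
by rewrite (le_trans (opnorm_ge _ _))// ler_piMr// bop_norm_ge0.
Qed.

Let bop_normrZ (a : R[i]) (T : bop) : bop_norm (a *: T) = `|a| * bop_norm T.
Proof.
apply/eqP; rewrite eq_le bop_normrZ_le/=.
have [->|a0] := eqVneq a 0; first by rewrite normr0 mul0r bop_norm_ge0.
have na0 : 0 < `|a| by rewrite normr_gt0.
rewrite -ler_pdivlMl// -normfV (le_trans _ (bop_normrZ_le _ _))//.
by rewrite scalerA mulVf// scale1r.
Qed.

HB.instance Definition _ :=
  Lmodule_isNormed.Build R[i] bop bop_ler_normD bop_normrZ bop_normr0_eq0.

Lemma bop_normE (T : bop) : `|T| = (opnorm T)%:C.
Proof. by []. Qed.

End BoundedOperators.

Notation "''B' ( V )" := (bop V) (at level 0, format "''B' ( V )") : type_scope.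

Definition ker (R : realType) (V : normedModType R[i]) (T : 'B(V)) : set V :=
  [set x | T x = 0].

Section OrthogonalComplement.
Variables (R : realType) (V : hilbertType R) (A : set V).

(* [perp A] is the closed subspace [A^perp] with the Hilbert space structure
   inherited from [V]; [A] need not be a subspace. *)
Definition orthocompl : {pred V} :=
  fun x => `[< forall y, A y -> '[x, y] = 0 >].

Record perp := Perp { perp_val : V ; _ : perp_val \in orthocompl }.

HB.instance Definition _ := [isSub for perp_val].
HB.instance Definition _ := [Choice of perp by <:].

Lemma orthocompl_submod : submod_closed orthocompl.
Proof.
split; first by apply/asboolP => y _; rewrite linear0l.
move=> a u v /asboolP Hu /asboolP Hv; apply/asboolP => y Ay.
by rewrite linearDl/= linearZl_LR/= Hu// Hv// mulr0 addr0.
Qed.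

HB.instance Definition _ :=
  GRing.isSubmodClosed.Build _ _ orthocompl orthocompl_submod.
HB.instance Definition _ := [SubChoice_isSubLmodule of perp by <:].

Let perp_norm (x : perp) : R[i] := `|\val x|.

Let perp_ler_normD (x y : perp) : perp_norm (x + y) <= perp_norm x + perp_norm y.
Proof. exact: ler_normD. Qed.

Let perp_normrZ (a : R[i]) (x : perp) : perp_norm (a *: x) = `|a| * perp_norm x.
Proof. exact: normrZ. Qed.

Let perp_normr0_eq0 (x : perp) : perp_norm x = 0 -> x = 0.
Proof. by move=> /normr0_eq0 x0; exact/val_inj. Qed.

HB.instance Definition _ :=
  Lmodule_isNormed.Build R[i] perp perp_ler_normD perp_normrZ perp_normr0_eq0.

Lemma perp_normE (x : perp) : `|x| = `|\val x|.
Proof. by []. Qed.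

Let perp_complete (F : set_system perp) :
  ProperFilter F -> cauchy F -> cvg F.
Proof.
move=> FF /cauchyP Fc.
have /cauchy_cvg/cvg_ex[l Fl] : cauchy ((\val : perp -> V) @ F).
  apply/cauchyP => e e0; have [x Fx] := Fc e e0; exists (\val x).
  by move: Fx; rewrite -!ball_normE.
have lA : l \in orthocompl.
  apply/asboolP => y Ay; apply/eqP; rewrite -normr_le0.
  apply/ler_addgt0Pl => e e0; rewrite addr0.
  have y1 : 0 < `|y| + 1 by rewrite ltr_wpDl.
  have [x] : exists x : perp, `|l - \val x| <= e / (`|y| + 1).
    have /cvgrPdist_le/(_ (e / (`|y| + 1))) := Fl.
    by rewrite divr_gt0// => /(_ isT)/filter_ex.
  move=> lx; have /asboolP/(_ _ Ay) xy := valP x.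
  have -> : '[l, y] = '[l - \val x, y] by rewrite linearBl/= xy subr0.
  rewrite (le_trans (cauchy_schwarz _ _))//.
  rewrite (le_trans (ler_wpM2r _ lx))// mulrAC ler_pdivrMr//.
  by rewrite ler_wpM2l ?ltW// ltrDl.
apply/cvg_ex; exists (Perp lA); apply/cvgrPdist_le => e e0.
by have /cvgrPdist_le/(_ e e0) := Fl.
Qed.

HB.instance Definition _ := Uniform_isComplete.Build perp perp_complete.

Let perp_inner (x y : perp) : R[i] := '[\val x, \val y].

Let perp_inner_bilinear : bilinear_for
  (GRing.Scale.Law.clone _ _ *%R _)
  (GRing.Scale.Law.clone _ _ (Num.conj \; *%R) _) perp_inner.
Proof.
split=> [y a u v|y a u v]; rewrite /perp_inner.
  by rewrite linearDl/= linearZl_LR.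
by rewrite linearD/= linearZr_LR.
Qed.

Let perp_inner_herm (x y : perp) :
  perp_inner x y = (-1) ^+ false * (perp_inner y x)^*%R.
Proof. by rewrite expr0 mul1r -inner_conj. Qed.

Let perp_inner_gt0 (x : perp) : x != 0 -> 0 < perp_inner x x.
Proof. by move=> x0; apply: neq0_dnorm_gt0. Qed.

HB.instance Definition _ := bilinear_isBilinear.Build R[i] perp perp R[i]
  _ _ perp_inner perp_inner_bilinear.
HB.instance Definition _ := isHermitianSesquilinear.Build R[i] perp false
  Num.conj perp_inner perp_inner_herm.
HB.instance Definition _ :=
  isDotProduct.Build R[i] perp perp_inner perp_inner_gt0.

Let perp_sqr_norm (x : perp) :
  `|x| ^+ 2 = (perp_inner : {dot perp for Num.conj}) x x.
Proof. by rewrite perp_normE sqr_norm_inner. Qed.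

HB.instance Definition _ := isHilbert.Build R perp perp_sqr_norm.

Lemma perp_innerE (x y : perp) : '[x, y] = '[\val x, \val y].
Proof. by []. Qed.

End OrthogonalComplement.

Section RealArithmetic.
Variable R : realFieldType.
Implicit Types a b c d e s t M : R.

Lemma riesz_arith1 a b M : a <= M * b -> 2 * a - b ^+ 2 <= M ^+ 2.
Proof. by move=> ?; have := sqr_ge0 (M - b); nra. Qed.

Lemma riesz_arith2 s d jx jy jm : s - d ^+ 2 / 8 < jx -> s - d ^+ 2 / 8 < jy -> jm <= s ->
  4 * jm - 2 * jx - 2 * jy < d ^+ 2.
Proof. by move=> ? ? ?; have := sqr_ge0 d; lra. Qed.

Lemma riesz_arith3 s e a b c d n m k : s - e / 2 < 2 * a - n ->
  2 * (a + b) - (n + m + 2 * c) <= s -> - k <= d -> d <= e / 4 ->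
  2 * (b - c - k) <= m + e.
Proof. move=> ? ? ? ?; lra. Qed.

Lemma riesz_arith4 e n t : e * (n ^+ 2 + 1) = 1 -> 2 * (e * t ^+ 2) <= (e * t * n) ^+ 2 ->
  e * t ^+ 2 <= 0.
Proof.
move=> E H; have et := sqr_ge0 (e * t).
have : (e * t * n) ^+ 2 = e * t ^+ 2 * (e * (n ^+ 2 + 1)) - (e * t) ^+ 2 by ring.
by rewrite E mulr1 => EH; move: H; rewrite EH; lra.
Qed.

Lemma riesz_arith5 b e : 0 <= b -> 0 < e -> b * (e / (4 * (b + 1))) <= e / 4.
Proof.
move=> b0 e0; have b1 : 0 < b + 1 by rewrite ltr_wpDl.
have -> : b * (e / (4 * (b + 1))) = e / 4 * (b / (b + 1)).
  by field; rewrite gt_eqF.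
rewrite ler_piMr//; first by rewrite divr_ge0// ltW.
by rewrite ler_pdivrMr// mul1r lerDl.
Qed.

End RealArithmetic.

Section Riesz.
Variables (R : realType) (V : hilbertType R).
Implicit Types x y z h : V.

Variables (f : {linear V -> R[i]^o}).
Variables (M : R) (fM : forall x : V, `|f x| <= M%:C * `|x|).

Let r x : R := complex.Re `|x|.
Let rE x : (r x)%:C = `|x|.
Proof. by rewrite RRe_real ?normr_real. Qed.
Let ltr0c (d : R) : (0 < d%:C) = (0 < d). Proof. exact: (ltcR 0). Qed.
Let r2E x : r x ^+ 2 = complex.Re '[x, x].
Proof. by apply: complexI; rewrite rmorphXn/= rE -sqr_norm_inner RRe_real ?rpredX ?normr_real. Qed.

Let ReD (a b : R[i]) : complex.Re (a + b) = complex.Re a + complex.Re b.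
Proof. by case: a b => [? ?] []. Qed.
Let ReN (a : R[i]) : complex.Re (- a) = - complex.Re a.
Proof. by case: a. Qed.
Let ReB (a b : R[i]) : complex.Re (a - b) = complex.Re a - complex.Re b.
Proof. by rewrite ReD ReN. Qed.
Let ReC (a : R[i]) : complex.Re (a^*)%R = complex.Re a.
Proof. by case: a. Qed.

Let r2D x y : r (x + y) ^+ 2 = r x ^+ 2 + r y ^+ 2 + 2 * complex.Re '[x, y].
Proof.
rewrite !r2E inner_sqrD !ReD ReC; ring.
Qed.

Let normRe (a : R[i]) : complex.Re a <= complex.Re `|a|.
Proof.
have := normc_ge_Re a; rewrite lecE/= => /andP[_].
exact/le_trans/ler_norm.
Qed.

(* The representing vector is found as the maximiser of J. *)
Let J x := 2 * complex.Re (f x) - r x ^+ 2.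

Let J_le x : J x <= M ^+ 2.
Proof.
apply: riesz_arith1; rewrite (le_trans (normRe _))// -lecR RRe_real ?normr_real//.
by rewrite rmorphM/= rE.
Qed.

Let s := sup (range J).

Let J_sup : has_sup (range J).
Proof.
split; first by exists (J 0), 0.
by exists (M ^+ 2) => _ [x _ <-]; exact: J_le.
Qed.

Let Js x : J x <= s.
Proof. by apply: (ub_le_sup (proj2 J_sup)); exists x. Qed.

Let F : set_system V :=
  filter_from [set d : R | 0 < d] (fun d => [set x | s - d < J x]).

Let FF : ProperFilter F.
Proof.
apply: filter_from_proper; last first.
  move=> d /= d0; have [_ [x _ <-] sx] := sup_adherent d0 J_sup.
  by exists x.
apply: filter_from_filter; first by exists 1; rewrite /= ltr01.
move=> d e /= d0 e0; exists (Num.min d e) => /=; first by rewrite lt_min d0.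
by move=> x /= xs; split=> /=; apply: le_lt_trans xs;
  rewrite lerD2l lerN2 ge_min lexx ?orbT.
Qed.

Let half (a : R[i]) : complex.Re (2^-1 * a) = 2^-1 * complex.Re a.
Proof.
have -> : (2^-1 : R[i]) = (2^-1)%:C by rewrite fmorphV rmorph_nat.
by case: a => a b /=; rewrite mul0r subr0.
Qed.

Let J_mid x y :
  r (x - y) ^+ 2 = 4 * J (2^-1 *: (x + y)) - 2 * J x - 2 * J y.
Proof.
have rh z : r (2^-1 *: z) = 2^-1 * r z.
  by rewrite /r normrZ normfV normr_nat half.
rewrite /J linearZ linearD /= half rh exprMn ReD !r2D.
rewrite linearN/= ReN.
have -> : r (- y) = r y by rewrite /r normrN.
by field.
Qed.

Let F_cauchy : cauchy F.
Proof.
have FF' := FF; apply/cauchyP => e e0.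
have eE : e = (complex.Re e)%:C by rewrite RRe_real// gtr0_real.
move: (complex.Re e) eE => d eE; move: e0; rewrite {}eE ltr0c => d0.
have d8 : 0 < d ^+ 2 / 8 by rewrite divr_gt0// exprn_gt0.
have [_ [x _ <-] sx] := sup_adherent d8 J_sup.
exists x; exists (d ^+ 2 / 8) => //= y sy.
rewrite -ball_normE/= -rE ltcR.
have r0 : 0 <= r (x - y) by rewrite -ler0c rE.
have := J_mid x y; have := Js (2^-1 *: (x + y)).
move: sx sy; rewrite -/s => sx sy sm E.
by rewrite -(@ltr_pXn2r _ 2%N) ?nnegrE// ?ltW// E; exact: riesz_arith2 sx sy sm.
Qed.

Lemma riesz : exists z, forall x, f x = '[x, z].
Proof.
have FF' := FF.
have [z Fz] : exists z, F --> z by apply/cvg_ex; exact: (@cauchy_cvg _ F _ F_cauchy).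
exists z.
pose g (x : V) : R[i] := f x - '[x, z].
have gle h : 2 * complex.Re (g h) <= r h ^+ 2.
  apply/ler_addgt0Pr => e e0.
  have rh0 : 0 <= r h by rewrite -ler0c rE.
  pose d := e / (4 * (r h + 1)).
  have d0 : 0 < d by rewrite divr_gt0// mulr_gt0// ltr_wpDl.
  have [x [sx zx]] : exists x, s - e / 2 < J x /\ `|z - x| <= d%:C.
    have : (fun x => x) @ F --> z by []. 
    move=> /cvgrPdist_le/(_ d%:C); rewrite ltr0c => /(_ d0) Fd.
    have : F [set x | s - e / 2 < J x] by exists (e / 2) => //=; rewrite divr_gt0.
    by move=> /(filterI Fd)/filter_ex[x [? ?]]; exists x.
  have := Js (x + h); move: sx.
  rewrite /J r2D linearD /= ReD => sx sxh.
  have xh : complex.Re '[x, h] = complex.Re '[h, x] by rewrite inner_conj ReC.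
  have gE : complex.Re (g h) =
      complex.Re (f h) - complex.Re '[h, x] - complex.Re '[h, z - x].
    have -> : '[h, z - x] = '[h, z] - '[h, x] by rewrite linearB.
    by rewrite /g !ReB; ring.
  have H1 : - complex.Re '[h, z - x] <= r h * d.
    rewrite -ReN (le_trans (normRe _))// -lecR RRe_real ?normr_real// normrN.
    rewrite (le_trans (cauchy_schwarz _ _))// rmorphM/= rE.
    by rewrite ler_wpM2l.
  have H2 : r h * d <= e / 4.
    exact: riesz_arith5.
  by rewrite gE; apply: riesz_arith3 H1 H2; [exact: sx | rewrite -xh].
move=> h; apply/eqP; rewrite -subr_eq0 -/(g h); apply/eqP.
have rh0 : 0 <= r h ^+ 2 by rewrite sqr_ge0.
pose e := (r h ^+ 2 + 1)^-1.
have e0 : 0 < e by rewrite invr_gt0 ltr_wpDl.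
have := gle ((e%:C * (g h)^*%R) *: h).
have -> : g ((e%:C * (g h)^*%R) *: h) = e%:C * `|g h| ^+ 2.
  rewrite /g linearZ/= linearZl_LR/= -mulrBr -/(g h) normCK.
  by rewrite -mulrA [(_^*)%R * _]mulrC.
pose t := complex.Re `|g h|.
have tE : `|g h| = t%:C by rewrite /t RRe_real ?normr_real.
have -> : r ((e%:C * (g h)^*%R) *: h) = e * t * r h.
  apply: complexI; rewrite !rmorphM/= !rE normrZ normrM norm_conjC tE.
  by rewrite ger0_norm ?ler0c ?ltW.
rewrite tE -rmorphXn -rmorphM/= => H.
apply/eqP; rewrite -normr_eq0 tE; apply/eqP; congr (_%:C).
have E : e * (r h ^+ 2 + 1) = 1 by rewrite mulVf// gt_eqF// ltr_wpDl.
apply/eqP; rewrite -sqrf_eq0 eq_le sqr_ge0 andbT.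
have : e * t ^+ 2 <= 0.
  exact: riesz_arith4 E H.
by rewrite pmulr_rle0.
Qed.

End Riesz.
Section Adjoint.
Variables (R : realType) (V : hilbertType R).
Implicit Types (S T : 'B(V)) (x y : V).

Lemma innerI x x' : (forall y, '[y, x] = '[y, x']) -> x = x'.
Proof.
move=> xx'; apply/eqP; rewrite -subr_eq0 -normr_eq0 -sqrf_eq0 sqr_norm_inner.
by rewrite linearB/= xx' subrr.
Qed.

Lemma adjoint_exists T : exists S : 'B(V), forall x y, '[T x, y] = '[x, S y].
Proof.
have lf y : linear (fun x => '[T x, y] : R[i]^o).
  by move=> a u v; rewrite linearP linearDl/= linearZl_LR.
pose f y : {linear V -> R[i]^o} :=
  HB.pack (fun x => '[T x, y] : R[i]^o) (GRing.isLinear.Build _ _ _ _ _ (lf y)).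
have fM y x : `|f y x| <= (opnorm T * complex.Re `|y|)%:C * `|x|.
  rewrite (le_trans (cauchy_schwarz _ _))//.
  have -> : (opnorm T * complex.Re `|y|)%:C = (opnorm T)%:C * `|y|.
    rewrite rmorphM; congr (_ * _); exact/RRe_real/normr_real.
  by rewrite mulrAC ler_wpM2r// opnorm_ge.
have {fM} /choice[g gE] : forall y, exists z, forall x, '[T x, y] = '[x, z].
  by move=> y; have [z Hz] := riesz (fM y); exists z.
have lg : linear g.
  move=> a u v; apply: innerI => x; rewrite -gE !linearP /=.
  by rewrite !gE.
pose G : {linear V -> V} := HB.pack g (GRing.isLinear.Build _ _ _ _ _ lg).
have cG : continuous G.
  apply/linear_bounded_continuous/linear_boundedP.
  near=> e => x /=.
  have [->|gx0] := eqVneq (g x) 0.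
    by rewrite normr0 mulr_ge0//; near: e; apply: nbhs_pinfty_ge.
  have gx : 0 < `|g x| by rewrite normr_gt0.
  rewrite -(ler_pM2l gx) -expr2 sqr_norm_inner -gE.
  have -> : '[T (g x), x] = `|'[T (g x), x]|.
    by rewrite gE -sqr_norm_inner ger0_norm ?exprn_ge0.
  rewrite (le_trans (cauchy_schwarz _ _))// mulrA ler_wpM2r//.
  rewrite (le_trans (opnorm_ge _ _))// mulrC ler_wpM2l//.
  near: e; apply: nbhs_pinfty_ge; apply/complex_realP; by exists (opnorm T).
have gP : g \in @bounded_linear R V by apply/asboolP.
by exists (Bop gP) => x y; rewrite gE.
Unshelve. all: by end_near. Qed.

Definition adjoint T : 'B(V) := projT1 (cid (adjoint_exists T)).

Lemma adjointE T x y : '[T x, y] = '[x, adjoint T y].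
Proof. exact: (projT2 (cid (adjoint_exists T))). Qed.

Lemma adjointP S T : (forall x y, '[T x, y] = '[x, S y]) <-> S = adjoint T.
Proof.
split=> [TS|-> x y]; last exact: adjointE.
by apply: bop_ext => y; apply: innerI => x; rewrite -TS adjointE.
Qed.

End Adjoint.

Section Operators.
Variables (R : realType) (V : hilbertType R).
Implicit Types S T A B P D U : 'B(V).

Definition self_adjoint T := T = adjoint T.

Definition orthogonal_projection P := P = adjoint P /\ P = P ^+ 2.

Definition difference_of_projections D := exists P Q : 'B(V),
  [/\ orthogonal_projection P, orthogonal_projection Q & D = P - Q].

(* Order on self-adjoint operators: [op_le A B] includes self-adjointness. *)
Definition op_le A B :=
  [/\ self_adjoint A, self_adjoint B & forall x, '[A x, x] <= '[B x, x]].

Definition unitary U := adjoint U * U = 1 /\ U * adjoint U = 1.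

Definition approx_unitarily_equivalent A B := exists U : nat -> 'B(V),
  (forall n, unitary (U n)) /\
  (fun n => adjoint (U n) * A * U n) @ \oo --> B.

End Operators.

Section Restriction.
Variables (R : realType) (V : hilbertType R).
Implicit Types (S T : 'B(V)) (A : set V).

Definition perp_stable T A := {homo T : x / x \in orthocompl A}.

Section Restrict.
Variables (T : 'B(V)) (A : set V) (TA : perp_stable T A).

Let restrict_fun (x : perp A) : perp A := Perp (TA (valP x)).

Let restrict_subproof : restrict_fun \in @bounded_linear R (perp A).
Proof.
have lT : linear restrict_fun.
  by move=> a x y; apply: val_inj; rewrite /= linearP.
apply/asboolP; split => //.
pose f : {linear perp A -> perp A} :=
  HB.pack restrict_fun (GRing.isLinear.Build _ _ _ _ _ lT).
suff: continuous f by [].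
apply/linear_bounded_continuous/linear_boundedP.
near=> e => x /=; rewrite !perp_normE (le_trans (opnorm_ge _ _))//.
rewrite ler_wpM2r//; near: e; apply: nbhs_pinfty_ge.
by apply/complex_realP; exists (opnorm T).
Unshelve. all: by end_near. Qed.

Definition restrict : 'B(perp A) := Bop restrict_subproof.

Lemma restrictE (x : perp A) : \val (restrict x) = T (\val x).
Proof. by []. Qed.

End Restrict.

Lemma perp_ker_sqr_stable T :
  self_adjoint T -> perp_stable T (ker (T ^+ 2 - 1)).
Proof.
move=> Tsa x /asboolP xN; apply/asboolP => y yK.
rewrite adjointE -Tsa; apply: xN; change ((T ^+ 2 - 1) (T y) = 0).
have yK0 : (T ^+ 2 - 1) y = 0 by [].
have E z : (T ^+ 2 - 1) z = T (T z) - z by rewrite expr2.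
by move: yK0; rewrite !E => /subr0_eq ->; rewrite subrr.
Qed.

Lemma op_le_stable S T :
  op_le S T -> perp_stable T (ker (T ^+ 2 - 1)).
Proof. by move=> [_ Tsa _]; exact: perp_ker_sqr_stable. Qed.

End Restriction.

(* Main.v *)
Require Import Defs.
From mathcomp Require Import ring lra.
From mathcomp Require Import cardinality.

(** If [D = P - Q] and [B = P + Q - 1] then [B D = - D B] and [B^2 = 1 - D^2];
    conversely a self-adjoint contraction [D] that anticommutes with a symmetry
    [J] is [P - Q] with [P, Q = (1 +- D + J sqrt (1 - D^2)) / 2].

    From equivalence to limits: if [H U_n + U_n H -> 0] on [N], then
    [S_n = H_+ U_n H_- + H_- U_n^* H_+] is self-adjoint, asymptotically
    anticommutes with [H], and [S_n^2 - H^4 -> 0].  Hence its sign [J_n]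
    asymptotically anticommutes with [H], and [(H - J_n H J_n) / 2] is a
    difference of projections converging to [H] on [N]; on [ker (H^2 - 1)] the
    operator [H] is one already.

    From limits to equivalence: [P_n] and [Q_n] asymptotically commute with the
    projection onto [N], so one may compress them to [N] and round.  If [1 - H^2]
    is bounded below on [N], the sign of [B_n] asymptotically anticommutes with
    [H].  Otherwise neither [1 - H] nor [1 + H] is bounded below, and both
    spectral subspaces of [D_n] near [1] and [-1] are infinite dimensional.  They
    have equal dimension: countably many operators separate the points of one
    when followed by the projection onto the other, so by Bessel's inequality an
    orthonormal basis of the first is the union, over the countably many
    operators and a basis of the second, of countable sets.  The sign of [B_n]
    on the middle of the spectrum, glued to a unitary exchange of the two ends,
    almost anticommutes with [H]. *)

(** The discontinuity of the sign shapes both directions. If self-adjoint [S n] asymptotically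
    anticommute with H and their absolute values asymptotically commute with it, the anticommutator
    of H with sgn (S n) is controlled only after multiplication by |S n|, and this factor has to be
    removed. Towards limits, |S n| approaches a multiple of H^2, and powers of H can be removed
    because T = H J + J H satisfies T^2 = T H J + J T H. Towards equivalence, a gap makes 1 - H^2,
    the limit of |B n|^2, bounded below. Without a gap, sgn (B n) fails to anticommute with D n only
    where |D n| = 1. It is replaced on the larger subspace where |D n| is close to 1: there D n is
    close to its own sign, and every exchange of the two ends anticommutes with that sign. The
    functional calculus rests on one iteration for square roots whose rate is uniform over
    contractions, so asymptotic relations between sequences pass to square roots. *)

Set Implicit Arguments.
Unset Strict Implicit.
Unset Printing Implicit Defensive.

Local Open Scope classical_set_scope.
Local Open Scope complex_scope.
Local Open Scope ring_scope.

(** * The real inner product and operator norms *)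

Section RealInnerProduct.
Variables (R : realType) (V : hilbertType R).
Implicit Types (x y z : V) (c : R).

(** Real parts keep all estimates in the real field, where [lra] and [nra] apply; by [rip_ext] and
    [inner_rip] nothing is lost. *)
Definition rip x y : R := complex.Re '[x, y].
Definition nrm x : R := complex.Re `|x|.

Lemma nrmC x : (nrm x)%:C = `|x|.
Proof. by rewrite /nrm RRe_real ?normr_real. Qed.

Lemma nrm_ge0 x : 0 <= nrm x.
Proof. by rewrite -ler0c nrmC. Qed.

Lemma ReD (a b : R[i]) : complex.Re (a + b) = complex.Re a + complex.Re b.
Proof. by case: a b => [? ?] []. Qed.
Lemma ReN (a : R[i]) : complex.Re (- a) = - complex.Re a.
Proof. by case: a. Qed.
Lemma ReConj (a : R[i]) : complex.Re (a^*)%R = complex.Re a.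
Proof. by case: a. Qed.
Lemma ReZ c (a : R[i]) : complex.Re (c%:C * a) = c * complex.Re a.
Proof. by case: a => a b /=; rewrite mul0r subr0. Qed.

Lemma ripC x y : rip x y = rip y x.
Proof. by rewrite /rip inner_conj ReConj. Qed.
Lemma ripDl x y z : rip (x + y) z = rip x z + rip y z.
Proof. by rewrite /rip linearDl/= ReD. Qed.
Lemma ripNl x z : rip (- x) z = - rip x z.
Proof. by rewrite /rip linearNl/= ReN. Qed.
Lemma ripZl c x z : rip (c%:C *: x) z = c * rip x z.
Proof. by rewrite /rip linearZl_LR/= ReZ. Qed.
Lemma rip0l z : rip 0 z = 0.
Proof. by rewrite /rip linear0l. Qed.
Lemma ripDr x y z : rip z (x + y) = rip z x + rip z y.
Proof. by rewrite ripC ripDl !(ripC z). Qed.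
Lemma ripNr x z : rip z (- x) = - rip z x.
Proof. by rewrite ripC ripNl ripC. Qed.
Lemma ripZr c x z : rip z (c%:C *: x) = c * rip z x.
Proof. by rewrite ripC ripZl ripC. Qed.
Lemma rip0r z : rip z 0 = 0.
Proof. by rewrite ripC rip0l. Qed.

Definition ripE := (ripDl, ripDr, ripNl, ripNr, ripZl, ripZr, rip0l, rip0r).

Lemma ripxx x : rip x x = nrm x ^+ 2.
Proof. by apply: complexI; rewrite rmorphXn/= nrmC sqr_norm_inner RRe_real// -sqr_norm_inner rpredX ?normr_real. Qed.

Lemma ripxx_ge0 x : 0 <= rip x x.
Proof. by rewrite ripxx sqr_ge0. Qed.

Lemma nrm0 : nrm 0 = 0.
Proof. by rewrite /nrm normr0. Qed.
Lemma nrm0_eq0 x : nrm x = 0 -> x = 0.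
Proof. by move=> x0; apply/normr0_eq0; rewrite -nrmC x0. Qed.
Lemma ripxx_eq0 x : rip x x <= 0 -> x = 0.
Proof.
move=> x0; apply: nrm0_eq0; apply/eqP; rewrite -sqrf_eq0 -ripxx.
by rewrite eq_le x0 ripxx_ge0.
Qed.
Lemma nrmD x y : nrm (x + y) <= nrm x + nrm y.
Proof. by rewrite -lecR rmorphD/= !nrmC ler_normD. Qed.
Lemma nrmN x : nrm (- x) = nrm x.
Proof. by rewrite /nrm normrN. Qed.
Lemma nrmB x y : nrm (x - y) <= nrm x + nrm y.
Proof. by rewrite -(nrmN y) nrmD. Qed.
Lemma nrmZ c x : nrm (c%:C *: x) = `|c| * nrm x.
Proof. by apply: complexI; rewrite rmorphM/= !nrmC normrZ normc_def /= expr0n/= addr0 sqrtr_sqr. Qed.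

Lemma ler_nrm x (M : R) : 0 <= M -> rip x x <= M ^+ 2 -> nrm x <= M.
Proof. by move=> M0; rewrite ripxx ler_pXn2r ?nnegrE ?nrm_ge0. Qed.

Lemma ler_nrm2 x y : rip x x <= rip y y -> nrm x <= nrm y.
Proof. by rewrite (ripxx y); apply/ler_nrm/nrm_ge0. Qed.

Lemma rip_le x y : rip x y <= nrm x * nrm y.
Proof.
have : `|'[x, y]| <= (nrm x * nrm y)%:C by rewrite rmorphM/= !nrmC cauchy_schwarz.
rewrite lecE/= => /andP[_ H]; apply: le_trans H.
have := normc_ge_Re '[x, y]; rewrite lecE/= => /andP[_].
exact/le_trans/ler_norm.
Qed.

Lemma rip_norm_le x y : `|rip x y| <= nrm x * nrm y.
Proof. by rewrite ler_norml rip_le andbT lerNl -ripNl -(nrmN x) rip_le. Qed.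

Lemma rip_ext x y : (forall z, rip x z = rip y z) -> x = y.
Proof.
move=> xy; apply/eqP; rewrite -subr_eq0; apply/eqP/ripxx_eq0.
by rewrite ripDl ripNl xy subrr.
Qed.

Lemma inner_rip x y : '[x, y] = rip x y +i* rip x ('i *: y).
Proof.
rewrite /rip linearZr_LR/=; case: '[x, y] => a b /=.
by rewrite !mul0r sub0r mulN1r opprK.
Qed.

Lemma rip_i x y : rip ('i *: x) y = - rip x ('i *: y).
Proof.
rewrite /rip linearZl_LR linearZr_LR/=; case: '[x, y] => a b /=.
by rewrite !mul0r !sub0r mulN1r opprK mul1r.
Qed.

End RealInnerProduct.
#[global] Hint Extern 0 (is_true (0 <= nrm _)) => exact: nrm_ge0 : core.

Section OperatorNorm.
Variables (R : realType) (V : hilbertType R).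
Implicit Types (x y z : V) (c : R) (S T X : 'B(V)).

Lemma bopD S T x : (S + T) x = S x + T x. Proof. by []. Qed.
Lemma bopN T x : (- T) x = - T x. Proof. by []. Qed.
Lemma bopM S T x : (S * T) x = S (T x). Proof. by []. Qed.
Lemma bopZ (a : R[i]) T x : (a *: T) x = a *: T x. Proof. by []. Qed.
Lemma bop1 x : (1 : 'B(V)) x = x. Proof. by []. Qed.
Lemma bop0 x : (0 : 'B(V)) x = 0. Proof. by []. Qed.
Lemma apD T x y : T (x + y) = T x + T y. Proof. exact: linearD. Qed.
Lemma apN T x : T (- x) = - T x. Proof. exact: linearN. Qed.
Lemma apZ T (a : R[i]) x : T (a *: x) = a *: T x. Proof. exact: linearZ. Qed.
Lemma ap0 T : T 0 = 0. Proof. exact: linear0. Qed.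
Definition bopE := (bopD, bopN, bopM, bopZ, bop1, bop0).
Definition apE := (apD, apN, apZ, ap0).

Lemma bop_rip S T : (forall x y, rip (S x) y = rip (T x) y) -> S = T.
Proof. by move=> ST; apply: bop_ext => x; apply: rip_ext. Qed.

Lemma opnorm_nrm T x : nrm (T x) <= opnorm T * nrm x.
Proof. by rewrite -lecR rmorphM/= !nrmC opnorm_ge. Qed.

Lemma opnorm_leP T c : 0 <= c -> (forall x, nrm (T x) <= c * nrm x) -> opnorm T <= c.
Proof.
move=> c0 H; apply: opnorm_le => x; have -> : (1 : R[i]) = 1%:C by [].
rewrite -!nrmC !lecR => x1.
by rewrite (le_trans (H x))// ler_piMr.
Qed.

Lemma opnorm_le_nrm T c x : opnorm T <= c -> nrm (T x) <= c * nrm x.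
Proof. by move=> Tc; rewrite (le_trans (opnorm_nrm _ _))// ler_wpM2r ?nrm_ge0. Qed.

Lemma opnorm1_nrm T x : opnorm T <= 1 -> nrm (T x) <= nrm x.
Proof. by move=> T1; rewrite -[leRHS]mul1r opnorm_le_nrm. Qed.

Lemma opnorm0 : opnorm (0 : 'B(V)) = 0.
Proof. by apply: complexI; rewrite -bop_normE normr0. Qed.
Lemma opnorm_eq0 T : opnorm T <= 0 -> T = 0.
Proof.
move=> T0; apply/normr0_eq0; rewrite bop_normE.
by have -> : opnorm T = 0 by apply/eqP; rewrite eq_le T0 opnorm_ge0.
Qed.
Lemma opnormD S T : opnorm (S + T) <= opnorm S + opnorm T.
Proof. by rewrite -lecR rmorphD/= -!bop_normE ler_normD. Qed.
Lemma opnormN T : opnorm (- T) = opnorm T.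
Proof. by apply: complexI; rewrite -!bop_normE normrN. Qed.
Lemma opnormB S T : opnorm (S - T) <= opnorm S + opnorm T.
Proof. by rewrite -(opnormN T) opnormD. Qed.
Lemma opnormZ c T : opnorm (c%:C *: T) = `|c| * opnorm T.
Proof.
apply: complexI; rewrite rmorphM/= -!bop_normE normrZ normc_def /= expr0n/= addr0.
by rewrite sqrtr_sqr.
Qed.
Lemma opnormM S T : opnorm (S * T) <= opnorm S * opnorm T.
Proof.
apply: opnorm_leP => [|x]; first by rewrite mulr_ge0 ?opnorm_ge0.
rewrite bopM (le_trans (opnorm_nrm _ _))// -mulrA ler_wpM2l ?opnorm_ge0//.
exact: opnorm_nrm.
Qed.
Lemma opnorm1 : opnorm (1 : 'B(V)) <= 1.
Proof. by apply: opnorm_leP => // x; rewrite mul1r. Qed.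

Lemma ripA T x y : rip (T x) y = rip x (adjoint T y).
Proof. by rewrite /rip adjointE. Qed.
Lemma ripAr T x y : rip x (T y) = rip (adjoint T x) y.
Proof. by rewrite ripC ripA ripC. Qed.

Lemma adjoint_rip S T : (forall x y, rip (T x) y = rip x (S y)) -> S = adjoint T.
Proof.
by move=> H; apply/bop_rip => x y; rewrite ripC -H ripA ripC.
Qed.

Lemma adjointK T : adjoint (adjoint T) = T.
Proof. by apply/esym/adjoint_rip => x y; rewrite ripC -ripA ripC. Qed.
Lemma adjointM S T : adjoint (S * T) = adjoint T * adjoint S.
Proof. by apply/esym/adjoint_rip => x y; rewrite !bopM !ripA. Qed.
Lemma adjointD S T : adjoint (S + T) = adjoint S + adjoint T.
Proof. by apply/esym/adjoint_rip => x y; rewrite !bopD !ripE !ripA. Qed.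
Lemma adjointN T : adjoint (- T) = - adjoint T.
Proof. by apply/esym/adjoint_rip => x y; rewrite !bopN !ripE !ripA. Qed.
Lemma adjoint1 : adjoint (1 : 'B(V)) = 1.
Proof. by apply/esym/adjoint_rip => x y; rewrite !bop1. Qed.

(** One half of the C*-identity: smallness of the product with the adjoint gives smallness of the
    operator. *)
Lemma opnorm_sqr T : opnorm T ^+ 2 <= opnorm (adjoint T * T).
Proof.
set c := opnorm (adjoint T * T).
have c0 : 0 <= c by exact: opnorm_ge0.
suff: opnorm T <= Num.sqrt c.
  move=> H; have -> : c = Num.sqrt c ^+ 2 by rewrite sqr_sqrtr.
  by rewrite ler_pXn2r ?nnegrE ?opnorm_ge0 ?sqrtr_ge0.
apply: opnorm_leP => [|x]; first exact: sqrtr_ge0.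
apply: ler_nrm; first by rewrite mulr_ge0 ?sqrtr_ge0.
rewrite exprMn sqr_sqrtr// ripA -bopM (le_trans (rip_le _ _))//.
by rewrite expr2 mulrC mulrA ler_wpM2r// opnorm_nrm.
Qed.

Lemma opnorm_adjoint T : opnorm (adjoint T) = opnorm T.
Proof.
suff H S : opnorm (adjoint S) <= opnorm S.
  by apply/eqP; rewrite eq_le H -{1}(adjointK T) H.
have := opnorm_sqr (adjoint S); rewrite adjointK => /le_trans/(_ (opnormM _ _)).
have [->|S0] := eqVneq (opnorm (adjoint S)) 0; first by rewrite opnorm_ge0.
by rewrite expr2 ler_pM2r// lt_neqAle eq_sym S0 opnorm_ge0.
Qed.

Definition sym T := forall x y, rip (T x) y = rip x (T y).

Lemma sym_adjoint T : sym T <-> T = adjoint T.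
Proof. by split=> [/adjoint_rip//|TE x y]; rewrite ripA -TE. Qed.

Lemma symD S T : sym S -> sym T -> sym (S + T).
Proof. by move=> sS sT x y; rewrite !bopD !ripE sS sT. Qed.
Lemma symN T : sym T -> sym (- T).
Proof. by move=> sT x y; rewrite !bopN !ripE sT. Qed.
Lemma symZ c T : sym T -> sym (c%:C *: T).
Proof. by move=> sT x y; rewrite !bopZ !ripE sT. Qed.
Lemma sym1 : sym 1. Proof. by []. Qed.
Lemma sym0 : sym 0. Proof. by move=> x y; rewrite !bop0 !ripE. Qed.
Lemma symM S T : sym S -> sym T -> S * T = T * S -> sym (S * T).
Proof. by move=> sS sT ST x y; rewrite {1}ST !bopM sT sS. Qed.
Lemma sym_sqr T : sym T -> sym (T * T).
Proof. by move=> sT; apply: symM. Qed.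

(* Polarization. *)
Lemma opnorm_form_le T c : sym T -> 0 <= c ->
  (forall x, `|rip (T x) x| <= c * rip x x) -> opnorm T <= c.
Proof.
move=> sT c0 Tc.
have H x y : 2 * rip (T x) y <= c * (rip x x + rip y y).
  have := Tc (x + y); have := Tc (x - y); rewrite !ler_norml !apE !ripE.
  rewrite (ripC (T y) x) -sT (ripC y x) => /andP[H _] /andP[_ +].
  by move: H; nra.
apply: opnorm_leP => // x.
have [x0|x0] := eqVneq (nrm x) 0; first by rewrite (nrm0_eq0 x0) ap0 nrm0 mulr0.
have [->|Tx0] := eqVneq (nrm (T x)) 0; first by rewrite mulr_ge0.
(* The second vector is T x rescaled to the norm of x, which balances the two squares in the
   polarised bound. *)
have := H x ((nrm x / nrm (T x))%:C *: T x); rewrite !ripE !ripxx.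
have -> : nrm x / nrm (T x) * (nrm x / nrm (T x) * nrm (T x) ^+ 2) = nrm x ^+ 2.
  by field.
have -> : nrm x / nrm (T x) * nrm (T x) ^+ 2 = nrm x * nrm (T x) by field.
have x1 : 0 < nrm x by rewrite lt_neqAle eq_sym x0 nrm_ge0.
rewrite -(ler_pM2l x1 (nrm (T x))); nra.
Qed.
End OperatorNorm.

(** * Norm limits of operators *)

Section Limits.
Variables (R : realType) (V : hilbertType R).
Implicit Types (x y z : V) (c d e : R) (S T X : 'B(V)).

(** The rate [e] bounds a whole tail and therefore survives the limit; later constructions need this
    explicit distance, not only convergence. *)
Lemma vector_limit (v : nat -> V) (e : nat -> R) :
  (forall n m, (n <= m)%N -> nrm (v m - v n) <= e n) ->
  (forall d, 0 < d -> exists n, e n <= d) ->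
  exists l, forall n, nrm (l - v n) <= e n.
Proof.
move=> ve e0.
have near_v n : \forall m \near \oo, nrm (v m - v n) <= e n.
  by exists n => // m /= nm; apply: ve.
have /cauchy_cvg/cvg_ex[l vl] : cauchy (v @ \oo).
  apply/cauchyP => d d0.
  have dE : d = (complex.Re d)%:C by rewrite RRe_real// gtr0_real.
  move: d0; rewrite {1 2}dE => d0.
  have d20 : 0 < complex.Re d / 2 by rewrite divr_gt0// -ltcR.
  have [n en] := e0 _ d20; exists (v n).
  apply: (@filterS nat \oo _ _ _ _ (near_v n)) => m vmn; rewrite -ball_normE/= dE -nrmC ltcR -nrmN opprB.
  by move: vmn en d20; lra.
exists l => n; apply/ler_addgt0Pr => d d0.
have : \forall m \near \oo, `|l - v m| <= d%:C.
  by have /cvgrPdist_le := vl; apply; rewrite ltcR.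
move=> /(filterI (near_v n))/filter_ex[m [vmn lvm]].
have -> : l - v n = (v m - v n) + (l - v m) by rewrite [RHS]addrC addrA subrK.
rewrite (le_trans (nrmD _ _))// lerD//.
by move: lvm; rewrite -nrmC lecR.
Qed.

Lemma bounded_linearP (f : V -> V) (M : R) : linear f ->
  (forall x, nrm (f x) <= M * nrm x) -> f \in @bounded_linear R V.
Proof.
move=> lf fM; apply/asboolP; split => //.
pose F : {linear V -> V} := HB.pack f (GRing.isLinear.Build _ _ _ _ _ lf).
suff: continuous F by [].
apply/linear_bounded_continuous/linear_boundedP.
near=> r => x.
have rM : M%:C <= r.
  by near: r; apply: nbhs_pinfty_ge; apply/complex_realP; exists M.
rewrite (le_trans _ (ler_wpM2r _ rM))//.
by rewrite -!nrmC -rmorphM/= lecR fM.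
Unshelve. all: by end_near. Qed.

Lemma operator_limit (T : nat -> 'B(V)) (e : nat -> R) :
  (forall n m, (n <= m)%N -> opnorm (T m - T n) <= e n) ->
  (forall d, 0 < d -> exists n, e n <= d) ->
  exists L, forall n, opnorm (L - T n) <= e n.
Proof.
move=> Te e0.
have /choice[f fT] x : exists l, forall n, nrm (l - T n x) <= e n * nrm x.
  apply: (@vector_limit (fun n => T n x) (fun n => e n * nrm x)) => [n m nm|d d0].
    by rewrite -bopN -bopD (opnorm_le_nrm _ (Te _ _ nm)).
  have x1 : 0 < nrm x + 1 by rewrite ltr_wpDl.
  have [|n en] := e0 (d / (nrm x + 1)); first by rewrite divr_gt0.
  exists n; rewrite (le_trans (ler_wpM2r _ en))// mulrAC ler_pdivrMr//.
  by rewrite ler_wpM2l ?ltW// ltrDl.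
have flin : linear f.
  move=> a x y; apply/eqP; rewrite -subr_eq0; apply/eqP/nrm0_eq0/eqP.
  rewrite eq_le nrm_ge0 andbT; apply/ler_addgt0Pl => d d0; rewrite addr0.
  (* [k] collects the factors of [e n] in the three errors below; the summand 1 makes it
     positive. *)
  pose k := nrm (a *: x + y) + complex.Re `|a| * nrm x + nrm y + 1.
  have na : 0 <= complex.Re `|a| by rewrite -ler0c RRe_real ?normr_real.
  have k0 : 0 < k by rewrite /k ltr_wpDl// !addr_ge0// mulr_ge0.
  have [n en] := e0 (d / k) (divr_gt0 d0 k0).
  have -> : f (a *: x + y) - (a *: f x + f y) =
     (f (a *: x + y) - T n (a *: x + y)) - a *: (f x - T n x) - (f y - T n y).
    by rewrite apD apZ scalerBr; apply: rip_ext => z; rewrite !ripE; ring.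
  have nz z : nrm (a *: z) = complex.Re `|a| * nrm z.
    by apply: complexI; rewrite nrmC normrZ -nrmC -[`|a| in LHS](RRe_real (normr_real a)) -rmorphM.
  rewrite (le_trans (nrmB _ _))// (le_trans (lerD (nrmB _ _) (lexx _)))// nz.
  have kd : e n * k <= d by rewrite -ler_pdivlMr.
  have e_ge0 : 0 <= e n.
    by apply: le_trans (Te n n _) => //; rewrite opnorm_ge0.
  have := fT (a *: x + y) n; have := fT y n.
  have := ler_wpM2l na (fT x n); move: kd; rewrite /k.
  move: (nrm _) (nrm _) (nrm _) (nrm _) (nrm _) (nrm _) (complex.Re `|a|) (e n) e_ge0.
  by intros; nra.
have fM x : nrm (f x) <= (opnorm (T 0%N) + e 0%N) * nrm x.
  have -> : f x = T 0%N x + (f x - T 0%N x) by rewrite addrC subrK.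
  by rewrite mulrDl (le_trans (nrmD _ _))// lerD// opnorm_nrm.
exists (Bop (bounded_linearP flin fM)) => n.
apply: opnorm_leP; last by move=> x; exact: fT.
by apply: le_trans (Te n n _) => //; rewrite opnorm_ge0.
Qed.

(** Asymptotic relations, such as an anticommutator tending to 0, concern sequences that need not
    converge themselves. The bound is real, unlike the complex-valued norm. *)
Definition to0 (T : nat -> 'B(V)) :=
  forall e, 0 < e -> \forall n \near \oo, opnorm (T n) <= e.

Lemma cvg_to0 (T : nat -> 'B(V)) L :
  T @ \oo --> L <-> to0 (fun n => T n - L).
Proof.
split=> [/cvgrPdist_le TL e e0|TL].
  have /TL : 0 < e%:C by rewrite ltcR.
  by apply: filterS => n; rewrite bop_normE lecR -opnormN opprB.
apply/cvgrPdist_le => e e0.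
have eE : e = (complex.Re e)%:C by rewrite RRe_real// gtr0_real.
move: e0; rewrite {}eE ltcR => /TL.
by apply: filterS => n; rewrite bop_normE lecR -opnormN opprB.
Qed.

Lemma to0_eq (S T : nat -> 'B(V)) : (forall n, T n = S n) -> to0 S -> to0 T.
Proof. by move=> ST H e /H; apply: filterS => n; rewrite ST. Qed.

Lemma to0_le (S T : nat -> 'B(V)) c :
  (forall n, opnorm (T n) <= c * opnorm (S n)) -> to0 S -> to0 T.
Proof.
move=> TS S0 e e0; pose c' := `|c| + 1.
have c0 : 0 < c' by rewrite ltr_wpDl.
have /S0 : 0 < e / c' by rewrite divr_gt0.
apply: filterS => n; rewrite ler_pdivlMr// mulrC => /(le_trans _); apply.
rewrite (le_trans (TS n))// ler_wpM2r ?opnorm_ge0// (le_trans (ler_norm _))//.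
by rewrite lerDl.
Qed.

Lemma to0_sqr_le (S T : nat -> 'B(V)) :
  (forall n, opnorm (T n) ^+ 2 <= opnorm (S n)) -> to0 S -> to0 T.
Proof.
move=> TS S0 e e0; have /S0 : 0 < e ^+ 2 by rewrite exprn_gt0.
apply: filterS => n /(le_trans (TS n)).
by rewrite ler_pXn2r ?nnegrE ?opnorm_ge0// ltW.
Qed.

Lemma to0D (S T : nat -> 'B(V)) : to0 S -> to0 T -> to0 (fun n => S n + T n).
Proof.
move=> S0 T0 e e0; have e20 : 0 < e / 2 by rewrite divr_gt0.
apply: filterS2 (S0 _ e20) (T0 _ e20) => n Sn Tn.
rewrite (le_trans (opnormD _ _))//; lra.
Qed.

Lemma to0N (T : nat -> 'B(V)) : to0 T -> to0 (fun n => - T n).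
Proof. by apply: (@to0_le _ _ 1) => n; rewrite opnormN mul1r. Qed.

Lemma to0B (S T : nat -> 'B(V)) : to0 S -> to0 T -> to0 (fun n => S n - T n).
Proof. by move=> S0 T0; apply: to0D => //; apply: to0N. Qed.

Lemma to0Z c (T : nat -> 'B(V)) : to0 T -> to0 (fun n => c%:C *: T n).
Proof. by apply: (@to0_le _ _ `|c|) => n; rewrite opnormZ. Qed.

Lemma to0Ml b (S T : nat -> 'B(V)) : (forall n, opnorm (S n) <= b) ->
  to0 T -> to0 (fun n => S n * T n).
Proof.
move=> Sb; apply: (@to0_le _ _ b) => n.
by rewrite (le_trans (opnormM _ _))// ler_wpM2r ?opnorm_ge0.
Qed.

Lemma to0Mr b (S T : nat -> 'B(V)) : (forall n, opnorm (S n) <= b) ->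
  to0 T -> to0 (fun n => T n * S n).
Proof.
move=> Sb; apply: (@to0_le _ _ b) => n.
by rewrite mulrC (le_trans (opnormM _ _))// mulrC [leRHS]mulrC ler_wpM2l ?opnorm_ge0.
Qed.

Lemma to0_adjoint (T : nat -> 'B(V)) : to0 T -> to0 (fun n => adjoint (T n)).
Proof. by apply: (@to0_le _ _ 1) => n; rewrite opnorm_adjoint mul1r. Qed.

Lemma to0_0 : to0 (fun=> 0).
Proof. by move=> e e0; apply: nearW => n; rewrite opnorm0 ltW. Qed.

Lemma to0_const T : to0 (fun=> T) -> T = 0.
Proof.
move=> T0; apply: opnorm_eq0; apply/ler_addgt0Pl => e /T0/filter_ex[_].
by rewrite addr0.
Qed.

Lemma to0_le_const (T : nat -> 'B(V)) c L : to0 (fun n => T n - L) ->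
  (forall n, opnorm (T n) <= c) -> opnorm L <= c.
Proof.
move=> TL Tc; apply/ler_addgt0Pr => e /TL/filter_ex[n].
have -> : L = T n - (T n - L) by rewrite subKr.
rewrite subKr => H.
by rewrite (le_trans (opnormB _ _))// lerD.
Qed.

End Limits.

(** * Square roots *)

Ltac opring := apply: bop_rip => ? ?; rewrite ?bopE ?apE ?ripE; field.

Section SquareRoot.
Variables (R : realType) (V : hilbertType R).
Implicit Types (x y z : V) (c d e b : R) (B L S T X : 'B(V)).

Fixpoint sqrt_scal n : R :=
  if n is m.+1 then (1 + sqrt_scal m ^+ 2) / 2 else 0.

Lemma sqrt_scal_bounds n : 0 <= sqrt_scal n <= 1.
Proof.
elim: n => [|n /andP[? ?]] /=; first by rewrite lexx ler01.
by apply/andP; split; nra.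
Qed.

Lemma sqrt_scal_le n m : (n <= m)%N -> sqrt_scal n <= sqrt_scal m.
Proof.
have H k : sqrt_scal k <= sqrt_scal k.+1.
  by have /= := sqr_ge0 (1 - sqrt_scal k); nra.
by move=> nm; rewrite -(subnKC nm); elim: (m - n)%N => [|k IH];
  rewrite ?addn0// addnS (le_trans IH).
Qed.

(** The fixed point 1 of t -> (1 + t^2) / 2 is double, so the error decays only like 1 / n: one step
    multiplies it by (1 + t) / 2. *)
Lemma sqrt_scal_rate n : (1 - sqrt_scal n) * n.+1%:R <= 2.
Proof.
elim: n => [|n]; first by rewrite /= subr0 mulr1; lra.
have /andP[] := sqrt_scal_bounds n.
rewrite -(natr1 n.+1) /=; move: (sqrt_scal n) (n.+1%:R : R) => t k t0 t1 tk.
have H : (1 - t) * k * ((1 + t) / 2) <= 2 * ((1 + t) / 2) by rewrite ler_wpM2r//; lra.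
by nra.
Qed.

Lemma sqrt_scal_lim d : 0 < d -> exists n, 1 - sqrt_scal n <= d.
Proof.
move=> d0; have [n dn] : exists n : nat, 2 / d <= n.+1%:R.
  exists (Num.bound (2 / d)); rewrite ltW// (lt_le_trans (archi_boundP _)) ?ler_nat//.
  by rewrite divr_ge0// ltW.
exists n; have n0 : (0 : R) < n.+1%:R by rewrite ltr0n.
rewrite -(ler_pM2r n0) (le_trans (sqrt_scal_rate n))//.
by move: dn; rewrite ler_pdivrMr// mulrC.
Qed.

Lemma eq0_of_rate T c : (forall n, opnorm T <= c * (1 - sqrt_scal n)) -> T = 0.
Proof.
move=> Tc; apply: opnorm_eq0; apply/ler_addgt0Pl => e e0; rewrite addr0.
have c0 : 0 < `|c| + 1 by rewrite ltr_wpDl.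
have [n] := sqrt_scal_lim (divr_gt0 e0 c0); rewrite ler_pdivlMr// => H.
rewrite (le_trans (Tc n))// (le_trans _ H)// mulrC ler_wpM2l//.
  by have := sqrt_scal_bounds n; lra.
by rewrite (le_trans (ler_norm _))// lerDl.
Qed.

(* Iteration for [1 - sqrt (1 - X)]; the scalar sequence
   [sqrt_scal], its value at [X = 1], majorises it. *)
Fixpoint sqrt_iter X n : 'B(V) :=
  if n is m.+1 then (2^-1)%:C *: (X + sqrt_iter X m * sqrt_iter X m) else 0.

(** S and T are not known to commute, so the difference of their squares is written in symmetrised
    form; its bound is the scalar difference of squares. *)
Let step X S T a b : opnorm S <= a -> opnorm T <= b -> opnorm (T - S) <= b - a ->
  opnorm ((2^-1)%:C *: (X + T * T) - (2^-1)%:C *: (X + S * S)) <=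
  (1 + b ^+ 2) / 2 - (1 + a ^+ 2) / 2.
Proof.
move=> Sa Tb TS.
have -> : (2^-1)%:C *: (X + T * T) - (2^-1)%:C *: (X + S * S) =
    (2^-1)%:C *: ((2^-1)%:C *: ((T - S) * (T + S) + (T + S) * (T - S))).
  by opring.
rewrite !opnormZ ger0_norm ?invr_ge0// mulrA.
have H : opnorm (T + S) <= b + a by rewrite (le_trans (opnormD _ _))// lerD.
have : opnorm ((T - S) * (T + S) + (T + S) * (T - S)) <= 2 * ((b - a) * (b + a)).
  rewrite (le_trans (opnormD _ _))// mulr_natl mulr2n lerD//;
  rewrite (le_trans (opnormM _ _))// ?[opnorm (T + S) * _]mulrC;
  by rewrite ler_pM ?opnorm_ge0.
by move: (opnorm _) => r; lra.
Qed.

Lemma sqrt_iter_bound X n : opnorm X <= 1 ->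
  opnorm (sqrt_iter X n) <= sqrt_scal n /\ opnorm (sqrt_iter X n.+1 - sqrt_iter X n) <= sqrt_scal n.+1 - sqrt_scal n.
Proof.
move=> X1; elim: n => [|n [IH1 IH2]].
  split; first by rewrite /= opnorm0.
  rewrite /= mulr0 addr0 !subr0 opnormZ expr0n addr0 ger0_norm ?invr_ge0//.
  by rewrite mulrC ler_wpM2r ?invr_ge0.
have H1 : opnorm (sqrt_iter X n.+1) <= sqrt_scal n.+1.
  have -> : sqrt_iter X n.+1 = (sqrt_iter X n.+1 - sqrt_iter X n) + sqrt_iter X n.
    by rewrite subrK.
  by rewrite (le_trans (opnormD _ _))//; lra.
by split; [exact: H1|apply: step].
Qed.

Lemma sqrt_iter_le1 X n : opnorm X <= 1 -> opnorm (sqrt_iter X n) <= 1.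
Proof.
move=> /(sqrt_iter_bound n)[H _]; apply: le_trans H _.
by have /andP[] := sqrt_scal_bounds n.
Qed.

Lemma sqrt_iter_cauchy X n m : opnorm X <= 1 -> (n <= m)%N ->
  opnorm (sqrt_iter X m - sqrt_iter X n) <= 1 - sqrt_scal n.
Proof.
move=> X1 nm; apply: (@le_trans _ _ (sqrt_scal m - sqrt_scal n)); last first.
  by have /andP[_] := sqrt_scal_bounds m; lra.
rewrite -(subnKC nm); elim: (m - n)%N => [|k IH]; first by rewrite addn0 !subrr opnorm0.
rewrite addnS; have [_] := sqrt_iter_bound (n + k) X1; move: IH.
move: (sqrt_iter X (n + k).+1) (sqrt_iter X (n + k)) (sqrt_iter X n) => A B C.
have -> : A - C = (A - B) + (B - C) by rewrite addrA subrK.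
by move=> IH H; rewrite (le_trans (opnormD _ _))//; lra.
Qed.

(** Outside the unit ball the iteration may diverge; [xget] with default 0 makes the definition
    total. *)
Definition sqrt_lim X : 'B(V) :=
  xget 0 [set L | forall n, opnorm (L - sqrt_iter X n) <= 1 - sqrt_scal n].

(* Locked, as are the sums defined below, so that rewriting with [bopD] does
   not see through it. *)
Definition sqrt1m X : 'B(V) := locked (1 - sqrt_lim X).
Lemma sqrt1mE X : sqrt1m X = 1 - sqrt_lim X. Proof. by rewrite /sqrt1m -lock. Qed.

Lemma sqrt_limP X n : opnorm X <= 1 ->
  opnorm (sqrt_lim X - sqrt_iter X n) <= 1 - sqrt_scal n.
Proof.
move=> X1; rewrite /sqrt_lim; case: xgetP => [L _ /(_ n)//|].
have [L HL] := operator_limit (fun n m => @sqrt_iter_cauchy X n m X1) sqrt_scal_lim.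
by move=> /(_ L).
Qed.

Lemma sqrt_lim_le1 X : opnorm X <= 1 -> opnorm (sqrt_lim X) <= 1.
Proof. by move=> /(sqrt_limP 0%N); rewrite /= !subr0. Qed.

(** The recursion passes to the limit. Rearranged, the equation says (1 - L)^2 = 1 - X. *)
Lemma sqrt_lim_eq X : opnorm X <= 1 ->
  sqrt_lim X = (2^-1)%:C *: (X + sqrt_lim X * sqrt_lim X).
Proof.
move=> X1; apply/eqP; rewrite -subr_eq0; apply/eqP/(@eq0_of_rate _ 2) => n.
set L := sqrt_lim X; pose Y := sqrt_iter X n.
have -> : L - (2^-1)%:C *: (X + L * L) =
    (L - sqrt_iter X n.+1) - (2^-1)%:C *: (L * (L - Y) + (L - Y) * Y).
  by rewrite /= -/Y; opring.
rewrite (le_trans (opnormB _ _))// opnormZ ger0_norm ?invr_ge0//.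
have := sqrt_limP n.+1 X1; have := sqrt_limP n X1; rewrite -/L -/Y => H1 H2.
have := sqrt_scal_le (leqnSn n) => H3.
have L1 := sqrt_lim_le1 X1; have Y1 := sqrt_iter_le1 n X1.
have H4 : opnorm (L * (L - Y)) <= 1 - sqrt_scal n.
  rewrite (le_trans (opnormM _ _))// (le_trans _ H1)// ler_piMl ?opnorm_ge0//.
have H5 : opnorm ((L - Y) * Y) <= 1 - sqrt_scal n.
  rewrite (le_trans (opnormM _ _))// (le_trans _ H1)// ler_piMr ?opnorm_ge0//.
have := opnormD (L * (L - Y)) ((L - Y) * Y).
by move: H2 H3 H4 H5; lra.
Qed.

Lemma sqrt1m_sqr X : opnorm X <= 1 -> sqrt1m X * sqrt1m X = 1 - X.
Proof.
move=> /sqrt_lim_eq E; rewrite !sqrt1mE.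
have {}E x : sqrt_lim X x + sqrt_lim X x = X x + sqrt_lim X (sqrt_lim X x).
  rewrite {1 2}E !bopE ?apE -scalerDl -rmorphD/=.
  by rewrite -[2^-1]mul1r -splitr scale1r.
apply: bop_rip => x y; have := congr1 (fun v => rip v y) (E x).
by rewrite !bopE ?apE !ripE; lra.
Qed.

Lemma sqrt_iter_sym X n : sym X -> sym (sqrt_iter X n).
Proof.
move=> sX; elim: n => [|n IH]; first exact: sym0.
by apply/symZ/symD => //; exact: sym_sqr.
Qed.

Lemma sqrt_lim_sym X : sym X -> opnorm X <= 1 -> sym (sqrt_lim X).
Proof.
move=> sX X1; apply/sym_adjoint/eqP; rewrite -subr_eq0; apply/eqP/(@eq0_of_rate _ 2) => n.
have /sym_adjoint E := sqrt_iter_sym n sX.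
have -> : sqrt_lim X - adjoint (sqrt_lim X) =
   (sqrt_lim X - sqrt_iter X n) - adjoint (sqrt_lim X - sqrt_iter X n).
  by rewrite adjointD adjointN -E; opring.
rewrite (le_trans (opnormB _ _))// opnorm_adjoint.
by have := sqrt_limP n X1; lra.
Qed.

Lemma sqrt1m_sym X : sym X -> opnorm X <= 1 -> sym (sqrt1m X).
Proof. by move=> sX X1; rewrite sqrt1mE; apply: symD; [exact: sym1|exact/symN/sqrt_lim_sym]. Qed.

Lemma sqrt1m_ge0 X x : opnorm X <= 1 -> 0 <= rip (sqrt1m X x) x.
Proof.
move=> X1; rewrite sqrt1mE !bopE ?apE !ripE subr_ge0 (le_trans (rip_le _ _))//.
by rewrite ripxx expr2 ler_wpM2r// opnorm1_nrm// sqrt_lim_le1.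
Qed.

(** Each iterate is a fixed polynomial in [X m], so it inherits the intertwining relation. The
    distance from iterate to square root depends on k alone, so k can be fixed before m. *)
Lemma sqrt1m_intertwine (X X' B : nat -> 'B(V)) b :
  (forall m, opnorm (X m) <= 1) -> (forall m, opnorm (X' m) <= 1) ->
  (forall m, opnorm (B m) <= b) -> to0 (fun m => X m * B m - B m * X' m) ->
  to0 (fun m => sqrt1m (X m) * B m - B m * sqrt1m (X' m)).
Proof.
move=> X1 X'1 Bb XB.
have iter k : to0 (fun m => sqrt_iter (X m) k * B m - B m * sqrt_iter (X' m) k).
  elim: k => [|k IH]; first by apply: to0_eq (to0_0 _) => n /=; rewrite mul0r mulr0 subr0.
  have H1 := to0Ml (fun m => sqrt_iter_le1 k (X1 m)) IH.
  have H2 := to0Mr (fun m => sqrt_iter_le1 k (X'1 m)) IH.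
  by apply: to0_eq (to0Z 2^-1 (to0D XB (to0D H1 H2))) => n /=; opring.
have b0 : 0 <= b by apply: le_trans (Bb 0%N); exact: opnorm_ge0.
move=> e e0.
have d0 : 0 < e / (4 * (b + 1)) by rewrite divr_gt0// mulr_gt0// ltr_wpDl.
have [k kE] := sqrt_scal_lim d0.
have e20 : 0 < e / 2 by rewrite divr_gt0.
apply: filterS (iter k _ e20) => m Hm.
have -> : sqrt1m (X m) * B m - B m * sqrt1m (X' m) =
  - (sqrt_iter (X m) k * B m - B m * sqrt_iter (X' m) k)
  - (sqrt_lim (X m) - sqrt_iter (X m) k) * B m
  + B m * (sqrt_lim (X' m) - sqrt_iter (X' m) k).
  by rewrite !sqrt1mE; opring.
have ke : (1 - sqrt_scal k) * b <= e / 4.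
  rewrite mulrC (le_trans (ler_wpM2l b0 kE))//.
  exact: riesz_arith5.
rewrite (le_trans (opnormD _ _))// (le_trans (lerD (opnormB _ _) (lexx _)))// opnormN.
have H1 : opnorm ((sqrt_lim (X m) - sqrt_iter (X m) k) * B m) <= e / 4.
  rewrite (le_trans (opnormM _ _))// (le_trans _ ke)// ler_pM ?opnorm_ge0//.
  exact: sqrt_limP.
have H2 : opnorm (B m * (sqrt_lim (X' m) - sqrt_iter (X' m) k)) <= e / 4.
  rewrite (le_trans (opnormM _ _))// mulrC (le_trans _ ke)// ler_pM ?opnorm_ge0//.
  exact: sqrt_limP.
by move: Hm H1 H2; lra.
Qed.

Lemma to0_cst T : T = 0 -> to0 (fun=> T). Proof. by move=> ->; exact: to0_0. Qed.

Lemma sqrt1m_comm X B : opnorm X <= 1 -> X * B = B * X -> sqrt1m X * B = B * sqrt1m X.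
Proof.
move=> X1 XB; apply/eqP; rewrite -subr_eq0; apply/eqP/to0_const.
apply: (@sqrt1m_intertwine (fun=> X) (fun=> X) (fun=> B) (opnorm B)) => //.
by apply: to0_cst; rewrite XB subrr.
Qed.

End SquareRoot.

(** * Projections, absolute values and signs *)

Section Projections.
Variables (R : realType) (V : hilbertType R).
Implicit Types (u x y z : V) (c d e b : R) (B L S T X P : 'B(V)) (A : set V).

Lemma inner_linr u (a : R[i]) x y :
  '[u, a *: x + y] = (a^*)%R * '[u, x] + '[u, y].
Proof. by rewrite linearD/= linearZr_LR. Qed.

(** The image of x represents the functional y -> <y, x> on [perp A], a Hilbert space to which
    [riesz] applies. *)
Lemma projection_exists A : exists P : 'B(V),
  [/\ sym P, forall x, P x \in orthocompl A & forall x, x \in orthocompl A -> P x = x].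
Proof.
have /choice[g gE] x : exists z : perp A, forall y : perp A, '[\val y, x] = '[\val y, \val z].
  have lf : linear (fun y : perp A => '[\val y, x] : R[i]^o).
    by move=> a u v; rewrite linearDl/= linearZl_LR.
  pose f : {linear perp A -> R[i]^o} :=
    HB.pack (fun y : perp A => '[\val y, x] : R[i]^o) (GRing.isLinear.Build _ _ _ _ _ lf).
  have fM (y : perp A) : `|f y| <= (nrm x)%:C * `|y|.
    by rewrite nrmC mulrC; apply: cauchy_schwarz.
  by have [z zE] := riesz fM; exists z => y; rewrite -perp_innerE -zE.
have gr x (y : perp A) : rip (\val y) x = rip (\val y) (\val (g x)) by rewrite /rip gE.
have eqp (u v : perp A) : (forall y : perp A, rip (\val y) (\val u) = rip (\val y) (\val v)) -> u = v.
  move=> uv; apply/val_inj/eqP; rewrite -subr_eq0; apply/eqP/ripxx_eq0.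
  by have := uv (u - v); rewrite /= ripDr ripNr => ->; rewrite subrr.
have lg : linear (fun x => \val (g x)).
  move=> a x y; suff -> : g (a *: x + y) = a *: g x + g y by [].
  have H (u : perp A) : '[\val u, a *: x + y] = '[\val u, a *: \val (g x) + \val (g y)].
    by rewrite !inner_linr (gE x u) (gE y u).
  by apply: eqp => u; rewrite -gr /rip H.
have gM x : nrm (\val (g x)) <= 1 * nrm x.
  rewrite mul1r; have := rip_le (\val (g x)) x; rewrite gr ripxx.
  have := nrm_ge0 (\val (g x)); rewrite le_eqVlt => /predU1P[<-|g0]; first by [].
  by rewrite expr2 ler_pM2l.
exists (Bop (bounded_linearP lg gM)); split => [x y|x|x xA] /=.
- rewrite [RHS]ripC; apply: etrans (gr y (g x)) _.
  by rewrite ripC; apply/esym/gr.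
- exact: valP.
by have -> : g x = Perp xA by apply: eqp => y; rewrite -gr.
Qed.

Definition projop A : 'B(V) := sval (cid (projection_exists A)).

Lemma projop_sym A : sym (projop A).
Proof. by rewrite /projop; case: cid => P []. Qed.
Lemma projop_mem A x : projop A x \in orthocompl A.
Proof. by rewrite /projop; case: cid => P []. Qed.
Lemma projop_id A x : x \in orthocompl A -> projop A x = x.
Proof. by rewrite /projop; case: cid => P [? ? H]; exact: H. Qed.

(** The kernel of T is the orthogonal complement of the range of its adjoint, which is the form that
    [projop] accepts. *)
Definition kerproj T := projop (range (adjoint T)).

Lemma mem_kerproj T x : (x \in orthocompl (range (adjoint T))) = `[< T x = 0 >].
Proof.
apply/asboolP/asboolP => [H|Tx y [z _ <-]]; last by rewrite -adjointE Tx linear0l.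
by apply: rip_ext => y; rewrite rip0l ripA /rip H//; exists y.
Qed.

Lemma kerproj_sym T : sym (kerproj T).
Proof. exact: projop_sym. Qed.

Lemma mul_kerproj T : T * kerproj T = 0.
Proof.
apply: bop_ext => x; rewrite bopM; apply/asboolP; rewrite -mem_kerproj.
exact: projop_mem.
Qed.

Lemma kerproj_id T x : T x = 0 -> kerproj T x = x.
Proof. by move=> Tx; apply: projop_id; rewrite mem_kerproj; apply/asboolP. Qed.

Lemma kerproj_mulK T X : T * X = 0 -> kerproj T * X = X.
Proof.
move=> TX; apply: bop_ext => x; apply: kerproj_id.
by rewrite -bopM TX.
Qed.

Lemma sym_mulC S T X : sym S -> sym T -> sym X -> S * T = X -> T * S = X.
Proof.
move=> /sym_adjoint SE /sym_adjoint TE /sym_adjoint XE ST.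
by rewrite XE -ST adjointM -SE -TE.
Qed.

Lemma kerproj_mul T : sym T -> kerproj T * T = 0.
Proof. by move=> sT; apply: sym_mulC (mul_kerproj T) => //; [exact: kerproj_sym|exact: sym0]. Qed.

Lemma kerproj_idem T : kerproj T * kerproj T = kerproj T.
Proof. exact/kerproj_mulK/mul_kerproj. Qed.

(** X preserves the kernel of T because it commutes with T, and the complement of the kernel because
    it is self-adjoint. *)
Lemma kerproj_comm T X : sym X -> T * X = X * T -> kerproj T * X = X * kerproj T.
Proof.
move=> /sym_adjoint sX TX.
have H : kerproj T * (X * kerproj T) = X * kerproj T.
  by apply: kerproj_mulK; rewrite mulrA TX -mulrA mul_kerproj mulr0.
rewrite -{}[in RHS]H.
have /sym_adjoint E := kerproj_sym T.
have H : kerproj T * (X * kerproj T) = X * kerproj T.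
  by apply: kerproj_mulK; rewrite mulrA TX -mulrA mul_kerproj mulr0.
by have := congr1 (@adjoint _ _) H; rewrite !adjointM -E -sX -mulrA => <-.
Qed.

End Projections.

Section AbsoluteValue.
Variables (R : realType) (V : hilbertType R).
Implicit Types (u x y z : V) (c d e b : R) (B L S T X P : 'B(V)) (A : set V).

(** T^2 is written as 1 - (1 - T^2), since [sqrt1m] takes the root of 1 - X. For a self-adjoint
    contraction T the argument is again a contraction. *)
Definition absop T : 'B(V) := sqrt1m (1 - T * T).

Lemma absopN T : absop (- T) = absop T.
Proof. by rewrite /absop mulrNN. Qed.

Lemma opnorm_sqr_le1 T : opnorm T <= 1 -> opnorm (T * T) <= 1.
Proof. by move=> T1; rewrite (le_trans (opnormM _ _))// mulr_ile1 ?opnorm_ge0. Qed.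

Lemma opnorm_1subsqr T : sym T -> opnorm T <= 1 -> opnorm (1 - T * T) <= 1.
Proof.
move=> sT T1; apply: opnorm_leP => // x; rewrite mul1r; apply: ler_nrm2.
rewrite !bopE ?apE !ripE (sT (T x) x) (ripC x) (sT (T x) x).
have : nrm (T (T x)) <= nrm (T x) by exact: opnorm1_nrm.
move=> /(lerXn2r 2)-/(_ (nrm_ge0 _) (nrm_ge0 _)); rewrite -!ripxx.
by have := ripxx_ge0 (T x); lra.
Qed.

Lemma absop_sqr T : sym T -> opnorm T <= 1 -> absop T * absop T = T * T.
Proof. by move=> sT T1; rewrite sqrt1m_sqr ?subKr// opnorm_1subsqr. Qed.

Lemma absop_sym T : sym T -> opnorm T <= 1 -> sym (absop T).
Proof.
move=> sT T1; apply: sqrt1m_sym; last exact: opnorm_1subsqr.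
by apply: symD; [exact: sym1|exact/symN/sym_sqr].
Qed.

Lemma absop_ge0 T x : sym T -> opnorm T <= 1 -> 0 <= rip (absop T x) x.
Proof. by move=> sT T1; apply: sqrt1m_ge0; apply: opnorm_1subsqr. Qed.

Lemma absop_nrm T x : sym T -> opnorm T <= 1 -> nrm (absop T x) = nrm (T x).
Proof.
move=> sT T1; apply/eqP; rewrite -(@eqrXn2 _ 2%N)// -!ripxx absop_sym// sT.
by rewrite -!bopM absop_sqr.
Qed.

Lemma absop_le1 T : sym T -> opnorm T <= 1 -> opnorm (absop T) <= 1.
Proof.
by move=> sT T1; apply: opnorm_leP => // x; rewrite mul1r absop_nrm// opnorm1_nrm.
Qed.

Lemma absop_comm_sqr T X : sym T -> opnorm T <= 1 -> T * T * X = X * (T * T) ->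
  absop T * X = X * absop T.
Proof.
move=> sT T1 TX; apply: sqrt1m_comm; first exact: opnorm_1subsqr.
by rewrite mulrBl mulrBr mul1r mulr1 TX.
Qed.

Lemma absop_comm T X : sym T -> opnorm T <= 1 -> T * X = X * T ->
  absop T * X = X * absop T.
Proof.
by move=> sT T1 TX; apply: absop_comm_sqr => //; rewrite -mulrA TX !mulrA TX.
Qed.

Lemma absop_intertwine_sqr (S T B : nat -> 'B(V)) b :
  (forall n, sym (S n)) -> (forall n, opnorm (S n) <= 1) ->
  (forall n, sym (T n)) -> (forall n, opnorm (T n) <= 1) ->
  (forall n, opnorm (B n) <= b) ->
  to0 (fun n => S n * S n * B n - B n * (T n * T n)) ->
  to0 (fun n => absop (S n) * B n - B n * absop (T n)).
Proof.
move=> sS S1 sT T1 Bb H; apply: (sqrt1m_intertwine _ _ Bb) => [n|n|].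
- exact: opnorm_1subsqr.
- exact: opnorm_1subsqr.
by apply: to0_eq (to0N H) => n; opring.
Qed.

Lemma absop_intertwine (S T B : nat -> 'B(V)) b :
  (forall n, sym (S n)) -> (forall n, opnorm (S n) <= 1) ->
  (forall n, sym (T n)) -> (forall n, opnorm (T n) <= 1) ->
  (forall n, opnorm (B n) <= b) ->
  to0 (fun n => S n * B n - B n * T n) ->
  to0 (fun n => absop (S n) * B n - B n * absop (T n)).
Proof.
move=> sS S1 sT T1 Bb H; apply: absop_intertwine_sqr Bb _ => //.
by apply: to0_eq (to0D (to0Ml S1 H) (to0Mr T1 H)) => n; opring.
Qed.

(** Twice the positive part of T; [negp] is twice the negative part. *)
Definition posp T : 'B(V) := locked (absop T + T).
Lemma pospE T : posp T = absop T + T. Proof. by rewrite /posp -lock. Qed.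
Definition negp T : 'B(V) := locked (absop T - T).
Lemma negpE T : negp T = absop T - T. Proof. by rewrite /negp -lock. Qed.
Lemma negp_posp_opp T : negp T = posp (- T).
Proof. by rewrite negpE pospE absopN. Qed.

Lemma posp_sym T : sym T -> opnorm T <= 1 -> sym (posp T).
Proof. by move=> sT T1; rewrite pospE; apply: symD => //; apply: absop_sym. Qed.
Lemma negp_sym T : sym T -> opnorm T <= 1 -> sym (negp T).
Proof. by move=> sT T1; rewrite negpE; apply: symD; [apply: absop_sym|exact: symN]. Qed.

Lemma posp_negp T : sym T -> opnorm T <= 1 -> posp T * negp T = 0.
Proof.
move=> sT T1; have E := absop_sqr sT T1.
have C : absop T * T = T * absop T by apply: absop_comm.
have {}E x : absop T (absop T x) = T (T x) by rewrite -bopM E.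
have {}C x : absop T (T x) = T (absop T x) by rewrite -bopM C.
by rewrite pospE negpE; apply: bop_rip => x y; rewrite !bopE ?apE E C !ripE; ring.
Qed.

Lemma negp_posp T : sym T -> opnorm T <= 1 -> negp T * posp T = 0.
Proof.
move=> sT T1; apply: sym_mulC (posp_negp sT T1); [exact: posp_sym|exact: negp_sym|].
exact: sym0.
Qed.

(** The value is -1 on the whole kernel of the positive part, including the kernel of T, so the
    square is exactly 1 even when T is not injective. *)
Definition sgnop T : 'B(V) := locked (1 - 2%:C *: kerproj (posp T)).
Lemma sgnopE T : sgnop T = 1 - 2%:C *: kerproj (posp T). Proof. by rewrite /sgnop -lock. Qed.

Lemma sgnop_sym T : sym (sgnop T).
Proof. by rewrite sgnopE; apply: symD; [exact: sym1|exact/symN/symZ/kerproj_sym]. Qed.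

Lemma sgnop_sqr T : sgnop T * sgnop T = 1.
Proof.
have E x : kerproj (posp T) (kerproj (posp T) x) = kerproj (posp T) x.
  by rewrite -bopM kerproj_idem.
by rewrite sgnopE; apply: bop_rip => x y; rewrite !bopE ?apE !ripE !E; ring.
Qed.

Let kerproj_absop T : sym T -> opnorm T <= 1 ->
  2%:C *: (kerproj (posp T) * absop T) = negp T.
Proof.
move=> sT T1; have -> : absop T = 2^-1%:C *: (posp T + negp T).
  by rewrite pospE negpE; opring.
have E x : kerproj (posp T) (posp T x) = 0.
  by rewrite -bopM kerproj_mul//; apply: posp_sym.
have E' x : kerproj (posp T) (negp T x) = negp T x.
  by rewrite -bopM kerproj_mulK// posp_negp.
by apply: bop_rip => x y; rewrite !bopE ?apE E E' !ripE; field.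
Qed.

Lemma sgnop_absop T : sym T -> opnorm T <= 1 -> sgnop T * absop T = T.
Proof.
move=> sT T1; rewrite sgnopE mulrBl mul1r.
have -> : 2%:C *: kerproj (posp T) * absop T = 2%:C *: (kerproj (posp T) * absop T).
  by opring.
by rewrite kerproj_absop// negpE; opring.
Qed.

Lemma sgnop_mul T : sym T -> opnorm T <= 1 -> sgnop T * T = absop T.
Proof. by move=> sT T1; rewrite -{2}(sgnop_absop sT T1) mulrA sgnop_sqr mul1r. Qed.

Lemma absop_sgnop T : sym T -> opnorm T <= 1 -> absop T * sgnop T = T.
Proof.
move=> sT T1; apply: sym_mulC (sgnop_absop sT T1) => //; last exact: absop_sym.
exact: sgnop_sym.
Qed.

Lemma mul_sgnop T : sym T -> opnorm T <= 1 -> T * sgnop T = absop T.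
Proof.
move=> sT T1; apply: sym_mulC (sgnop_mul sT T1) => //; last exact: absop_sym.
exact: sgnop_sym.
Qed.

Lemma sgnop_comm T X : sym T -> opnorm T <= 1 -> sym X -> T * X = X * T ->
  sgnop T * X = X * sgnop T.
Proof.
move=> sT T1 sX TX.
have /(congr1 (fun Y : 'B(V) => X - 2%:C *: Y)) : kerproj (posp T) * X = X * kerproj (posp T).
  by apply: kerproj_comm => //; rewrite !pospE mulrDl mulrDr TX absop_comm.
move=> E; transitivity (X - 2%:C *: (kerproj (posp T) * X)); first by rewrite sgnopE; opring.
by rewrite E sgnopE; opring.
Qed.

Lemma opnorm_unit_le1 S : adjoint S * S = 1 -> opnorm S <= 1.
Proof.
move=> SS; apply: opnorm_leP => // x; rewrite mul1r; apply: ler_nrm2.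
by rewrite ripA -bopM SS bop1.
Qed.

Lemma sgnop_le1 T : opnorm (sgnop T) <= 1.
Proof.
apply: opnorm_unit_le1; have /sym_adjoint <- := sgnop_sym T.
exact: sgnop_sqr.
Qed.

(* The spectral projection of [T] for [(0, +oo)]. *)
Definition posproj T : 'B(V) := locked (2^-1%:C *: (1 + sgnop T)).
Lemma posprojE T : posproj T = 2^-1%:C *: (1 + sgnop T). Proof. by rewrite /posproj -lock. Qed.

Lemma posproj_sym T : sym (posproj T).
Proof. by rewrite posprojE; apply/symZ/symD => //; exact: sgnop_sym. Qed.

Lemma posproj_idem T : posproj T * posproj T = posproj T.
Proof.
have E x : sgnop T (sgnop T x) = x by rewrite -bopM sgnop_sqr.
by rewrite !posprojE; apply: bop_rip => x y; rewrite !bopE ?apE E !ripE; field.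
Qed.

Lemma posproj_comm T X : sym T -> opnorm T <= 1 -> sym X -> T * X = X * T ->
  posproj T * X = X * posproj T.
Proof.
move=> sT T1 sX TX; have E x : sgnop T (X x) = X (sgnop T x).
  by rewrite -!bopM sgnop_comm.
by rewrite !posprojE; apply: bop_rip => x y; rewrite !bopE ?apE E !ripE.
Qed.

Lemma mul_posproj T : sym T -> opnorm T <= 1 -> T * posproj T = absop T * posproj T.
Proof.
move=> sT T1; have E x : T (sgnop T x) = absop T x by rewrite -bopM mul_sgnop.
have E' x : absop T (sgnop T x) = T x by rewrite -bopM absop_sgnop.
by rewrite !posprojE; apply: bop_rip => x y; rewrite !bopE ?apE E E' !ripE; ring.
Qed.

Lemma mul_posprojC T : sym T -> opnorm T <= 1 ->
  T * (1 - posproj T) = - (absop T * (1 - posproj T)).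
Proof.
move=> sT T1; have E x : T (sgnop T x) = absop T x by rewrite -bopM mul_sgnop.
have E' x : absop T (sgnop T x) = T x by rewrite -bopM absop_sgnop.
by rewrite !posprojE; apply: bop_rip => x y; rewrite !bopE ?apE E E' !ripE; field.
Qed.

Lemma posproj_ge0 T x : sym T -> opnorm T <= 1 -> posproj T x = x -> 0 <= rip (T x) x.
Proof.
by move=> sT T1 <-; rewrite -{1}bopM mul_posproj// bopM absop_ge0.
Qed.

Lemma posproj_le0 T x : sym T -> opnorm T <= 1 -> posproj T x = 0 -> rip (T x) x <= 0.
Proof.
move=> sT T1 Ex; have xE : (1 - posproj T) x = x by rewrite !bopE ?apE Ex subr0.
by rewrite -{1}xE -bopM mul_posprojC// bopN bopM xE ripNl oppr_le0 absop_ge0.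
Qed.

Lemma posp_ge0 T x : sym T -> opnorm T <= 1 -> 0 <= rip (posp T x) x.
Proof.
move=> sT T1; have E y : posproj T (posproj T y) = posproj T y by rewrite -bopM posproj_idem.
have -> : posp T x = 2%:C *: T (posproj T x).
  have E1 : T (sgnop T x) = absop T x by rewrite -bopM mul_sgnop.
  by apply: rip_ext => y; rewrite !pospE !posprojE !bopE ?apE E1 !ripE; field.
rewrite -E -bopM -posproj_comm// bopM ripZl posproj_sym.
by rewrite mulr_ge0// posproj_ge0.
Qed.

Lemma negp_ge0 T x : sym T -> opnorm T <= 1 -> 0 <= rip (negp T x) x.
Proof.
by move=> sT T1; rewrite negp_posp_opp; apply: posp_ge0; [exact: symN|rewrite opnormN].
Qed.

End AbsoluteValue.

(** * Symmetries, and from an approximate unitary to an approximate symmetry *)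

Section Symmetries.
Variables (R : realType) (V : hilbertType R).
Implicit Types (u x y z : V) (c d e b : R) (A B D H J L P Q S T U X : 'B(V)).

Lemma bop_apply S T : S = T -> forall x, S x = T x.
Proof. by move=> ->. Qed.

Lemma unitary_le1 U : unitary U -> opnorm U <= 1.
Proof. by move=> [UU _]; apply: opnorm_unit_le1. Qed.

Lemma adjoint_unitary U : unitary U -> unitary (adjoint U).
Proof. by move=> [? ?]; split; rewrite adjointK. Qed.

Lemma symmetry_le1 J : sym J -> J * J = 1 -> opnorm J <= 1.
Proof. by move=> /sym_adjoint sJ JJ; apply: opnorm_unit_le1; rewrite -sJ. Qed.

Lemma projectionP P : orthogonal_projection P <-> sym P /\ P * P = P.
Proof.
by rewrite /orthogonal_projection expr2; split=> -[/sym_adjoint ? ?]; split.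
Qed.

(** J commutes with D^2, hence with C = sqrt (1 - D^2). So J C anticommutes with D and both D + J C
    and - D + J C have square 1; symmetries correspond to projections. *)
Lemma anticommuting_difference D J : sym D -> opnorm D <= 1 ->
  sym J -> J * J = 1 -> J * D = - (D * J) -> difference_of_projections D.
Proof.
move=> sD D1 sJ JJ JD; pose C := sqrt1m (D * D).
have DD1 := opnorm_sqr_le1 D1.
have sC : sym C by apply: sqrt1m_sym => //; exact: sym_sqr.
have {}JD x : J (D x) = - D (J x) by rewrite -bopM JD.
have {}JJ x : J (J x) = x by rewrite -bopM JJ.
have CC x : C (C x) = x - D (D x) by rewrite -bopM sqrt1m_sqr.
have CJ x : C (J x) = J (C x).
  rewrite -!bopM /C sqrt1m_comm//.
  by apply: bop_ext => {}x; rewrite !bopE ?apE !JD apN opprK.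
have CD x : C (D x) = D (C x) by rewrite -!bopM /C sqrt1m_comm// mulrA.
have sB : sym (J * C) by apply: symM => //; apply: bop_ext => x; rewrite !bopM CJ.
exists (2^-1%:C *: (1 + D + J * C)), (2^-1%:C *: (1 - D + J * C)).
have sD' := symN sD.
split; [apply/projectionP|apply/projectionP|by opring]; split.
- by apply/symZ/symD => //; apply/symD.
- apply: bop_rip => x y; rewrite !bopE ?apE !(CJ, CD, JD, JJ, CC, apN, apD) !ripE.
  by field.
- by apply/symZ/symD => //; apply/symD.
- apply: bop_rip => x y; rewrite !bopE ?apE !(CJ, CD, JD, JJ, CC, apN, apD) !ripE.
  by field.
Qed.

Lemma projection_le1 P : sym P -> P * P = P -> opnorm P <= 1.
Proof.
move=> sP PP; apply: opnorm_leP => // x; rewrite mul1r.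
have [->|Px] := eqVneq (nrm (P x)) 0; first exact: nrm_ge0.
have Px0 : 0 < nrm (P x) by rewrite lt_neqAle eq_sym Px nrm_ge0.
rewrite -(ler_pM2l Px0) -expr2 -ripxx sP -bopM PP ripC.
exact: rip_le.
Qed.

(** T X times its adjoint is T X^2 T, so the C*-identity applies. *)
Lemma to0_sqrt (T X : nat -> 'B(V)) b : (forall n, sym (T n)) -> (forall n, sym (X n)) ->
  (forall n, opnorm (T n) <= b) -> to0 (fun n => T n * (X n * X n)) ->
  to0 (fun n => T n * X n).
Proof.
move=> sT sX Tb H.
apply: (@to0_sqr_le _ _ (fun n => T n * (X n * X n) * T n)) => [n|]; last exact: to0Mr H.
rewrite -opnorm_adjoint adjointM; have /sym_adjoint <- := sT n; have /sym_adjoint <- := sX n.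
apply: le_trans (opnorm_sqr _) _; rewrite adjointM.
by have /sym_adjoint <- := sT n; have /sym_adjoint <- := sX n; rewrite !mulrA.
Qed.

(** With J = sgn S one has J |S| = S, so (H J + J H) |S| = (H S + S H) + J (H |S| - |S| H). *)
Lemma sgnop_anticommute (H S : nat -> 'B(V)) :
  (forall n, sym (S n)) -> (forall n, opnorm (S n) <= 1) ->
  to0 (fun n => H n * S n + S n * H n) ->
  to0 (fun n => H n * absop (S n) - absop (S n) * H n) ->
  to0 (fun n => (H n * sgnop (S n) + sgnop (S n) * H n) * absop (S n)).
Proof.
move=> sS S1 HS HA.
apply: to0_eq (to0D HS (to0Ml (fun n => sgnop_le1 (S n)) HA)) => n.
have E x : sgnop (S n) (absop (S n) x) = S n x by rewrite -bopM sgnop_absop.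
by apply: bop_rip => x y; rewrite !bopE ?apE !E !ripE; ring.
Qed.

Lemma symmetric_anticommutators H J : sym H -> sym J -> sym (H * J + J * H).
Proof. by move=> sH sJ x y; rewrite !bopE ?apE !ripE !(sH, sJ) addrC. Qed.

Lemma anticommutator_le H J : opnorm H <= 1 -> opnorm J <= 1 ->
  opnorm (H * J + J * H) <= 2.
Proof.
move=> H1 J1; rewrite (le_trans (opnormD _ _))// -[2]/(1 + 1) lerD//;
  by rewrite (le_trans (opnormM _ _))// mulr_ile1 ?opnorm_ge0.
Qed.

Lemma approx_symmetry H (U : nat -> 'B(V)) : sym H -> opnorm H <= 1 ->
  (forall n, unitary (U n)) -> to0 (fun n => H * U n + U n * H) ->
  exists J : nat -> 'B(V),
    (forall n, sym (J n) /\ J n * J n = 1) /\ to0 (fun n => H * J n + J n * H).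
Proof.
move=> sH H1 uU HU; pose a := posp H; pose b := negp H.
have sa : sym a by exact: posp_sym.
have sb : sym b by exact: negp_sym.
have a2 : opnorm a <= 2.
  by rewrite /a pospE (le_trans (opnormD _ _))// -[2]/(1 + 1) lerD// absop_le1.
have b2 : opnorm b <= 2.
  by rewrite /b negpE (le_trans (opnormB _ _))// -[2]/(1 + 1) lerD// absop_le1.
pose U' n := adjoint (U n).
have U1 n : opnorm (U n) <= 1 by apply: unitary_le1.
have U'1 n : opnorm (U' n) <= 1 by rewrite /U' opnorm_adjoint.
(* U asymptotically conjugates H into - H, hence |H| into |H| and the positive part into the
   negative one. *)
pose d n := a * U n - U n * b.
have d0 : to0 d.
  have HA : to0 (fun n => absop H * U n - U n * absop H).
    apply: (@absop_intertwine_sqr _ _ (fun=> H) (fun=> H) U 1) => //.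
    have cH (n : nat) : opnorm H <= 1 by [].
    by apply: to0_eq (to0B (to0Ml cH HU) (to0Mr cH HU)) => n; opring.
  by apply: to0_eq (to0D HA HU) => n; rewrite /d /a /b pospE negpE; opring.
(* Adding the adjoint makes the operator self-adjoint. As a and b have norm at most 2, each summand
   is at most 4, and the factor gives a contraction. *)
pose S n := 8^-1%:C *: (a * U n * b + b * U' n * a).
have sS n : sym (S n).
  apply: symZ => x y; rewrite !bopE ?apE !ripE /U' (sa _ y) (ripA (U n)) (sb x).
  by rewrite (sb _ y) -ripAr (sa x) addrC.
have abU (X Y Z : 'B(V)) : opnorm X <= 2 -> opnorm Y <= 1 -> opnorm Z <= 2 ->
    opnorm (X * Y * Z) <= 4.
  move=> X2 Y1 Z2; rewrite (le_trans (opnormM _ _))//.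
  have : opnorm (X * Y) <= 2.
    rewrite (le_trans (opnormM _ _))// -[2]mulr1 ler_pM ?opnorm_ge0//.
  have -> : (4 : R) = 2 * 2 by ring.
  by move=> XY; rewrite ler_pM ?opnorm_ge0.
have S1 n : opnorm (S n) <= 1.
  rewrite opnormZ ger0_norm ?invr_ge0// ler_pdivrMl// mulr1.
  have := opnormD (a * U n * b) (b * U' n * a).
  have := abU a (U n) b a2 (U1 n) b2; have := abU b (U' n) a b2 (U'1 n) a2.
  by lra.
have UU n x : U n (U' n x) = x by rewrite -bopM (uU n).2.
have U'U n x : U' n (U n x) = x by rewrite -bopM (uU n).1.
have ab x : a (b x) = 0 by rewrite -bopM posp_negp.
have ba x : b (a x) = 0 by rewrite -bopM negp_posp.
(* The cross terms of (S n)^2 vanish since a b = 0, and the others approach a^4 + b^4 = 16 H^4; with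
   the factor 1 / 64 this is K^2. *)
pose K := 2^-1%:C *: (H * H).
have sK : sym K by apply/symZ/sym_sqr.
have K1 : opnorm K <= 1.
  rewrite opnormZ ger0_norm ?invr_ge0// ler_pdivrMl// mulr1.
  by have := opnorm_sqr_le1 H1; lra.
have AH z : absop H (H z) = H (absop H z) by rewrite -!bopM absop_comm.
have AA z : absop H (absop H z) = H (H z) by rewrite -!bopM absop_sqr.
have aH x : a (H x) = H (a x) by rewrite /a !pospE !bopE ?apE AH.
have bH x : b (H x) = H (b x) by rewrite /b !negpE !bopE ?apE AH.
have aa x : a (a x) = 2%:C *: H (a x).
  by apply: rip_ext => y; rewrite /a !pospE !bopE ?apE AH AA !ripE; ring.
have bb x : b (b x) = - (2%:C *: H (b x)).
  by apply: rip_ext => y; rewrite /b !negpE !bopE ?apE AH AA !ripE; ring.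
have ab4 x y : rip (a (a (a (a x)))) y =
    16 * rip (H (H (H (H x)))) y - rip (b (b (b (b x)))) y.
  rewrite !(aa, bb, aH, bH, apZ, apN) !ripE.
  by rewrite /a /b pospE negpE !bopE ?apE !ripE; ring.
pose d' n := adjoint (d n).
have d'E n x : d' n x = U' n (a x) - b (U' n x).
  rewrite /d' /d adjointD adjointN !adjointM.
  by have /sym_adjoint <- := sa; have /sym_adjoint <- := sb.
have SK : to0 (fun n => S n * S n * 1 - 1 * (K * K)).
  have ca (n : nat) : opnorm a <= 2 by [].
  have cb (n : nat) : opnorm b <= 2 by [].
  have d'0 : to0 d' by exact: to0_adjoint.
  (* [R1] and [R2] are the errors of turning a U b b U^* a into a^4; [R3] and [R4] those of turning
     b U^* a a U b into b^4. *)
  have R1 : to0 (fun n => a * (d n * (U' n * (a * a)))).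
    apply: (to0Ml ca); apply: (@to0Mr _ _ (opnorm (a * a))) d0 => n.
    by rewrite (le_trans (opnormM _ _))// ler_piMl ?opnorm_ge0.
  have R2 : to0 (fun n => a * U n * b * (d' n * a)).
    by apply: (@to0Ml _ _ 4) => [n|]; [exact: abU|exact: to0Mr ca d'0].
  have R3 : to0 (fun n => b * U' n * a * (d n * b)).
    by apply: (@to0Ml _ _ 4) => [n|]; [exact: abU|exact: to0Mr cb d0].
  have R4 : to0 (fun n => b * (U' n * (d n * (b * b)))).
    by apply: (to0Ml cb); apply: (to0Ml U'1); apply: (@to0Mr _ _ (opnorm (b * b))) d0.
  apply: to0_eq (to0Z 64^-1 (to0B (to0D R3 R4) (to0D R1 R2))) => n.
  apply: bop_rip => x y; rewrite /S /K /d !bopE ?apE !(d'E, ab, ba, UU, U'U, apD, apN, ap0) !ripE.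
  rewrite !ab4.
  by field.
(* The identity as intertwiner turns convergence of the squares into convergence of the absolute
   values. *)
have KS : to0 (fun n => absop (S n) - absop K).
  have c1 (n : nat) : opnorm (1 : 'B(V)) <= 1 by exact: opnorm1.
  have := absop_intertwine_sqr sS S1 (fun=> sK) (fun=> K1) c1 SK.
  by apply: to0_eq => n; rewrite mulr1 mul1r.
pose J n := sgnop (S n).
have sJ n : sym (J n) by exact: sgnop_sym.
have JJ n : J n * J n = 1 by exact: sgnop_sqr.
have J1 n : opnorm (J n) <= 1 by exact: sgnop_le1.
exists J; split => //.
pose T n := H * J n + J n * H.
have cH (n : nat) : opnorm H <= 1 by [].
have sT n : sym (T n) by exact: symmetric_anticommutators.
have T2 n : opnorm (T n) <= 2 by exact: anticommutator_le.
have HA : to0 (fun n => H * absop (S n) - absop (S n) * H).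
  have HK x : absop K (H x) = H (absop K x).
    by rewrite -!bopM absop_comm// /K; opring.
  apply: to0_eq (to0B (to0Ml cH KS) (to0Mr cH KS)) => n.
  move: (absop (S n)) (absop K) HK => s k HK.
  by apply: bop_rip => x y; rewrite !bopE ?apE !HK !ripE; ring.
have HS : to0 (fun n => H * S n + S n * H).
  have ca (n : nat) : opnorm a <= 2 by [].
  have cb (n : nat) : opnorm b <= 2 by [].
  have HU' := to0_adjoint HU.
  apply: to0_eq (to0Z 8^-1 (to0D (to0Ml ca (to0Mr cb HU)) (to0Ml cb (to0Mr ca HU')))) => n.
  rewrite adjointD !adjointM; have /sym_adjoint <- := sH; rewrite -/(U' n) /S.
  by apply: bop_rip => x y; rewrite !bopE ?apE !(aH, bH) !ripE; field.
have TA : to0 (fun n => T n * absop (S n)) by apply: sgnop_anticommute.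
have TK : to0 (fun n => T n * absop K).
  apply: to0_eq (to0B TA (to0Ml T2 KS)) => n.
  by move: (T n) (absop (S n)) (absop K) => t s k; opring.
have TKK : to0 (fun n => T n * ((H * H) * (H * H))).
  have cK (n : nat) : opnorm (absop K) <= 1 by apply: absop_le1.
  apply: to0_eq (to0Z 4 (to0Mr cK TK)) => m.
  have E' x : absop K (absop K x) = 4^-1%:C *: H (H (H (H x))).
    by rewrite -bopM absop_sqr//; apply: rip_ext => y; rewrite /K !bopE ?apE !ripE; field.
  move: (T m) (absop K) E' => t k E'.
  by apply: bop_rip => x y; rewrite !bopE E' ?apE !ripE; field.
(* Two square roots lead from H^4 to H^2 and from H^2 to H. *)
have TH : to0 (fun n => T n * H).
  apply: (to0_sqrt sT (fun=> sH) T2).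
  exact: (to0_sqrt sT (fun=> sym_sqr sH) T2).
(* J commutes with T because J^2 = 1, so T^2 = T (H J + J H) = T H J + J T H. *)
apply: (@to0_sqr_le _ _ (fun n => T n * T n)) => [n|].
  by apply: le_trans (opnorm_sqr _) _; have /sym_adjoint <- := sT n.
apply: to0_eq (to0D (to0Mr J1 TH) (to0Ml J1 TH)) => n.
have JJx x : J n (J n x) = x by rewrite -bopM JJ.
by apply: bop_rip => x y; rewrite /T !bopE ?apE !JJx !ripE; ring.
Qed.

(** S^2 - 1 = (|S| + 1) (|S| - 1) and |S| + 1 is bounded below by 1, so |S| tends to 1; finally sgn
    S - S = - sgn S (|S| - 1). *)
Lemma sgnop_round (S : nat -> 'B(V)) : (forall n, sym (S n)) -> (forall n, opnorm (S n) <= 1) ->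
  to0 (fun n => S n * S n - 1) -> to0 (fun n => sgnop (S n) - S n).
Proof.
move=> sS S1 SS; pose A n := absop (S n) - 1.
have A0 : to0 A.
  apply: (@to0_le _ _ _ _ 1) SS => n.
  rewrite mul1r; apply: opnorm_leP => [|x]; first exact: opnorm_ge0.
  apply: le_trans (opnorm_nrm _ _).
  have -> : (S n * S n - 1) x = absop (S n) (A n x) + A n x.
    have E : absop (S n) (absop (S n) x) = S n (S n x) by rewrite -!bopM absop_sqr.
    by apply: rip_ext => y; rewrite /A !bopE ?apE E !ripE; ring.
  move: (A n x) => y.
  have [->|y0] := eqVneq (nrm y) 0; first exact: nrm_ge0.
  have yp : 0 < nrm y by rewrite lt_neqAle eq_sym y0 nrm_ge0.
  rewrite -(ler_pM2r yp) -expr2 -ripxx; apply: le_trans (rip_le _ _).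
  by rewrite ripDl lerDr absop_ge0.
apply: to0_eq (to0N (to0Ml (fun n => sgnop_le1 (S n)) A0)) => n.
have E x : sgnop (S n) (absop (S n) x) = S n x by rewrite -bopM sgnop_absop.
by apply: bop_rip => x y; rewrite /A !bopE ?apE E !ripE; ring.
Qed.

End Symmetries.

(** * Absorption of countable factors by infinite sets *)

Section InfiniteCardinals.
Variable T : pointedType.
Implicit Types (X Y : set T).

Let triples := (T * nat * T)%type.

(* [G] is the graph of an injection [A * nat -> A] for some [A] included in [X]. *)
Let absorbing X : set (set triples) := [set G |
  [/\ forall x n y y', G (x, n, y) -> G (x, n, y') -> y = y',
      forall x n x' n' y, G (x, n, y) -> G (x', n', y) -> x = x' /\ n = n',
      forall x n y, G (x, n, y) -> X x,
      forall x n y m, G (x, n, y) -> exists z, G (x, m, z) &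
      forall x n y, G (x, n, y) -> exists z, G (y, 0%N, z)]].

Let absorbing_bigcup X (F : set (set triples)) : F `<=` absorbing X ->
  total_on F subset -> absorbing X (\bigcup_(G in F) G).
Proof.
move=> FX Ftot.
have common p q : (\bigcup_(G in F) G) p -> (\bigcup_(G in F) G) q ->
    exists G, [/\ F G, G p & G q].
  move=> [G FG Gp] [G' FG' G'q]; have [GG'|G'G] := Ftot _ _ FG FG'.
    by exists G'; split => //; apply: GG'.
  by exists G; split => //; apply: G'G.
split.
- move=> x n y y' H H'; have [G [FG Gy Gy']] := common _ _ H H'.
  by have [I _ _ _ _] := FX _ FG; apply: I Gy Gy'.
- move=> x n x' n' y H H'; have [G [FG Gy Gy']] := common _ _ H H'.
  by have [_ I _ _ _] := FX _ FG; apply: I Gy Gy'.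
- by move=> x n y [G FG Gy]; have [_ _ I _ _] := FX _ FG; apply: I Gy.
- move=> x n y m [G FG Gy]; have [_ _ _ I _] := FX _ FG.
  by have [z Gz] := I _ _ _ m Gy; exists z, G.
- move=> x n y [G FG Gy]; have [_ _ _ _ I] := FX _ FG.
  by have [z Gz] := I _ _ _ Gy; exists z, G.
Qed.

(** Zorn's lemma is applied to graphs, whose unions along chains are plain unions of sets. A maximal
    domain A misses only finitely many points of X, and those can be moved into A. *)
Lemma infinite_absorb X : infinite_set X -> exists f : T -> nat -> T,
  (forall x n, X x -> X (f x n)) /\
  (forall x x' n n', X x -> X x' -> f x n = f x' n' -> x = x' /\ n = n').
Proof.
move=> Xinf; have [G [GX Gmax]] := Zorn_bigcup (@absorbing_bigcup X).
have [Gfun Ginj GsubX Gtot Gran] := GX.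
pose A := [set x | exists z, G (x, 0%N, z)].
have AX : A `<=` X by move=> x [z /GsubX].
have GA x n y : G (x, n, y) -> A x /\ A y.
  by move=> Gy; split; [exact: Gtot Gy|exact: Gran Gy].
have finXA : finite_set (X `\` A).
  apply: contrapT => /infiniteP/pcard_leP[g].
  have gXA i : (X `\` A) (g i) by apply: funS.
  have ginj i j : g i = g j -> i = j by move=> /inj; apply; rewrite in_setE.
  (* A sequence g outside A would carry its own absorbing injection, obtained by coding pairs of
     indices, and so enlarge G. *)
  pose G' := G `|` [set p | exists i n, p = (g i, n, g (pickle (i, n)))].
  apply: (Gmax G'); first split.
  - exact: subsetUl.
  - move=> G'G; have Gz : G (g 0%N, 0%N, g (pickle (0%N, 0%N))).
      by apply: G'G; right; exists 0%N, 0%N.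
    by have [_] := gXA 0%N; apply; exists (g (pickle (0%N, 0%N))).
  split.
  - move=> x n y y' [Gy|[i [m [-> -> ->]]]] [Gy'|[j [k]]].
    + exact: Gfun Gy Gy'.
    + by move=> [xE _ _]; have [xA _] := GA _ _ _ Gy; have [_] := gXA j; rewrite -xE.
    + by have [xA _] := GA _ _ _ Gy'; have [_] := gXA i.
    + by move=> [/ginj-> -> ->].
  - move=> x n x' n' y [Gy|[i [m [-> -> ->]]]] [Gy'|[j [k]]].
    + exact: Ginj Gy Gy'.
    + by move=> [_ _ yE]; have [_ yA] := GA _ _ _ Gy; have [_] := gXA (pickle (j, k)); rewrite -yE.
    + by have [_ yA] := GA _ _ _ Gy'; have [_] := gXA (pickle (i, m)).
    + by move=> [-> -> /ginj/(pcan_inj pickleK)[-> ->]].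
  - move=> x n y [/GsubX//|[i [m [-> _ _]]]]; exact: (gXA i).1.
  - move=> x n y m [Gy|[i [k [-> _ _]]]].
      by have [z Gz] := Gtot _ _ _ m Gy; exists z; left.
    by exists (g (pickle (i, m))); right; exists i, m.
  - move=> x n y [Gy|[i [k [_ _ ->]]]].
      by have [z Gz] := Gran _ _ _ Gy; exists z; left.
    by exists (g (pickle (pickle (i, k), 0%N))); right; exists (pickle (i, k)), 0%N.
have /choice[h hG] (p : T * nat) : exists y, A p.1 -> G (p, y).
  have [[z Gz]|nA] := pselect (A p.1); last by exists point.
  by have [y Gy] := Gtot _ _ _ p.2 Gz; exists y => _; case: p Gy Gz.
have hA x n : A x -> A (h (x, n)) by move=> xA; have [] := GA _ _ _ (hG (x, n) xA).
have hinj x n x' n' : A x -> A x' -> h (x, n) = h (x', n') -> x = x' /\ n = n'.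
  move=> xA x'A hE; have := hG (x, n) xA; rewrite hE => H.
  exact: Ginj H (hG (x', n') x'A).
have [a aA] : A !=set0.
  apply/set0P/eqP => A0; apply: Xinf; by move: finXA; rewrite A0 setD0.
have /countable_injP[k kinj] := finite_set_countable finXA.
(* Points of A use column 0; the remaining ones go to the row of [a] in columns from 1 on, so no
   values collide. *)
pose i x := if pselect (A x) then h (x, 0%N) else h (a, (k x).+1).
have iA x : A (i x) by rewrite /i; case: pselect => ?; apply: hA.
have iinj x x' : X x -> X x' -> i x = i x' -> x = x'.
  rewrite /i => xX x'X; case: pselect => xA; case: pselect => x'A /hinj.
  - by case.
  - by case.
  - by case.
  - case=> // _ [] /kinj; apply; rewrite in_setE; split => //.
exists (fun x n => h (i x, n)); split=> [x n _|x x' n n' xX x'X].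
  exact/AX/hA.
by move=> /hinj[]// /iinj-> // ->.
Qed.

(** Numbering every fibre embeds X into the product of Y with two copies of nat; [pickle] merges the
    copies and [infinite_absorb] removes the result. *)
Lemma card_le_countable_fibers X Y (phi : T -> T * nat) : infinite_set Y ->
  (forall x, X x -> Y (phi x).1) ->
  (forall p, countable [set x | X x /\ phi x = p]) -> (X #<= Y)%card.
Proof.
move=> /infinite_absorb[f [fY finj]] phiY phic.
have /choice[k kinj] p : exists k : T -> nat,
    {in [set x | X x /\ phi x = p] &, injective k}.
  exact/countable_injP.
apply/pcard_leP; apply/injfunPex.
exists (fun x => f (phi x).1 (pickle ((phi x).2, k (phi x) x))).
  by move=> x xX; apply/fY/phiY.
move=> x x'; rewrite !in_setE => xX x'X /finj[||p1]; [exact: phiY|exact: phiY|].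
move=> /(pcan_inj pickleK)[p2].
have pE : phi x = phi x' by rewrite (surjective_pairing (phi x)) p1 p2 -surjective_pairing.
by rewrite pE => /(kinj (phi x')); apply; rewrite in_setE.
Qed.

End InfiniteCardinals.

(** * Orthonormal bases *)

Section OrthonormalBases.
Variables (R : realType) (V : hilbertType R).
Implicit Types (u v w x y z : V) (Y W : set V) (c : V -> R[i]) (P Q Z : 'B(V)).
Implicit Types (s t : seq V).

Definition orthonormal Y := (forall y, Y y -> nrm y = 1) /\
  (forall y y', Y y -> Y y' -> y != y' -> '[y, y'] = 0).

Definition sqn (a : R[i]) : R := complex.Re (a * (a^*)%R).

Lemma sqnC a : (sqn a)%:C = `|a| ^+ 2.
Proof. by rewrite /sqn -normCK RRe_real// rpredX// normr_real. Qed.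

Lemma sqn_ge0 a : 0 <= sqn a.
Proof. by rewrite -ler0c sqnC exprn_ge0. Qed.

Lemma sqn_conj a : sqn (a^*)%R = sqn a.
Proof. by rewrite /sqn conjCK mulrC. Qed.

Lemma sqn_inner x y : sqn '[x, y] = sqn '[y, x].
Proof. by rewrite inner_conj sqn_conj. Qed.

(** Coefficients are indexed by the vectors themselves, so one function [c] serves all finite
    subsets. *)
Definition lincomb c s : V := \sum_(y <- s) c y *: y.
Definition sqsum c s : R := \sum_(y <- s) sqn (c y).

Lemma inner_lincomb0 Y c s v : orthonormal Y -> Y v -> {in s, forall y, Y y} ->
  v \notin s -> '[lincomb c s, v] = 0.
Proof.
move=> [_ oY] Yv; rewrite /lincomb; elim: s => [|y s IH] sY.
  by rewrite big_nil linear0l.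
rewrite inE negb_or => /andP[vy vs]; rewrite big_cons linearDl/= linearZl_LR/= IH//.
  by rewrite oY ?mulr0 ?addr0// 1?eq_sym//; apply: sY; rewrite mem_head.
by move=> z zs; apply: sY; rewrite inE zs orbT.
Qed.

Lemma inner_unit y : nrm y = 1 -> '[y, y] = 1.
Proof. by move=> y1; rewrite -sqr_norm_inner -nrmC y1 expr1n. Qed.

Lemma inner_lincomb Y c s v : orthonormal Y -> {in s, forall y, Y y} -> uniq s ->
  v \in s -> '[lincomb c s, v] = c v.
Proof.
move=> oY; elim: s => [//|y s IH] sY /= /andP[ys us].
rewrite /lincomb big_cons linearDl/= linearZl_LR/= -/(lincomb c s).
have Yy : Y y by apply: sY; rewrite mem_head.
have sY' : {in s, forall z, Y z} by move=> z zs; apply: sY; rewrite inE zs orbT.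
rewrite inE => /predU1P[->|vs].
  by rewrite (inner_lincomb0 _ oY)// addr0 inner_unit ?mulr1//; apply: oY.1.
rewrite IH//.
have -> : '[y, v] = 0.
  by apply: oY.2 => //; [exact: sY'|apply: contraNneq ys => ->].
by rewrite mulr0 add0r.
Qed.

Lemma nrm_lincomb Y c s : orthonormal Y -> {in s, forall y, Y y} -> uniq s ->
  nrm (lincomb c s) ^+ 2 = sqsum c s.
Proof.
move=> oY; elim: s => [|y s IH] sY /=.
  by rewrite /lincomb /sqsum !big_nil nrm0 expr0n.
move=> /andP[ys us]; rewrite /sqsum big_cons -/(sqsum c s).
have Yy : Y y by apply: sY; rewrite mem_head.
have sY' : {in s, forall z, Y z} by move=> z zs; apply: sY; rewrite inE zs orbT.
rewrite -IH// -!ripxx /lincomb big_cons -/(lincomb c s) ripDl !ripDr.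
have -> : rip (c y *: y) (c y *: y) = sqn (c y).
  rewrite /rip linearZl_LR/= linearZr_LR/= inner_unit ?mulr1//; exact: oY.1.
have E : rip (lincomb c s) (c y *: y) = 0.
  by rewrite /rip linearZr_LR/= (inner_lincomb0 _ oY)// mulr0.
by rewrite (ripC (c y *: y)) E addr0 add0r.
Qed.

Lemma rip_lincomb x s : rip x (lincomb (fun y => '[x, y]) s) = sqsum (fun y => '[x, y]) s.
Proof.
rewrite /lincomb /sqsum; elim: s => [|y s IH]; first by rewrite !big_nil rip0r.
by rewrite !big_cons ripDr IH /rip linearZr_LR/= mulrC.
Qed.

Lemma bessel Y x s : orthonormal Y -> {in s, forall y, Y y} -> uniq s ->
  sqsum (fun y => '[x, y]) s <= nrm x ^+ 2.
Proof.
move=> oY sY us; set p := lincomb (fun y => '[x, y]) s.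
have := ripxx_ge0 (x - p); rewrite !ripE (ripC p x) rip_lincomb (ripxx p).
rewrite (nrm_lincomb _ oY)// -ripxx; lra.
Qed.

Lemma sqn_le1 a (d : R) : 0 <= d -> (sqn a <= d ^+ 2) = (`|a| <= d%:C).
Proof.
move=> d0; rewrite -lecR sqnC rmorphXn/= ler_pXn2r ?nnegrE//.
by rewrite ler0c.
Qed.

Lemma sqsum_cat c s s' : sqsum c (s ++ s') = sqsum c s + sqsum c s'.
Proof. by rewrite /sqsum big_cat. Qed.

Lemma sqsum_sub c s s' : uniq s -> uniq s' -> {subset s <= s'} ->
  sqsum c s <= sqsum c s'.
Proof.
move=> us us' ss'.
rewrite /sqsum; have /(perm_big _) -> : perm_eq s [seq y <- s' | y \in s].
  apply: uniq_perm => //; first exact: filter_uniq.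
  by move=> y; rewrite mem_filter andb_idr//; exact: ss'.
rewrite big_filter [leRHS](bigID (mem s))/= lerDl.
by apply: sumr_ge0 => y _; exact: sqn_ge0.
Qed.

(** Finite subsets whose square sums approach the supremum carry almost all the mass. Made
    increasing, they give a Cauchy sequence of partial sums, with no enumeration of Y. *)
Lemma riesz_fischer Y c (M : R) : orthonormal Y -> 0 <= M ->
  (forall s, {in s, forall y, Y y} -> uniq s -> sqsum c s <= M ^+ 2) ->
  exists z, nrm z <= M /\ forall y, Y y -> '[z, y] = c y.
Proof.
move=> oY M0 cM.
pose ok s := {in s, forall y, Y y} /\ uniq s.
pose S := [set sqsum c s | s in [set s | ok s]].
have Ssup : has_sup S.
  split; first by exists (sqsum c [::]), [::].
  by exists (M ^+ 2) => _ [s [sY us] <-]; exact: cM.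
have Sle s : ok s -> sqsum c s <= sup S.
  by move=> oks; apply: (ub_le_sup (proj2 Ssup)); exists s.
pose e (k : nat) : R := k.+1%:R^-1.
have e0 k : 0 < e k by rewrite invr_gt0 ltr0n.
have /choice[t tP] (k : nat) : exists s, ok s /\ sup S - e k ^+ 2 < sqsum c s.
  have ek : 0 < e k ^+ 2 by rewrite exprn_gt0.
  by have [_ [s oks <-]] := sup_adherent ek Ssup; exists s.
(* The chosen subsets are merged into an increasing chain, each stage appending only new vectors. *)
pose q := fix q k := if k is m.+1 then q m ++ [seq y <- t m.+1 | y \notin q m] else t 0%N.
have okq k : ok (q k).
  elim: k => [|k [IH1 IH2]] /=; first by have [] := tP 0%N.
  have [[tY ut] _] := tP k.+1; split.
    move=> y; rewrite mem_cat => /orP[/IH1//|]; rewrite mem_filter => /andP[_].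
    exact: tY.
  rewrite cat_uniq IH2 filter_uniq// andbT/=.
  by apply/hasPn => y; rewrite mem_filter => /andP[].
have qlarge k : sup S - e k ^+ 2 < sqsum c (q k).
  case: k => [|k]; first by have [] := tP 0%N.
  have [[tY ut] H] := tP k.+1; apply: lt_le_trans H _.
  apply: sqsum_sub => //; first by have [] := okq k.+1.
  by move=> y yt; rewrite /= mem_cat mem_filter yt andbT orbN.
have qcat k m : (k <= m)%N -> exists r, q m = q k ++ r.
  move=> km; rewrite -(subnKC km); elim: (m - k)%N => [|n [r IH]].
    by exists [::]; rewrite addn0 cats0.
  by rewrite addnS /= IH -catA; eexists.
have ze k m : (k <= m)%N -> nrm (lincomb c (q m) - lincomb c (q k)) <= e k.
  move=> km; have [r qr] := qcat _ _ km; have [qY uq] := okq m.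
  have ur : uniq r by move: uq; rewrite qr cat_uniq => /and3P[].
  have rY : {in r, forall y, Y y}.
    by move=> y yr; apply: qY; rewrite qr mem_cat yr orbT.
  have -> : lincomb c (q m) - lincomb c (q k) = lincomb c r.
    by rewrite qr /lincomb big_cat; apply: rip_ext => v; rewrite !ripE; ring.
  rewrite -(@ler_pXn2r _ 2%N) ?nnegrE ?(ltW (e0 _))// (nrm_lincomb _ oY)//.
  have := Sle _ (okq m); have := qlarge k; rewrite qr sqsum_cat.
  by lra.
have elim d : 0 < d -> exists n, e n <= d.
  move=> d0; exists (Num.bound d^-1).
  rewrite /e -[leRHS]invrK lef_pV2 ?posrE ?ltr0n ?invr_gt0//.
  have := @archi_boundP R d^-1; rewrite invr_ge0 ltW// => /(_ isT)/ltW/le_trans; apply.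
  by rewrite ler_nat.
have [z zq] := vector_limit ze elim.
exists z; split.
  apply/ler_addgt0Pr => d /elim[n en].
  have -> : z = lincomb c (q n) + (z - lincomb c (q n)) by rewrite addrC subrK.
  rewrite (le_trans (nrmD _ _))// lerD//; last by rewrite (le_trans (zq n)).
  have [qY uq] := okq n.
  by rewrite -(@ler_pXn2r _ 2%N) ?nnegrE// (nrm_lincomb _ oY)// cM.
move=> y Yy; apply/eqP; rewrite -subr_eq0 -normr_le0; apply/ler_addgt0Pl => d d0.
rewrite addr0.
have dE : d = (complex.Re d)%:C by rewrite RRe_real// gtr0_real.
move: d0; rewrite {}dE ltcR => d0.
have [n en] := elim _ (divr_gt0 d0 (ltr0Sn R 1)).
have [qY uq] := okq n.
have H1 : `|'[z - lincomb c (q n), y]| <= (e n)%:C.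
  rewrite (le_trans (cauchy_schwarz _ _))// -!nrmC -rmorphM/= (oY.1 _ Yy) mulr1 lecR; exact: zq.
have H2 : `|'[lincomb c (q n), y] - c y| <= (e n)%:C.
  have [yq|yq] := boolP (y \in q n).
    by rewrite (inner_lincomb _ oY)// subrr normr0 ler0c ltW.
  rewrite (inner_lincomb0 _ oY)// sub0r normrN -sqn_le1 ?(ltW (e0 _))//.
  (* A vector outside [q n] can raise the square sum by at most (e n)^2, which bounds its
     coefficient. *)
  have oky : ok (rcons (q n) y).
    split; last by rewrite rcons_uniq yq.
    by move=> v; rewrite mem_rcons inE => /predU1P[->//|/qY].
  have := Sle _ oky; have := qlarge n.
  by rewrite /sqsum big_rcons/=; lra.
have -> : '[z, y] - c y =
    '[z - lincomb c (q n), y] + ('[lincomb c (q n), y] - c y).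
  by rewrite linearBl/= addrA subrK.
rewrite (le_trans (ler_normD _ _))// (le_trans (lerD H1 H2))// -rmorphD/= lecR.
by lra.
Qed.

(** By Bessel's inequality only finitely many squared coefficients exceed 1 / (k + 1), for each
    k. *)
Lemma countable_inner Y v : orthonormal Y -> countable [set y | Y y /\ '[y, v] != 0].
Proof.
move=> oY; pose F (k : nat) := [set y | Y y /\ k.+1%:R^-1 < sqn '[v, y]].
have -> : [set y | Y y /\ '[y, v] != 0] = \bigcup_k F k.
  apply/seteqP; split=> y; last first.
    move=> [k _ [Yy H]]; split => //; apply: contraTneq H => yv.
    rewrite -leNgt inner_conj yv rmorph0 /sqn mul0r/=.
    by rewrite invr_ge0 ler0n.
  move=> [Yy yv]; have H : 0 < sqn '[v, y].
    by rewrite -ltcR sqn_inner sqnC exprn_gt0// normr_gt0.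
  exists (Num.bound (sqn '[v, y])^-1) => //; split => //.
  rewrite -[ltRHS]invrK ltf_pV2 ?posrE ?ltr0n ?invr_gt0//.
  have := @archi_boundP R (sqn '[v, y])^-1; rewrite invr_ge0 sqn_ge0 => /(_ isT).
  by move=> /lt_le_trans; apply; rewrite ler_nat leqnSn.
apply: bigcup_countable => // k _; apply: finite_set_countable.
apply: contrapT => /(infinite_set_fset (Num.bound (nrm v ^+ 2 * k.+1%:R)))[A AF nA].
set s := finmap.enum_fset A in nA.
have sF y : y \in s -> F k y by move=> ys; apply: AF.
have sY : {in s, forall y, Y y} by move=> y /sF[].
have := bessel v oY sY (finmap.fset_uniq A).
have : \sum_(y <- s) k.+1%:R^-1 <= sqsum (fun y => '[v, y]) s.
  by rewrite /sqsum big_seq [leRHS]big_seq; apply: ler_sum => y /sF[_ /ltW].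
rewrite big_const_seq count_predT iter_addr_0 => /le_trans/[apply].
rewrite -[_^-1 *+ _]mulr_natl ler_pdivrMr ?ltr0n// leNgt => /negP; apply.
apply: lt_le_trans (archi_boundP _) _; first by rewrite mulr_ge0 ?sqr_ge0 ?ler0n.
by rewrite ler_nat.
Qed.

(** Completeness is expressed as maximality within the range of P: this is what Zorn's lemma yields
    and what [basis_ext] needs. *)
Definition basis P Y := [/\ orthonormal Y, forall y, Y y -> P y = y &
  forall x, P x = x -> (forall y, Y y -> '[x, y] = 0) -> x = 0].

Lemma basis_exists P : exists Y, basis P Y.
Proof.
pose ok Y := orthonormal Y /\ forall y, Y y -> P y = y.
have ok_bigcup (F : set (set V)) : F `<=` ok -> total_on F subset ->
    ok (\bigcup_(Y in F) Y).
  move=> FX Ftot; split; first split.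
  - by move=> y [Y FY Yy]; have [[H _] _] := FX _ FY; apply: H.
  - move=> y y' [Y FY Yy] [Y' FY' Y'y]; have [YY'|Y'Y] := Ftot _ _ FY FY'.
      by have [[_ H] _] := FX _ FY'; apply: H => //; apply: YY'.
    by have [[_ H] _] := FX _ FY; apply: H => //; apply: Y'Y.
  - by move=> y [Y FY Yy]; have [_ H] := FX _ FY; apply: H.
have [Y [[oY YP] Ymax]] := Zorn_bigcup ok_bigcup.
exists Y; split => // x Px xY; apply: contrapT => /eqP x0.
have nx0 : nrm x != 0 by apply: contra_neq x0 => /nrm0_eq0.
pose v := (nrm x)^-1%:C *: x.
have vY y : Y y -> '[v, y] = 0 by move=> Yy; rewrite linearZl_LR/= xY// mulr0.
have v1 : nrm v = 1 by rewrite nrmZ ger0_norm ?invr_ge0// mulVf.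
have nYv : ~ Y v.
  by move=> /vY; rewrite inner_unit// => /eqP; rewrite oner_eq0.
apply: (Ymax (Y `|` [set v])).
  split; first exact: subsetUl.
  by move=> /(_ v) H; apply: nYv; apply: H; right.
split; first split.
- by move=> y [/oY.1|->].
- move=> y y' [Yy|->] [Yy'|->].
  + exact: oY.2.
  + by rewrite inner_conj vY// rmorph0.
  + by rewrite vY.
  + by rewrite eqxx.
- by move=> y [/YP|->]//; rewrite apZ Px.
Qed.

(** The coefficients <x, g w> are square summable by Bessel's inequality for Y, as g is injective;
    [riesz_fischer] realises them in the range of Q, and maximality of W gives linearity. *)
Lemma coordinate_transfer P Q Y W (g : V -> V) : sym Q -> Q * Q = Q -> orthonormal Y ->
  basis Q W -> (forall w, W w -> Y (g w)) -> {in W &, injective g} ->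
  exists Z, [/\ Q * Z = Z, opnorm Z <= 1 &
                 forall x w, W w -> '[Z x, w] = '[x, g w]].
Proof.
move=> sQ QQ oY [oW WQ Wmax] gY ginj.
have Q1 := projection_le1 sQ QQ.
have innerQ x w : W w -> '[Q x, w] = '[x, w].
  by move=> Ww; rewrite adjointE; have /sym_adjoint <- := sQ; rewrite WQ.
have /choice[f fP] x : exists z,
    [/\ Q z = z, nrm z <= nrm x & forall w, W w -> '[z, w] = '[x, g w]].
  have [|z [zx zW]] := @riesz_fischer W (fun w => '[x, g w]) _ oW (nrm_ge0 x).
    move=> s sW us.
    have -> : sqsum (fun w => '[x, g w]) s = sqsum (fun y => '[x, y]) (map g s).
      by rewrite /sqsum big_map.
    apply: (bessel _ oY); first by move=> _ /mapP[w ws ->]; apply/gY/sW.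
    rewrite map_inj_in_uniq// => w w' /sW ww /sW ww'.
    by apply: ginj; rewrite in_setE.
  exists (Q z); split; first by rewrite -bopM QQ.
    by rewrite (le_trans _ zx)// opnorm1_nrm.
  by move=> w Ww; rewrite innerQ// zW.
have flin : linear f.
  move=> a x y; apply/eqP; rewrite -subr_eq0; apply/eqP.
  have [fx _ fxW] := fP x; have [fy _ fyW] := fP y.
  have [fa _ faW] := fP (a *: x + y).
  apply: Wmax; first by rewrite !apE fx fy fa.
  move=> w Ww; rewrite linearBl/= faW// !linearDl/= !linearZl_LR/= fxW// fyW//.
  by rewrite subrr.
have fM x : nrm (f x) <= 1 * nrm x by rewrite mul1r; have [] := fP x.
exists (Bop (bounded_linearP flin fM)); split.
- by apply: bop_ext => x; have [] := fP x.
- by apply: opnorm_leP => // x; apply: fM.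
- by move=> x w Ww; have [_ _] := fP x; apply.
Qed.

Lemma basis_ext P W u v : basis P W -> P u = u -> P v = v ->
  (forall w, W w -> '[u, w] = '[v, w]) -> u = v.
Proof.
move=> [_ _ Wmax] Pu Pv uv; apply/eqP; rewrite -subr_eq0; apply/eqP.
by apply: Wmax; [rewrite !apE Pu Pv|move=> w Ww; rewrite linearBl/= uv// subrr].
Qed.

(** The bijection and its inverse induce contractions Z and Z' that are mutually inverse between the
    two ranges; this forces Z to be a partial isometry. *)
Lemma equivalent_projections P Q Y W : sym P -> P * P = P -> sym Q -> Q * Q = Q ->
  basis P Y -> basis Q W -> (Y #= W)%card ->
  exists Z, adjoint Z * Z = P /\ Z * adjoint Z = Q.
Proof.
move=> sP PP sQ QQ bY bW /card_set_bijP[f [fW finj fsurj]].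
have [oY YP _] := bY; have [oW WQ _] := bW.
have /choice[g gP] w : exists y, W w -> Y y /\ f y = w.
  have [Ww|nW] := pselect (W w); last by exists 0.
  by have [y Yy yw] := fsurj w Ww; exists y.
have gY w : W w -> Y (g w) by move=> /gP[].
have fg w : W w -> f (g w) = w by move=> /gP[].
have gf y : Y y -> g (f y) = y.
  move=> Yy; have Wf := fW _ Yy.
  by apply: finj; rewrite ?in_setE ?fg//; exact: gY.
have ginj : {in W &, injective g}.
  by move=> w w'; rewrite !in_setE => Ww Ww' E; rewrite -(fg w)// E fg.
have [Z [QZ Z1 ZE]] := coordinate_transfer P sQ QQ oY bW gY ginj.
have [Z' [PZ' Z'1 Z'E]] := coordinate_transfer Q sP PP oW bY fW finj.
have ZZ' : Z * Z' = Q.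
  apply: bop_ext => x; apply: (basis_ext bW).
  - by rewrite -!bopM mulrA QZ.
  - by rewrite -bopM QQ.
  - move=> w Ww; rewrite bopM ZE// Z'E ?fg//; last exact: gY.
    by rewrite adjointE; have /sym_adjoint <- := sQ; rewrite WQ.
have Z'Z : Z' * Z = P.
  apply: bop_ext => x; apply: (basis_ext bY).
  - by rewrite -!bopM mulrA PZ'.
  - by rewrite -bopM PP.
  - move=> y Yy; rewrite bopM Z'E// ZE ?gf//; last exact: fW.
    by rewrite adjointE; have /sym_adjoint <- := sP; rewrite YP.
have ZP : Z * P = Z.
  apply: bop_ext => x; apply: (basis_ext bW).
  - by rewrite -!bopM mulrA QZ.
  - by rewrite -bopM QZ.
  - move=> w Ww; rewrite bopM !ZE// adjointE; have /sym_adjoint <- := sP.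
    by rewrite YP//; apply: gY.
(* Z contracts, and so does its inverse Z' on the range of Q, so no norm is lost. *)
have nZ x : nrm (Z x) = nrm (P x).
  apply/le_anti/andP; split; first by rewrite -ZP bopM opnorm1_nrm.
  by rewrite -Z'Z bopM opnorm1_nrm.
have AZ : adjoint Z * Z = P.
  apply/eqP; rewrite -subr_eq0; apply/eqP/opnorm_eq0.
  apply: opnorm_form_le => // [|x].
    apply: symD; last exact: symN.
    by apply/sym_adjoint; rewrite adjointM adjointK.
  rewrite mul0r normr_le0 !bopE ripDl ripNl -ripAr ripxx nZ -ripxx sP -bopM PP.
  by rewrite (ripC x) subrr.
exists Z; split => //; rewrite -ZZ'; congr (_ * _).
have /sym_adjoint sQE := sQ.
have -> : adjoint Z = adjoint Z * Q by rewrite -{1}QZ adjointM -sQE.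
by rewrite -ZZ' mulrA AZ PZ'.
Qed.

End OrthonormalBases.

(** * Forms bounded below on a subspace of finite codimension *)

Section FiniteCodimension.
Variables (R : realType) (V : hilbertType R).
Implicit Types (u v w x y z : V) (c d e : R) (A K X T : 'B(V)) (s : seq V).

Lemma coercive_nrm K c x : (forall x, c * rip x x <= rip (K x) x) ->
  c * nrm x <= nrm (K x).
Proof.
move=> Kc; have [->|x0] := eqVneq (nrm x) 0; first by rewrite mulr0.
have xp : 0 < nrm x by rewrite lt_neqAle eq_sym x0 nrm_ge0.
rewrite -(ler_pM2r xp) -mulrA -expr2 -ripxx; apply: le_trans (Kc x) (rip_le _ _).
Qed.

(** The Lax-Milgram argument: v -> v + t (y - K v) is a strict contraction for a suitable t, and its
    fixed points solve K v = y. *)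
Lemma coercive_surj K c y : 0 < c -> (forall x, c * rip x x <= rip (K x) x) ->
  exists z, K z = y.
Proof.
(* [k] bounds the norm of K and exceeds c, so that 0 < c / k < 1. *)
move=> c0 Kc; pose k := opnorm K + c + 1.
have Kk : opnorm K <= k by rewrite /k; lra.
have ck : c < k by have := opnorm_ge0 K; rewrite /k; lra.
have k0 : 0 < k by exact: lt_trans ck.
pose r : R := 1 - (c / k) ^+ 2.
have ck1 : 0 < c / k < 1 by rewrite divr_gt0// ltr_pdivrMr// mul1r.
have r01 : 0 <= r < 1 by move: ck1; rewrite /r => /andP[? ?]; apply/andP; split; nra.
pose q := Num.sqrt r.
have q0 : 0 <= q by exact: sqrtr_ge0.
have qq : q ^+ 2 = r by rewrite sqr_sqrtr//; case/andP: r01.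
have q1 : q < 1 by rewrite -(@ltr_pXn2r _ 2%N) ?nnegrE// qq expr1n; case/andP: r01.
(* This t minimises 1 - 2 t c + t^2 k^2, the bound for the squared contraction factor; the minimum
   is 1 - (c / k)^2. *)
pose t : R := c / k ^+ 2.
have contract x : nrm (x - t%:C *: K x) <= q * nrm x.
  apply: ler_nrm; first exact: mulr_ge0.
  rewrite exprMn qq -ripxx !ripE (ripC x).
  have Kx : rip (K x) (K x) <= k ^+ 2 * rip x x.
    rewrite !ripxx -exprMn ler_pXn2r ?nnegrE ?mulr_ge0// ?(ltW k0)//.
    exact: opnorm_le_nrm.
  have t0 : 0 <= t by rewrite /t divr_ge0 ?exprn_ge0 ?ltW.
  have E1 : t * (t * rip (K x) (K x)) <= t * (t * (k ^+ 2 * rip x x)).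
    by rewrite !ler_wpM2l.
  have E2 : t * (t * (k ^+ 2 * rip x x)) = (c / k) ^+ 2 * rip x x.
    by rewrite /t; field; rewrite gt_eqF.
  have E3 : t * (c * rip x x) <= t * rip (K x) x by rewrite ler_wpM2l.
  have E4 : t * (c * rip x x) = (c / k) ^+ 2 * rip x x.
    by rewrite /t; field; rewrite gt_eqF.
  by rewrite /r; lra.
pose v := fix v n := if n is m.+1 then v m + t%:C *: (y - K (v m)) else 0.
have res n : nrm (y - K (v n)) <= q ^+ n * nrm y.
  elim: n => [|n IH] /=; first by rewrite ap0 subr0 mul1r.
  have -> : y - K (v n + t%:C *: (y - K (v n))) =
      (y - K (v n)) - t%:C *: K (y - K (v n)).
    by apply: rip_ext => z; rewrite !apE !ripE; ring.
  by rewrite (le_trans (contract _))// exprS -mulrA ler_wpM2l.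
have qn0 n : 0 <= q ^+ n by rewrite exprn_ge0.
have ve n m : (n <= m)%N -> nrm (v m - v n) <= 2 * q ^+ n * nrm y / c.
  move=> nm; rewrite ler_pdivlMr// mulrC (le_trans (coercive_nrm _ Kc))//.
  have -> : K (v m - v n) = (y - K (v n)) - (y - K (v m)).
    by apply: rip_ext => z; rewrite !apE !ripE; ring.
  rewrite (le_trans (nrmB _ _))//.
  have qmn : q ^+ m <= q ^+ n by rewrite ler_wiXn2l// ltW.
  have H1 := res n; have H2 := res m.
  have H3 : q ^+ m * nrm y <= q ^+ n * nrm y by rewrite ler_wpM2r.
  by move: H1 H2 H3; lra.
have qlim d : 0 < d -> exists n, q ^+ n <= d.
  move=> d0; have /cvgr0Pnorm_le/(_ d d0) : (fun n => q ^+ n) @ \oo --> (0 : R).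
    by apply: cvg_expr; rewrite ger0_norm.
  by move=> /filter_ex[n]; rewrite ger0_norm//; exists n.
have elim d : 0 < d -> exists n, 2 * q ^+ n * nrm y / c <= d.
  move=> d0; have y1 : 0 < 2 * (nrm y + 1) by rewrite mulr_gt0// ltr_wpDl.
  have [|n qn] := qlim (d * c / (2 * (nrm y + 1))).
    by rewrite divr_gt0// mulr_gt0.
  exists n; rewrite ler_pdivrMr//; move: qn; rewrite ler_pdivlMr//.
  by have := qn0 n; have := nrm_ge0 y; nra.
have [z zv] := vector_limit ve elim.
exists z; apply/eqP; rewrite -subr_eq0; apply/eqP/nrm0_eq0/eqP.
rewrite eq_le nrm_ge0 andbT; apply/ler_addgt0Pl => d d0; rewrite addr0.
have k10 : 0 < 2 * (k + 1) by rewrite mulr_gt0// addr_gt0.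
have y10 : 0 < 2 * (nrm y + 1) by rewrite mulr_gt0// ltr_wpDl.
have [n1 H1] := elim _ (divr_gt0 d0 k10).
have [n2 H2] := qlim _ (divr_gt0 d0 y10).
have H1' : nrm (z - v (n1 + n2)%N) <= d / (2 * (k + 1)).
  apply: le_trans H1; apply: le_trans (zv _) _.
  rewrite ler_pM2r ?invr_gt0// ler_wpM2r// ler_wpM2l//.
  by rewrite ler_wiXn2l ?leq_addr// ltW.
have H2' : nrm (y - K (v (n1 + n2)%N)) <= d / (2 * (nrm y + 1)) * nrm y.
  apply: le_trans (res _) _; rewrite ler_wpM2r//; apply: le_trans H2.
  by rewrite ler_wiXn2l ?leq_addl// ltW.
have -> : K z - y = K (z - v (n1 + n2)%N) - (y - K (v (n1 + n2)%N)).
  by apply: rip_ext => u; rewrite !apE !ripE; ring.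
rewrite (le_trans (nrmB _ _))//.
have H3 : nrm (K (z - v (n1 + n2)%N)) <= k * (d / (2 * (k + 1))).
  by rewrite (le_trans (opnorm_le_nrm _ Kk))// ler_wpM2l// ltW.
have H4 : k * (d / (2 * (k + 1))) <= d / 2.
  rewrite mulrA ler_pdivrMr//; move: d0 k0; nra.
have H5 : d / (2 * (nrm y + 1)) * nrm y <= d / 2.
  rewrite mulrAC ler_pdivrMr//; have := nrm_ge0 y; move: d0; nra.
by move: H2' H3 H4 H5; lra.
Qed.

Lemma rank_one_exists y : exists X, forall x, X x = '[x, y] *: y.
Proof.
have lf : linear (fun x => '[x, y] *: y).
  by move=> a u v; rewrite linearDl/= linearZl_LR/= scalerDl scalerA.
have fM x : nrm ('[x, y] *: y) <= nrm y ^+ 2 * nrm x.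
  rewrite -lecR nrmC normrZ rmorphM rmorphXn/= !nrmC expr2 -mulrA mulrC.
  by rewrite ler_wpM2l// mulrC cauchy_schwarz.
by exists (Bop (bounded_linearP lf fM)).
Qed.

Lemma rip_scale_inner x y : rip ('[x, y] *: y) x = sqn '[x, y].
Proof. by rewrite /rip linearZl_LR/= [X in _ * X]inner_conj. Qed.

Lemma sym_inner T x y : sym T -> '[T x, y] = '[x, T y].
Proof. by move=> /sym_adjoint TE; rewrite adjointE -TE. Qed.

Lemma rip_scale a x y : rip (a *: x) (a *: y) = sqn a * rip x y.
Proof.
rewrite /rip linearZl_LR/= linearZr_LR/= mulrA -[a * _](_ : (sqn a)%:C = _) ?ReZ//.
by rewrite sqnC -normCK.
Qed.

(** K, the sum of A and the rank one form of y, is invertible. With K z = y and t = <y, z>,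
    definiteness of A forces t < 1, so the rank one form uses up only part of K. *)
Lemma rank_one_peel A y c : sym A -> (forall x, 0 <= rip (A x) x) ->
  (forall x, rip (A x) x <= 0 -> x = 0) -> 0 < c ->
  (forall x, c * rip x x <= rip (A x) x + sqn '[x, y]) ->
  exists2 c', 0 < c' & forall x, c' * rip x x <= rip (A x) x.
Proof.
move=> sA A0 Adef c0 Ac; have [X XE] := rank_one_exists y.
pose K := A + X.
have KE x : rip (K x) x = rip (A x) x + sqn '[x, y].
  by rewrite /K bopD ripDl XE rip_scale_inner.
have [z zE] := @coercive_surj K c y c0 (fun x => eq_ind_r (fun r => _ <= r) (Ac x) (KE x)).
have sK : sym K.
  apply: symD => // u v; rewrite !XE /rip linearZl_LR/= linearZr_LR/=.
  by rewrite -inner_conj mulrC.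
pose t := rip y z.
have tE : '[z, y] = t%:C.
  have E : rip z ('i *: y) = 0.
    have : rip z ('i *: y) = - rip z ('i *: y).
      by rewrite -{1}zE -apZ -sK -rip_i zE ripC.
    by lra.
  by rewrite inner_rip E ripC.
have Az : A z = (1 - t)%:C *: y.
  have /(congr1 (fun v => v - X z)) := zE; rewrite bopD XE tE.
  by move=> E; apply: rip_ext => u; have := congr1 (fun v => rip v u) E; rewrite /= !ripE; lra.
have zt : rip (A z) z = (1 - t) * t by rewrite Az ripZl.
have Kzz : rip (K z) z = t by rewrite zE.
have t0 : 0 <= t.
  rewrite -Kzz; apply: le_trans (le_trans _ (Ac z)) _; last by rewrite KE.
  by rewrite mulr_ge0 ?ripxx_ge0// ltW.
(* If t >= 1, then <A z, z> = (1 - t) t <= 0, so z = 0 and t = 0. *)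
have t1 : t < 1.
  rewrite ltNge; apply/negP => t1.
  have z0 : z = 0 by apply: Adef; rewrite zt mulr_le0_ge0// subr_le0.
  by move: t1; rewrite /t z0 rip0r ler10.
exists (c * (1 - t) / (2 - t)) => [|x].
  by rewrite divr_gt0// ?mulr_gt0// subr_gt0// (lt_trans t1)// ltr1n.
clearbody K; have t2 : 0 < 2 - t by lra.
pose a := '[x, y].
have Kpos v : 0 <= rip (K v) v.
  by rewrite KE addr_ge0 ?sqn_ge0.
have cross : rip (K x) (a *: z) = sqn a.
  have E : '[K x, a *: z] = (a^*)%R * '[K x, z] by exact: linearZr_LR.
  by rewrite /rip E (sym_inner x z sK) zE -/a mulrC.
(* Expanding the form of K at x - a z gives (1 - t) |a|^2 <= <A x, x>. Inserted into (1 - t) times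
   the bound [H'], this explains the constant c (1 - t) / (2 - t). *)
have := Kpos (x - a *: z); rewrite !apE zE !ripE cross rip_scale.
have -> : rip (a *: y) x = sqn a by rewrite rip_scale_inner.
have -> : rip y z = t by [].
have := KE x; rewrite -/a => -> H.
have H' : c * rip x x <= rip (A x) x + sqn a by exact: Ac.
rewrite mulrAC ler_pdivrMr//.
have {}t1 : 0 <= 1 - t by lra.
have := sqn_ge0 a; have := ler_wpM2l t1 H'; move: H.
by lra.
Qed.

(** Adding the rank one form of y to A restores the bound with one orthogonality condition fewer.
    The induction hypothesis then applies, and [rank_one_peel] removes the form again. *)
Lemma finite_codim_coercive A c s Y : sym A -> (forall x, 0 <= rip (A x) x) ->
  (forall x, rip (A x) x <= 0 -> x = 0) -> 0 < c ->
  orthonormal Y -> {in s, forall y, Y y} -> uniq s ->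
  (forall x, {in s, forall y, '[x, y] = 0} -> c * rip x x <= rip (A x) x) ->
  exists2 c', 0 < c' & forall x, c' * rip x x <= rip (A x) x.
Proof.
move=> + + + + oY; elim: s c A => [|y s IH] c A sA A0 Adef c0 sY us Ac.
  by exists c => // x; apply: Ac.
move: us => /= /andP[ys us].
have Yy : Y y by apply: sY; rewrite mem_head.
have sY' : {in s, forall z, Y z} by move=> z zs; apply: sY; rewrite inE zs orbT.
have [X XE] := rank_one_exists y.
have XX x : rip ((A + X) x) x = rip (A x) x + sqn '[x, y].
  by rewrite bopD ripDl XE rip_scale_inner.
have sX : sym (A + X).
  apply: symD => // u v; rewrite !XE /rip linearZl_LR/= linearZr_LR/=.
  by rewrite -inner_conj mulrC.
(* For x = w + a y with w orthogonal to y, <x, x> = <w, w> + |a|^2 and c <w, w> <= 2 <A x, x> + 2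
   |a|^2 <A y, y>; C dominates the resulting coefficients. *)
pose C := 2 / c + 2 * rip (A y) y / c + 1.
have C0 : 0 < C.
  rewrite /C ltr_wpDl// addr_ge0// divr_ge0 ?mulr_ge0 ?(ltW c0)//.
have AX0 x : 0 <= rip ((A + X) x) x by rewrite XX addr_ge0 ?sqn_ge0.
have AXdef x : rip ((A + X) x) x <= 0 -> x = 0.
  by rewrite XX => H; apply: Adef; have := sqn_ge0 '[x, y]; lra.
have AXc x : {in s, forall y, '[x, y] = 0} -> C^-1 * rip x x <= rip ((A + X) x) x.
  move=> xs; rewrite XX; pose a := '[x, y]; pose w := x - a *: y.
  have wy : '[w, y] = 0.
    by rewrite linearBl/= linearZl_LR/= inner_unit ?mulr1 ?subrr//; apply: oY.1.
  have ws : {in y :: s, forall z, '[w, z] = 0}.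
    move=> z; rewrite inE => /predU1P[->//|zs].
    rewrite linearBl/= xs// linearZl_LR/= oY.2 ?mulr0 ?subrr//; first exact: sY'.
    by apply: contraNneq ys => ->.
  have H1 := Ac w ws.
  (* The parallelogram law for the form of A at x and a y, with the nonnegative value at x + a y
     dropped. *)
  have Aw : rip (A w) w <= 2 * rip (A x) x + 2 * (sqn a * rip (A y) y).
    have := A0 (x + a *: y); rewrite /w !apE !ripE -!apZ.
    have -> : rip (A (a *: y)) (a *: y) = sqn a * rip (A y) y by rewrite apZ rip_scale.
    by lra.
  have xE : x = w + a *: y by rewrite subrK.
  clearbody w.
  have wa : rip w (a *: y) = 0 by rewrite /rip linearZr_LR/= wy mulr0.
  have yy : rip y y = 1 by rewrite ripxx oY.1// expr1n.
  have xx : rip x x = rip w w + sqn a.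
    by rewrite {1 2}xE !ripE (ripC _ w) wa rip_scale yy; ring.
  rewrite mulrC ler_pdivrMr// xx.
  have ww : rip w w <= 2 / c * rip (A x) x + 2 * rip (A y) y / c * sqn a.
    have -> : 2 / c * rip (A x) x + 2 * rip (A y) y / c * sqn a =
       (2 * rip (A x) x + 2 * (sqn a * rip (A y) y)) / c by field; rewrite gt_eqF.
    by rewrite ler_pdivlMr// mulrC (le_trans H1).
  have i1 : 0 <= 2 / c by rewrite divr_ge0// ltW.
  have i2 : 0 <= 2 * rip (A y) y / c by rewrite divr_ge0 ?mulr_ge0// ltW.
  have := A0 x; have := sqn_ge0 a; rewrite -/a /C => s0 a0.
  have j1 : 0 <= 2 / c * sqn a by exact: mulr_ge0.
  have j2 : 0 <= 2 * rip (A y) y / c * rip (A x) x by exact: mulr_ge0.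
  by move: ww j1 j2 s0 a0; lra.
have Ci : 0 < C^-1 by rewrite invr_gt0.
have [c' c'0 c'A] := IH _ _ sX AX0 AXdef Ci sY' us AXc.
by apply: (@rank_one_peel A y c' sA A0 Adef c'0) => x; rewrite -XX.
Qed.

End FiniteCodimension.

(** * Spectral subspaces of a difference of projections *)

Section LimitsOfDifferences.
Variables (R : realType) (V : hilbertType R).
Implicit Types (u v w x y z : V) (c d e : R) (A B D F H J P Q X T Z : 'B(V)).

(** Halving keeps H - c a contraction for 0 <= c <= 1, so that positive parts and signs apply;
    [posp] then isolates the part of H above c. *)
Definition cut H c : 'B(V) := locked (2^-1%:C *: (H - c%:C *: (1 : 'B(V)))).

Lemma cutE H c : cut H c = 2^-1%:C *: (H - c%:C *: (1 : 'B(V))).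
Proof. by rewrite /cut -lock. Qed.

Lemma cut_sym H c : sym H -> sym (cut H c).
Proof. by move=> sH; rewrite cutE; apply/symZ/symD => //; apply/symN/symZ. Qed.

Lemma cut_le1 H c : opnorm H <= 1 -> 0 <= c <= 1 -> opnorm (cut H c) <= 1.
Proof.
move=> H1 /andP[c0 c1]; rewrite cutE opnormZ ger0_norm ?invr_ge0//.
have := opnormB H (c%:C *: (1 : 'B(V))); rewrite opnormZ ger0_norm//.
have := opnorm1 V; have := opnorm_ge0 (1 : 'B(V)); nra.
Qed.

Lemma rip_cut H c x : rip (cut H c x) x = (rip (H x) x - c * rip x x) / 2.
Proof. by rewrite cutE !bopE !ripE mulrC. Qed.

Lemma cut_comm H X c : H * X = X * H -> cut H c * X = X * cut H c.
Proof.
move=> HX; have E x : H (X x) = X (H x) by rewrite -!bopM HX.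
by rewrite cutE; apply: bop_rip => x y; rewrite !bopE !apE E !ripE.
Qed.

(** B asymptotically carries H to - H, hence the part of H above c to the part of - H above c, and
    likewise below c. *)
Lemma cut_intertwine H (B : nat -> 'B(V)) c : sym H -> opnorm H <= 1 -> 0 <= c <= 1 ->
  (forall n, opnorm (B n) <= 1) -> to0 (fun n => H * B n + B n * H) ->
  to0 (fun n => posp (cut (- H) c) * B n - B n * posp (cut H c)) /\
  to0 (fun n => negp (cut (- H) c) * B n - B n * negp (cut H c)).
Proof.
move=> sH H1 c01 B1 HB.
have HB' : to0 (fun n => cut (- H) c * B n - B n * cut H c).
  by apply: to0_eq (to0Z (- 2^-1) HB) => n; rewrite !cutE; opring.
have H1' : opnorm (- H) <= 1 by rewrite opnormN.
have A0 := absop_intertwine (fun=> cut_sym c (symN sH)) (fun=> cut_le1 H1' c01)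
  (fun=> cut_sym c sH) (fun=> cut_le1 H1 c01) B1 HB'.
split; [apply: to0_eq (to0D A0 HB') => n|apply: to0_eq (to0B A0 HB') => n].
  by rewrite !pospE; opring.
by rewrite !negpE; opring.
Qed.

Lemma posp_negpE T x : posp T x = negp T x + 2%:C *: T x.
Proof. by rewrite pospE negpE; apply: rip_ext => y; rewrite !bopE !ripE; ring. Qed.

(* The [B n] asymptotically conjugate [H] into [-H]. *)
Lemma one_sided_gap H (B : nat -> 'B(V)) c : sym H -> opnorm H <= 1 ->
  (forall x, H (H x) = x -> x = 0) -> (forall n, opnorm (B n) <= 1) ->
  to0 (fun n => H * B n + B n * H) -> to0 (fun n => B n * B n - (1 - H * H)) ->
  0 < c -> (forall x, c * rip x x <= rip ((1 - H) x) x) ->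
  exists2 c', 0 < c' & forall x, c' * rip x x <= rip x x - rip (H x) (H x).
Proof.
move=> sH H1 Hinj B1 HB BB c0 Hc.
wlog c1 : c c0 Hc / c <= 1.
  move=> W; apply: (W (Num.min c 1)); rewrite ?lt_min ?c0 ?ltr01 ?ge_min ?lexx ?orbT//.
  move=> x; apply: le_trans (Hc x); rewrite ler_wpM2r ?ripxx_ge0//.
  by rewrite ge_min lexx.
have Hc' x : c * rip x x <= rip x x - rip (H x) x.
  by have := Hc x; rewrite !bopE !ripE.
have c01 : 0 <= 1 - c / 2 <= 1 by apply/andP; split; lra.
have H1' : opnorm (- H) <= 1 by rewrite opnormN.
(* H is at most 1 - c, so no part of it lies above this threshold; the aim is the same conclusion
   for - H. *)
pose h := cut H (1 - c / 2); pose k := cut (- H) (1 - c / 2).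
have sh : sym h by exact: cut_sym.
have h1 : opnorm h <= 1 by exact: cut_le1.
have sk : sym k by exact/cut_sym/symN.
have k1 : opnorm k <= 1 by exact: cut_le1.
have posph : posp h = 0.
  apply: bop_ext => x; set y := posp h x.
  have yE : posp h y = 2%:C *: h y by rewrite posp_negpE -[negp h y]bopM negp_posp// add0r.
  have := posp_ge0 y sh h1; rewrite yE ripZl rip_cut => H2.
  apply: ripxx_eq0; have := Hc' y; have := ripxx_ge0 y; move: H2.
  by move: (rip _ _) (rip _ _) => a b; nra.
have [kB _] := cut_intertwine sH H1 c01 B1 HB.
(* [posp k] times B n approaches B n times [posp h], which is 0; multiplying by B n replaces its
   square by 1 - H^2. *)
have kk : posp k * (1 - H * H) = 0.
  apply: to0_const.
  have b1 (n : nat) : opnorm (posp k) <= opnorm (posp k) by [].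
  apply: to0_eq (to0B (to0Mr B1 kB) (to0Ml b1 BB)) => n.
  rewrite -/h -/k posph mulr0 subr0.
  by opring.
have sHH : sym (1 - H * H) by apply: symD => //; apply/symN/sym_sqr.
have posk : posp k = 0.
  apply: bop_ext => x; apply: Hinj.
  have := bop_apply (sym_mulC (posp_sym sk k1) sHH (@sym0 _ V) kk) x.
  by rewrite !bopE => /eqP; rewrite subr_eq0 => /eqP.
pose q := 1 - c / 2.
have Hq : opnorm H <= q.
  apply: opnorm_form_le => //; first by rewrite /q; lra.
  move=> x; have := negp_ge0 x sk k1; have := posp_negpE k x.
  rewrite posk bop0 => /(congr1 (fun v => rip v x)); rewrite ripDl ripZl rip0l rip_cut.
  rewrite bopN ripNl ler_norml => E1 E2; have := Hc' x; have := ripxx_ge0 x.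
  by rewrite /q in E1 *; move=> E3 E4; apply/andP; split; nra.
exists (1 - q ^+ 2) => [|x]; first by rewrite /q; nra.
have q0 : 0 <= q by rewrite /q; lra.
have : rip (H x) (H x) <= q ^+ 2 * rip x x.
  by rewrite !ripxx -exprMn ler_pXn2r ?nnegrE ?mulr_ge0// opnorm_le_nrm.
by lra.
Qed.

Lemma differenceP P Q : orthogonal_projection P -> orthogonal_projection Q ->
  [/\ sym (P - Q), sym (P + Q - 1), (P + Q - 1) * (P - Q) = - ((P - Q) * (P + Q - 1)) &
      (P + Q - 1) * (P + Q - 1) = 1 - (P - Q) * (P - Q)].
Proof.
move=> /projectionP[sP PP] /projectionP[sQ QQ].
have {}PP x : P (P x) = P x by rewrite -bopM PP.
have {}QQ x : Q (Q x) = Q x by rewrite -bopM QQ.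
split.
- by apply: symD => //; apply: symN.
- by apply: symD; [apply: symD|apply: symN].
- by apply: bop_rip => x y; rewrite !bopE !apE !PP !QQ !ripE; ring.
- by apply: bop_rip => x y; rewrite !bopE !apE !PP !QQ !ripE; ring.
Qed.

Lemma complementary_le1 B D : sym B -> sym D -> B * B = 1 - D * D -> opnorm B <= 1.
Proof.
move=> sB sD BB; apply: opnorm_leP => // x; rewrite mul1r; apply: ler_nrm2.
by rewrite sB -bopM BB !bopE !ripE -(sD x); have := ripxx_ge0 (D x); lra.
Qed.

(** * Spectral subspaces determined by the relations between B and D *)

Section ExactPair.
Variables (B D : 'B(V)).

(** These relations, provided by [differenceP], replace the two projections from here on; they
    persist under D -> - D, so the two ends of the spectrum are treated alike. *)
Definition exact_pair := [/\ sym B, sym D, B * D = - (D * B) & B * B = 1 - D * D].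
Hypothesis BD : exact_pair.

Let sB : sym B. Proof. by case: BD. Qed.
Let sD : sym D. Proof. by case: BD. Qed.
Let B1 : opnorm B <= 1.
Proof. by case: BD => ? ? _; apply: complementary_le1. Qed.

Lemma exact_pair_le1 : opnorm B <= 1 /\ opnorm D <= 1.
Proof.
split=> //; apply: (@complementary_le1 D B) => //; case: BD => _ _ _ ->.
by opring.
Qed.
Let D1 : opnorm D <= 1. Proof. by case: exact_pair_le1. Qed.

Let anti x : B (D x) = - D (B x).
Proof. by case: BD => _ _ E _; rewrite -bopM E. Qed.
Let BB x : B (B x) = x - D (D x).
Proof. by case: BD => _ _ _ E; rewrite -bopM E. Qed.

(** B^2 = 1 - D^2, so |B| is a function of D. *)
Lemma absopB_comm F : F * D = D * F -> absop B * F = F * absop B.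
Proof.
move=> FD; have E x : F (D x) = D (F x) by rewrite -!bopM FD.
apply: absop_comm_sqr => //; apply: bop_ext => x.
by rewrite !bopE !BB !apE !E.
Qed.

Lemma absopD_comm_B : absop D * B = B * absop D.
Proof.
apply: absop_comm_sqr => //; apply: bop_ext => x.
by rewrite !bopE !anti !apE opprK.
Qed.

Lemma absopD_comm_sgn : absop D * sgnop B = sgnop B * absop D.
Proof.
apply/esym/sgnop_comm => //; last exact/esym/absopD_comm_B.
exact: absop_sym.
Qed.

Lemma absopB_antisgn x : D (sgnop B (absop B x)) = - sgnop B (D (absop B x)).
Proof.
rewrite -[sgnop B _]bopM sgnop_absop// -[D (absop B x)]bopM -absopB_comm//.
by rewrite bopM -[sgnop B _]bopM sgnop_absop// anti opprK.
Qed.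

Variable (d : R).
Hypothesis d01 : 0 < d < 1.

(** The spectral projection of |D| for (1 - d, +oo): it covers both ends of the spectrum of D. *)
Definition outer := posproj (cut (absop D) (1 - d)).

Let d01' : 0 <= 1 - d <= 1.
Proof. by move: d01 => /andP[? ?]; apply/andP; split; lra. Qed.
Let sA : sym (absop D). Proof. exact: absop_sym. Qed.
Let A1 : opnorm (absop D) <= 1. Proof. exact: absop_le1. Qed.
Let sk : sym (cut (absop D) (1 - d)). Proof. exact: cut_sym. Qed.
Let k1 : opnorm (cut (absop D) (1 - d)) <= 1. Proof. exact: cut_le1. Qed.

Lemma outer_sym : sym outer. Proof. exact: posproj_sym. Qed.
Lemma outer_idem : outer * outer = outer. Proof. exact: posproj_idem. Qed.

Lemma outer_comm X : sym X -> absop D * X = X * absop D -> outer * X = X * outer.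
Proof. by move=> sX AX; apply: posproj_comm => //; apply: cut_comm. Qed.

Lemma outer_ge x : outer x = x -> (1 - d) * rip x x <= rip (absop D x) x.
Proof. by move=> /(posproj_ge0 sk k1); rewrite rip_cut; lra. Qed.

Lemma outer_le x : outer x = 0 -> rip (absop D x) x <= (1 - d) * rip x x.
Proof. by move=> /(posproj_le0 sk k1); rewrite rip_cut; lra. Qed.

Lemma absop_fix x : D (D x) = x -> absop D x = x.
Proof.
move=> DDx; apply/eqP; rewrite -subr_eq0; apply/eqP; set u := absop D x - x.
have Au : absop D u = - u.
  have AA : absop D (absop D x) = x by rewrite -bopM absop_sqr// bopM.
  by rewrite /u apD apN AA opprB.
apply: ripxx_eq0; have := absop_ge0 u sD D1; rewrite Au ripNl; lra.
Qed.

(** The component u of x outside [outer] satisfies |D| u = u, but the form of |D| at u is at most (1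
    - d) <u, u>; hence u = 0. *)
Lemma outer_fix x : D (D x) = x -> outer x = x.
Proof.
move=> /absop_fix Ax; apply/eqP; rewrite eq_sym -subr_eq0; apply/eqP.
set u := x - outer x.
have uE : outer u = 0.
  by rewrite /u apD apN -[outer (outer x)]bopM outer_idem subrr.
have AO : outer * absop D = absop D * outer by apply: outer_comm.
have Au : absop D u = u.
  by rewrite /u apD apN -[absop D (outer x)]bopM -AO bopM Ax.
apply: ripxx_eq0; have := outer_le uE; rewrite Au.
by have := ripxx_ge0 u; move: d01 => /andP[]; nra.
Qed.

(** The anticommutator T vanishes on the range of |B|. Being self-adjoint, it maps into the kernel
    of B, where D^2 = 1, hence into the range of [outer]. *)
Lemma outer_anticommutator :
  (D * sgnop B + sgnop B * D) * (1 - outer) = 0.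
Proof.
set T := D * _ + _.
have sT : sym T by apply: symmetric_anticommutators => //; exact: sgnop_sym.
have TA : T * absop B = 0.
  by apply: bop_ext => x; rewrite /T bopM bopD !bopM absopB_antisgn addNr.
have AT : absop B * T = 0.
  by apply: sym_mulC TA => //; [exact: absop_sym|exact: sym0].
have OT : outer * T = T.
  apply: bop_ext => x; apply: outer_fix.
  have BT : B (T x) = 0.
    by rewrite -{1}(sgnop_absop sB B1) bopM -[absop B _]bopM AT bop0 ap0.
  by have := BB (T x); rewrite BT ap0 => /esym/eqP; rewrite subr_eq0 => /eqP.
have TO : T * outer = T by apply: sym_mulC OT => //; exact: outer_sym.
by rewrite mulrBr mulr1 TO subrr.
Qed.

(** How F acts on the kernel of D is left open. Thus 1 - F splits - D, whereas [posproj] of - D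
    differs from 1 - [posproj D] on that kernel. *)
Definition splits F := [/\ sym F, F * F = F, F * D = D * F, D * F = absop D * F &
  D * (1 - F) = - (absop D * (1 - F))].

Section Split.
Variable F : 'B(V).
Hypothesis FP : splits F.

Let sF : sym F. Proof. by case: FP. Qed.
Let FF x : F (F x) = F x. Proof. by case: FP => _ E _ _ _; rewrite -bopM E. Qed.

Lemma splits_absop : absop D * F = F * absop D.
Proof. by case: FP => _ _ E _ _; apply: absop_comm. Qed.

Lemma splits_outer : outer * F = F * outer.
Proof. by apply: outer_comm => //; exact: splits_absop. Qed.

Lemma splits_proj : sym (outer * F) /\ (outer * F) * (outer * F) = outer * F.
Proof.
split; first exact: symM outer_sym sF splits_outer.
have OO x : outer (outer x) = outer x by rewrite -bopM outer_idem.
have OF x : F (outer x) = outer (F x) by rewrite -!bopM splits_outer.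
by apply: bop_ext => x; rewrite !bopE OF FF OO.
Qed.

Lemma splits_fix x : (outer * F) x = x -> outer x = x /\ F x = x.
Proof.
rewrite bopM => xE; split; first by rewrite -xE -[outer (outer _)]bopM outer_idem.
by rewrite -xE -[F (outer _)]bopM -splits_outer bopM FF.
Qed.

Lemma splits_ge x : outer x = x -> F x = x -> (1 - d) * rip x x <= rip (D x) x.
Proof.
move=> Ox Fx; rewrite -{3}Fx -bopM; case: FP => _ _ _ -> _.
by rewrite bopM Fx outer_ge.
Qed.

(** On F x the operator D acts as |D|, whose form is at most 1 - d there; on the rest it acts as -
    |D| and contributes nothing positive. *)
Lemma splits_le x : (outer * F) x = 0 -> rip (D x) x <= (1 - d) * rip x x.
Proof.
rewrite bopM => OFx; have H1 := outer_le OFx.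
have [_ _ _ DF DF'] := FP.
have xE : x = F x + (x - F x) by rewrite addrC subrK.
have Dx : D x = absop D (F x) - absop D (x - F x).
  have := bop_apply DF x; have := bop_apply DF' x; rewrite !bopE => E1 E2.
  by rewrite {1}xE (apD D) E1 E2.
have E1 : rip (F x) x = rip (F x) (F x) by rewrite -{1}FF sF.
have AF : absop D (F x) = F (absop D x) by rewrite -!bopM splits_absop.
have E2 : rip (absop D (F x)) x = rip (absop D (F x)) (F x).
  by rewrite AF -{1}FF sF.
have E3 : rip (absop D (F x)) (F x) = rip (absop D x) (F x).
  by rewrite AF sF FF.
have := absop_ge0 (x - F x) sD D1; have := ripxx_ge0 (x - F x).
rewrite Dx !apE !ripE !E2 (ripC x) !E1 -E3 => H2 H3.
have d0 : 0 <= 1 - d by case/andP: d01'.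
by have := ler_wpM2l d0 H2; move: H1 H3; lra.
Qed.

End Split.

Lemma splits_posproj : splits (posproj D).
Proof.
split; [exact: posproj_sym|exact: posproj_idem|exact: posproj_comm| |].
  exact: mul_posproj.
exact: mul_posprojC.
Qed.

End ExactPair.
End LimitsOfDifferences.

(** * Matching the ends of the spectrum *)

Section Matching.
Variables (R : realType) (V : hilbertType R).
Implicit Types (u v w x y z : V) (c d e : R) (A B D F H J P Q T U Z : 'B(V)).
Implicit Types (X Y W : set V).

Lemma outerN D d : outer (- D) d = outer D d.
Proof. by rewrite /outer absopN. Qed.

Lemma exact_pairN B D : exact_pair B D -> exact_pair B (- D).
Proof.
move=> [sB sD BD BB]; split => //; first exact: symN.
  by rewrite mulrN BD mulNr.
by rewrite mulrNN.
Qed.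

Lemma splitsN D F : splits D F -> splits (- D) (1 - F).
Proof.
move=> [sF FF FD DF DF'].
have {}FF x : F (F x) = F x by rewrite -bopM FF.
split; rewrite ?absopN.
- by apply: symD => //; apply: symN.
- by apply: bop_rip => x y; rewrite !bopE !apE FF !ripE; ring.
- by rewrite mulrN mulNr mulrBl mulrBr mul1r mulr1 FD.
- by rewrite mulNr DF' opprK.
- by rewrite mulNr subKr DF.
Qed.

Lemma injective_sub_sqr H x : (forall x, H (H x) = x -> x = 0) ->
  (forall e, 0 < e -> nrm ((1 - H * H) x) <= e) -> x = 0.
Proof.
move=> Hinj small; apply: Hinj; apply/eqP; rewrite eq_sym -subr_eq0; apply/eqP/nrm0_eq0/eqP.
rewrite eq_le nrm_ge0 andbT; apply/ler_addgt0Pl => e e0; rewrite addr0.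
by have := small e e0; rewrite !bopE.
Qed.

(* Either [sgnop B] already moves [x] into the opposite spectral subspace, or
   [x] is an exact eigenvector of [D]; in the latter case some [B n] sends the
   part of [x] where [H] is nearly [1] to vectors where [H] is nearly [-1]. *)
Lemma transfer H D B F (b : nat -> 'B(V)) d x : sym H -> opnorm H <= 1 ->
  (forall x, H (H x) = x -> x = 0) -> (forall n, opnorm (b n) <= 1) ->
  to0 (fun n => H * b n + b n * H) -> to0 (fun n => b n * b n - (1 - H * H)) ->
  exact_pair B D -> 0 < d < 1 -> opnorm (H - D) <= d / 8 -> splits D F ->
  outer D d x = x -> F x = x ->
  (outer D d * (1 - F)) (sgnop B x) = 0 ->
  (forall n, (outer D d * (1 - F)) (b n (posp (cut H (1 - d / 2)) x)) = 0) ->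
  x = 0.
Proof.
move=> sH H1 Hinj b1 Hb bb BD d01 HD FP Ox Fx Jx bx.
have [sB sD anti BB] := BD; have [B1 D1] := exact_pair_le1 BD.
have [d0 d1] := andP d01.
have [sF FF FD DF DF'] := FP.
have AO : absop B * outer D d = outer D d * absop B.
  apply/esym/(outer_comm BD d01); first exact: absop_sym.
  by apply/esym/(absopB_comm BD)/absop_comm.
have AF : absop B * F = F * absop B by apply: absopB_comm FD.
have JO : outer D d * sgnop B = sgnop B * outer D d.
  by apply: (outer_comm BD d01); [exact: sgnop_sym|exact: absopD_comm_sgn].
have JA : sgnop B * absop B = absop B * sgnop B by rewrite sgnop_absop// absop_sgnop.
pose w := absop B x; pose v := sgnop B w.
have Ow : outer D d w = w by rewrite /w -bopM -AO bopM Ox.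
have Fw : F w = w by rewrite /w -bopM -AF bopM Fx.
have Ov : outer D d v = v by rewrite /v -bopM JO bopM Ow.
have vE : v = absop B (sgnop B x) by rewrite /v /w -!bopM JA.
have Fv : F v = v.
  have : (outer D d * (1 - F)) v = absop B ((outer D d * (1 - F)) (sgnop B x)).
    have AO' z : absop B (outer D d z) = outer D d (absop B z) by rewrite -!bopM AO.
    have AF' z : absop B (F z) = F (absop B z) by rewrite -!bopM AF.
    by rewrite vE !bopE AO' !apE AF'.
  rewrite Jx ap0 bopM bopD bopN bop1 apD apN -[outer D d (F v)]bopM.
  rewrite (splits_outer BD d01 FP) bopM Ov => /eqP; rewrite subr_eq0 => /eqP.
  by [].
(* The form of D is at least 1 - d on both w and v = sgn (B) w, yet takes opposite values at them,
   because sgn B anticommutes with D on the range of |B|. *)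
have w0 : w = 0.
  have H2 := splits_ge BD d01 FP Ow Fw; have H3 := splits_ge BD d01 FP Ov Fv.
  have Dv : rip (D v) v = - rip (D w) w.
    rewrite /v (absopB_antisgn BD) ripNl -/w sgnop_sym -[sgnop B (sgnop B w)]bopM.
    by rewrite sgnop_sqr bop1.
  by apply: ripxx_eq0; have := ripxx_ge0 v; move: H2 H3; rewrite Dv; nra.
have DDx : D (D x) = x.
  have Bx : B x = 0 by rewrite -{1}(sgnop_absop sB B1) bopM -/w w0 ap0.
  have := bop_apply BB x; rewrite !bopE Bx ap0 => /esym/eqP.
  by rewrite subr_eq0 => /eqP.
have Dx : D x = x by rewrite -{1}Fx -bopM DF bopM Fx (absop_fix BD DDx).
pose h := cut H (1 - d / 2); pose k := cut (- H) (1 - d / 2); pose g := posp h x.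
have c01 : 0 <= 1 - d / 2 <= 1 by apply/andP; split; lra.
have sh : sym h by exact: cut_sym.
have h1 : opnorm h <= 1 by exact: cut_le1.
have sk : sym k by exact/cut_sym/symN.
have k1 : opnorm k <= 1 by apply: cut_le1 => //; rewrite opnormN.
have HDx z : `|rip ((H - D) z) z| <= d / 8 * rip z z.
  rewrite (le_trans (rip_norm_le _ _))// ripxx expr2 mulrA ler_wpM2r//.
  exact: opnorm_le_nrm.
(* D x = x and |H - D| <= d / 8 place the form of H at x above the threshold 1 - d / 2, so x has a
   nonzero part above it unless x = 0. *)
have small : g = 0 -> x = 0.
  move=> g0; apply: ripxx_eq0; have := HDx x; rewrite ler_norml => /andP[+ _].
  rewrite !bopE !ripE Dx => H2.
  have := negp_ge0 x sh h1; have := posp_negpE h x; rewrite -/g g0.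
  move=> /(congr1 (fun v => rip v x)); rewrite rip0l ripDl ripZl rip_cut => E1 E2.
  by have := ripxx_ge0 x; nra.
apply: small; apply: (injective_sub_sqr Hinj) => e e0.
have [_ kb] := cut_intertwine sH H1 c01 b1 Hb.
(* The denominator adds the two errors below: 8 (|g| + 1) / d from y, and |g| from the approximation
   of 1 - H^2. *)
pose e' := e / (8 * (nrm g + 1) / d + nrm g + 1).
have K0 : 0 < 8 * (nrm g + 1) / d + nrm g + 1.
  by rewrite ltr_wpDl// addr_ge0// divr_ge0 ?mulr_ge0 ?addr_ge0// ltW.
have e'0 : 0 < e' by rewrite divr_gt0.
have [m [km bm]] := filter_ex (filterI (kb _ e'0) (bb _ e'0)).
pose y := b m g.
have ky : nrm (negp k y) <= e' * nrm g.
  have -> : negp k y = (negp k * b m - b m * negp h) g.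
    have ng : negp h g = 0 by rewrite /g -bopM negp_posp.
    by rewrite !bopE ng ap0 subr0.
  exact: opnorm_le_nrm.
(* As y misses the lower end of D, the form of - H at y is at most 1 - d + d / 8 times <y, y>, below
   the threshold 1 - d / 2. So [negp k] is bounded below at y, while [ky] makes it small there. *)
have y_small : d / 8 * nrm y <= nrm (negp k y).
  have [->|y0] := eqVneq (nrm y) 0; first by rewrite mulr0.
  have yp : 0 < nrm y by rewrite lt_neqAle eq_sym y0 nrm_ge0.
  rewrite -(ler_pM2r yp) -[leLHS]mulrA -expr2 -ripxx; apply: le_trans (rip_le _ _).
  have := splits_le (exact_pairN BD) d01 (splitsN FP) (x := y).
  rewrite outerN => /(_ (bx m)); rewrite bopN ripNl => H2.
  have := HDx y; rewrite ler_norml => /andP[+ _]; rewrite !bopE !ripE => H3.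
  have := posp_ge0 y sk k1; rewrite posp_negpE ripDl ripZl rip_cut bopN ripNl.
  by have := ripxx_ge0 y; move: H2 H3; nra.
have -> : (1 - H * H) g = b m y - (b m * b m - (1 - H * H)) g.
  by rewrite /y; apply: rip_ext => z; rewrite !bopE !ripE; ring.
rewrite (le_trans (nrmB _ _))//.
have H2 : nrm ((b m * b m - (1 - H * H)) g) <= e' * nrm g by apply: opnorm_le_nrm.
have H3 : nrm (b m y) <= nrm y by apply: opnorm1_nrm.
have H4 : nrm y <= 8 * (nrm g + 1) / d * e'.
  have : d / 8 * nrm y <= e' * (nrm g + 1).
    rewrite (le_trans y_small)// (le_trans ky)// ler_wpM2l ?(ltW e'0)//.
    by rewrite lerDl.
  rewrite mulrAC ler_pdivrMr// mulrC -ler_pdivlMr// => /le_trans; apply.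
  by rewrite le_eqVlt; apply/orP; left; apply/eqP; field; rewrite gt_eqF.
have E : e' * (8 * (nrm g + 1) / d + nrm g + 1) = e by rewrite divfK// gt_eqF.
by rewrite -[leRHS]E; move: H2 H3 H4 e'0; lra.
Qed.

(** Each x in X is sent to a pair (y, i) with <C i x, y> nonzero. Moving C i to y by its adjoint,
    [countable_inner] shows that the fibres are countable. *)
Lemma card_basis_le P Q (C : nat -> 'B(V)) X Y : sym Q -> Q * Q = Q ->
  (forall x, P x = x -> (forall i, Q (C i x) = 0) -> x = 0) ->
  basis P X -> basis Q Y -> infinite_set Y -> (X #<= Y)%card.
Proof.
move=> sQ QQ PQ [oX XP Xmax] bY Yinf; have [oY YQ Ymax] := bY.
have [y0 Yy0] := infinite_setN0 Yinf.
have /choice[phi phiP] x : exists p : V * nat, Y p.1 /\ (X x -> '[C p.2 x, p.1] != 0).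
  have [Xx|nX] := pselect (X x); last by exists (y0, 0%N).
  have x0 : x <> 0 by move=> x0; have := oX.1 _ Xx; rewrite x0 nrm0; lra.
  have [i Qi] : exists i, Q (C i x) <> 0.
    apply: contrapT => /forallNP H; apply/x0/PQ => [|i]; first exact: XP.
    exact: contrapT (H i).
  have [y [Yy yx]] : exists y, Y y /\ '[C i x, y] != 0.
    apply: contrapT => /forallNP H; apply: Qi.
    apply: (basis_ext bY); rewrite ?ap0//; first by rewrite -bopM QQ.
    move=> y Yy; rewrite linear0l sym_inner// YQ//; apply/eqP/negPn/negP => yx.
    by apply: (H y).
  by exists (y, i).
apply: (card_le_countable_fibers Yinf (phi := phi)) => [x _|[y i]].
  by have [] := phiP x.
apply: sub_countable (countable_inner (adjoint (C i) y) oX).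
apply: subset_card_le => x [Xx pE]; split => //.
by have [_ /(_ Xx)] := phiP x; rewrite pE adjointE.
Qed.

Lemma sub1_form H : opnorm H <= 1 -> forall x, 0 <= rip ((1 - H) x) x.
Proof.
move=> H1 x; rewrite !bopE !ripE subr_ge0 (le_trans (rip_le _ _))//.
by rewrite ripxx expr2 ler_wpM2r// opnorm1_nrm.
Qed.

(** For a contraction, |H x - x|^2 <= 2 <(1 - H) x, x>; so a zero of the form is fixed by H, hence
    by H^2. *)
Lemma sub1_form_def H : opnorm H <= 1 -> (forall x, H (H x) = x -> x = 0) ->
  forall x, rip ((1 - H) x) x <= 0 -> x = 0.
Proof.
move=> H1 Hinj x; rewrite !bopE !ripE => Hx; apply: Hinj.
suff Hxx : H x = x by rewrite !Hxx.
apply/eqP; rewrite -subr_eq0; apply/eqP/ripxx_eq0.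
rewrite !ripE (ripC x (H x)).
have : rip (H x) (H x) <= rip x x.
  by rewrite !ripxx ler_pXn2r ?nnegrE// opnorm1_nrm.
by move: Hx; lra.
Qed.

(** If Y were finite, the form of D would be at most 1 - d orthogonally to Y, and that of 1 - H at
    least 7 d / 8. By [finite_codim_coercive] a lower bound would then hold everywhere. *)
Lemma basis_infinite H D B F d Y : sym H -> opnorm H <= 1 ->
  (forall x, H (H x) = x -> x = 0) -> exact_pair B D -> 0 < d < 1 ->
  opnorm (H - D) <= d / 8 -> splits D F -> basis (outer D d * F) Y ->
  ~ (exists2 c, 0 < c & forall x, c * rip x x <= rip ((1 - H) x) x) ->
  infinite_set Y.
Proof.
move=> sH H1 Hinj BD d01 HD FP [oY YP Ymax] nogap /finite_seqP[s YE].
apply: nogap.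
have [d0 d1] := andP d01.
have c0 : 0 < d / 2 by rewrite divr_gt0.
have sY : {in undup s, forall y, Y y} by move=> y; rewrite mem_undup YE.
have s1H : sym (1 - H) by apply: symD => //; exact: symN.
apply: (finite_codim_coercive s1H (sub1_form H1) (sub1_form_def H1 Hinj) c0 oY sY (undup_uniq s)).
move=> x xs; have [sP PP] := splits_proj BD d01 FP.
have Px : (outer D d * F) x = 0.
  apply: Ymax => [|y Yy]; first by rewrite -bopM PP.
  by rewrite (sym_inner _ _ sP) YP// xs// mem_undup; move: Yy; rewrite YE.
have H2 := splits_le BD d01 FP Px.
have : `|rip ((H - D) x) x| <= d / 8 * rip x x.
  rewrite (le_trans (rip_norm_le _ _))// ripxx expr2 mulrA ler_wpM2r//.
  exact: opnorm_le_nrm.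
rewrite ler_norml !bopE !ripE => /andP[_ H3].
by have := ripxx_ge0 x; move: H2 H3; nra.
Qed.

Lemma partial_isometryE Z : (adjoint Z * Z) * (adjoint Z * Z) = adjoint Z * Z ->
  Z * (adjoint Z * Z) = Z.
Proof.
move=> PP; apply/eqP; rewrite -subr_eq0; apply/eqP/opnorm_eq0.
rewrite -(@ler_pXn2r _ 2%N) ?nnegrE ?opnorm_ge0// expr0n (le_trans (opnorm_sqr _))//.
set P := adjoint Z * Z in PP *.
have sP : adjoint P = P by rewrite /P adjointM adjointK.
have -> : adjoint (Z * P - Z) * (Z * P - Z) = 0.
  rewrite adjointD adjointN adjointM sP.
  have ZZ x : adjoint Z (Z x) = P x by [].
  have {}PP x : P (P x) = P x by rewrite -bopM PP.
  by clearbody P; apply: bop_rip => x y; rewrite !bopE !apE !ZZ !PP !ripE; ring.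
by rewrite opnorm0.
Qed.

(* The unitary is [sgnop B] on the part of the space where [|D|] is at most
   [1 - d] and exchanges the two spectral subspaces where [|D|] exceeds it. *)
Lemma glued_unitary B D d Z : exact_pair B D -> 0 < d < 1 ->
  adjoint Z * Z = outer D d * (1 - posproj D) ->
  Z * adjoint Z = outer D d * posproj D ->
  exists U, unitary U /\ opnorm (D * U + U * D) <= 4 * d.
Proof.
move=> BD d01 ZZ ZZ'; have [sB sD anti BB] := BD; have [B1 D1] := exact_pair_le1 BD.
have [d0 d1] := andP d01.
pose O := outer D d; pose J := sgnop B; pose s := sgnop D; pose F := posproj D.
have FP : splits D F by exact: splits_posproj BD.
have FP' := splitsN FP.
have [sP PP] := splits_proj BD d01 FP.
have [sP' PP'] := splits_proj (exact_pairN BD) d01 FP'; rewrite outerN in sP' PP'.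
have OF := splits_outer BD d01 FP.
have [sF FF FD DF DF'] := FP.
have OO : O * O = O := outer_idem D d.
pose Z' := adjoint Z.
have ZP : Z * (O * (1 - F)) = Z by rewrite -ZZ; apply: partial_isometryE; rewrite ZZ.
have PZ : O * F * Z = Z.
  by rewrite -ZZ' -mulrA; apply: partial_isometryE; rewrite ZZ.
have Fx x : F (F x) = F x by rewrite -bopM FF.
have Ox x : O (O x) = O x by rewrite -bopM OO.
have FO x : F (O x) = O (F x) by rewrite -!bopM OF.
have sO : sym O := outer_sym D d.
have OZ x : O (Z x) = Z x by rewrite -{1}PZ !bopM Ox -!bopM PZ.
have FZ x : F (Z x) = Z x.
  by rewrite -{1}PZ !bopM FO Fx -!bopM PZ.
have ZO x : Z (O x) = Z x.
  by rewrite -{1}ZP -[in RHS]ZP !bopE FO !apE !Ox.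
have ZF x : Z (F x) = 0.
  by rewrite -{1}ZP !bopE Fx subrr !ap0.
have Z'E x y : rip (Z' x) y = rip x (Z y) by rewrite ripAr.
have OZ' x : O (Z' x) = Z' x by apply: rip_ext => y; rewrite sO !Z'E ZO.
have FZ' x : F (Z' x) = 0 by apply: rip_ext => y; rewrite sF Z'E ZF rip0r rip0l.
have Z'O x : Z' (O x) = Z' x by apply: rip_ext => y; rewrite !Z'E sO OZ.
have Z'F x : Z' (F x) = Z' x by apply: rip_ext => y; rewrite !Z'E sF FZ.
have ZZx x : Z (Z x) = 0 by rewrite -(FZ x) ZF.
have Z'Z'x x : Z' (Z' x) = 0 by rewrite -(Z'F (Z' x)) FZ' ap0.
have ZZ'x x : Z (Z' x) = O (F x) by rewrite -bopM ZZ'.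
have Z'Zx x : Z' (Z x) = O x - O (F x) by rewrite -bopM ZZ !bopE !apE.
have sJ : sym J := sgnop_sym B.
have JJ x : J (J x) = x by rewrite -bopM sgnop_sqr.
have OJ x : O (J x) = J (O x).
  by rewrite -!bopM (outer_comm BD d01 sJ (absopD_comm_sgn BD)).
(* The first summand acts where |D| is at most 1 - d; adding the adjoint [Z'] makes the exchange of
   the ends self-adjoint, so U is a symmetry. *)
pose U : 'B(V) := J * (1 - O) + (Z + Z').
have sU : sym U.
  apply: symD.
    apply: symM => //; first by apply: symD => //; apply: symN.
    by apply: bop_ext => x; rewrite !bopE !apE OJ.
  by move=> x y; rewrite !bopE !ripE Z'E -/Z' ripA addrC.
have ZJO x : Z (J (O x)) = Z (J x) by rewrite -OJ ZO.
have Z'JO x : Z' (J (O x)) = Z' (J x) by rewrite -OJ Z'O.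
have UU : U * U = 1.
  apply: bop_rip => x y; rewrite /U !bopE !apE.
  rewrite !(OJ, JJ, OZ, OZ', ZZx, Z'Z'x, ZZ'x, Z'Zx, Ox, ZJO, Z'JO) !ripE.
  by ring.
have uU : unitary U by split; have /sym_adjoint <- := sU.
exists U; split => //.
have DO x : D (O x) = O (D x).
  by rewrite -!bopM (outer_comm BD d01 sD (absop_comm sD D1 (erefl (D * D)))).
have sE x : s x = 2%:C *: F x - x.
  by rewrite /F posprojE; apply: rip_ext => y; rewrite !bopE !ripE /s; field.
(* The sign s anticommutes exactly with the exchange Z + Z', so on the range of O only the distance
   of D from s matters, and that is at most d. *)
pose E : 'B(V) := (D - s) * O.
have E1 : opnorm E <= d.
  pose G : 'B(V) := (1 - absop D) * O.
  have AO x : absop D (O x) = O (absop D x).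
    have sA := absop_sym sD D1.
    by rewrite -!bopM (outer_comm BD d01 sA erefl).
  have -> : E = - (s * G).
    have sA x : s (absop D x) = D x by rewrite -bopM sgnop_absop.
    by rewrite /E /G; apply: bop_rip => x y; rewrite !bopE !apE sA !ripE; ring.
  rewrite opnormN (le_trans (opnormM _ _))//.
  have G1 : opnorm G <= d.
    have sA := absop_sym sD D1; have A1 := absop_le1 sD D1.
    apply: opnorm_form_le; [|exact: ltW|].
      apply: symM => //; first by apply: symD => //; apply: symN.
      by apply: bop_ext => x; rewrite !bopE !apE AO.
    move=> x; have -> : rip (G x) x = rip ((1 - absop D) (O x)) (O x).
      by rewrite -sO /G; congr rip; rewrite !bopE !apE -AO Ox.
    have H1 := outer_ge BD d01 (Ox x); have H2 := sub1_form A1 (O x).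
    rewrite ger0_norm//; move: H2; rewrite !bopE !ripE => H2.
    have : rip (O x) (O x) <= rip x x.
      rewrite !ripxx ler_pXn2r ?nnegrE// opnorm1_nrm//; exact: projection_le1.
    by move: H1; nra.
  by rewrite -[leRHS]mul1r ler_pM ?opnorm_ge0//; apply: sgnop_le1.
have Z1 : opnorm Z <= 1.
  rewrite -(@ler_pXn2r _ 2%N) ?nnegrE ?opnorm_ge0// expr1n.
  apply: le_trans (opnorm_sqr _) _; rewrite ZZ.
  exact: projection_le1.
have Z2 : opnorm (Z + Z') <= 2.
  by rewrite (le_trans (opnormD _ _))// /Z' opnorm_adjoint; lra.
have -> : D * U + U * D = (D * J + J * D) * (1 - O) + (E * (Z + Z') + (Z + Z') * E).
  apply: bop_rip => x y; rewrite /U /E !bopE !apE !sE.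
  have ODZ u : O (D (Z u)) = D (Z u) by rewrite -DO OZ.
  have ODZ' u : O (D (Z' u)) = D (Z' u) by rewrite -DO OZ'.
  rewrite !(DO, OZ, OZ', ZO, Z'O, FZ, FZ', ZF, Z'F, FO, ODZ, ODZ', apD, apN, apZ, ap0).
  by rewrite !ripE; ring.
rewrite (outer_anticommutator BD d01) add0r (le_trans (opnormD _ _))//.
have H1 := opnormM E (Z + Z'); have H2 := opnormM (Z + Z') E.
have H3 : opnorm E * opnorm (Z + Z') <= d * 2 by rewrite ler_pM ?opnorm_ge0.
by move: H1 H2; rewrite [opnorm (Z + Z') * _]mulrC; lra.
Qed.

End Matching.

(** * Unitaries that anticommute with H up to a prescribed error *)

Section AnticommutingUnitaries.
Variables (R : realType) (V : hilbertType R).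
Implicit Types (x y z : V) (c d e : R) (B D F H J P Q T U Z : 'B(V)).

(** |B n| commutes with D n exactly, so [sgnop_anticommute] controls the anticommutator times |B n|.
    A second factor |B n| turns this into 1 - H^2, which the gap cancels. *)
Lemma gap_anticommute H (B D : nat -> 'B(V)) c : sym H ->
  (forall n, exact_pair (B n) (D n)) ->
  to0 (fun n => H - D n) -> to0 (fun n => H * B n + B n * H) ->
  to0 (fun n => B n * B n - (1 - H * H)) -> opnorm H <= 1 ->
  0 < c -> (forall x, c * rip x x <= rip x x - rip (H x) (H x)) ->
  to0 (fun n => H * sgnop (B n) + sgnop (B n) * H).
Proof.
move=> sH BD HD HB BB H1 c0 gap.
have sB n : sym (B n) by case: (BD n).
have B1 n : opnorm (B n) <= 1 by case: (exact_pair_le1 (BD n)).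
have A1 n : opnorm (absop (B n)) <= 1 by exact: absop_le1.
have HA : to0 (fun n => H * absop (B n) - absop (B n) * H).
  apply: to0_eq (to0B (to0Mr A1 HD) (to0Ml A1 HD)) => n.
  have E x : absop (B n) (D n x) = D n (absop (B n) x).
    by rewrite -!bopM (absopB_comm (BD n)).
  by apply: bop_rip => x y; rewrite !bopE !apE E !ripE; ring.
have TA := sgnop_anticommute sB B1 HB HA.
have J1 n : opnorm (sgnop (B n)) <= 1 by exact: sgnop_le1.
have T2 n : opnorm (H * sgnop (B n) + sgnop (B n) * H) <= 2 by exact: anticommutator_le.
have TH : to0 (fun n => (H * sgnop (B n) + sgnop (B n) * H) * (1 - H * H)).
  apply: to0_eq (to0B (to0Mr A1 TA) (to0Ml T2 BB)) => n.
  have E x : absop (B n) (absop (B n) x) = B n (B n x) by rewrite -!bopM absop_sqr.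
  move: (sgnop (B n)) => s.
  by apply: bop_rip => x y; rewrite !bopE !apE !E !ripE; ring.
(* In the adjoint the factor 1 - H^2 stands on the left, where the gap bounds it below by c. *)
apply: (@to0_le _ _ _ _ c^-1) (to0_adjoint TH) => n.
rewrite adjointM adjointD adjointN adjoint1 adjointM; have /sym_adjoint <- := sH.
have /sym_adjoint <- : sym (H * sgnop (B n) + sgnop (B n) * H).
  by apply: symmetric_anticommutators => //; exact: sgnop_sym.
move: (H * _ + _) => T.
apply: opnorm_leP => [|x]; first by rewrite mulr_ge0 ?invr_ge0 ?opnorm_ge0// ltW.
rewrite -mulrA ler_pdivlMl//; apply: le_trans (opnorm_nrm _ _); rewrite bopM.
apply: coercive_nrm => y; apply: le_trans (gap y) _.
by rewrite !bopE !ripE (sH (H y) y).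
Qed.

Lemma anticommuting_unitary H (P Q : nat -> 'B(V)) e : sym H -> opnorm H <= 1 ->
  (forall x, H (H x) = x -> x = 0) ->
  (forall n, orthogonal_projection (P n)) -> (forall n, orthogonal_projection (Q n)) ->
  to0 (fun n => P n - Q n - H) -> 0 < e ->
  exists U, unitary U /\ opnorm (H * U + U * H) <= e.
Proof.
move=> sH H1 Hinj pP pQ PQH e0.
pose D n := P n - Q n; pose B n := P n + Q n - 1.
have BD n : exact_pair (B n) (D n).
  by have [? ? ? ?] := differenceP (pP n) (pQ n); split.
have B1 n : opnorm (B n) <= 1 by case: (exact_pair_le1 (BD n)).
have D1 n : opnorm (D n) <= 1 by case: (exact_pair_le1 (BD n)).
have HD : to0 (fun n => H - D n) by apply: to0_eq (to0N PQH) => n; rewrite /D; opring.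
have anti n x : B n (D n x) = - D n (B n x).
  by case: (BD n) => _ _ E _; rewrite -bopM E.
have BBE n x : B n (B n x) = x - D n (D n x).
  by case: (BD n) => _ _ _ E; rewrite -bopM E.
clearbody B D.
have HB : to0 (fun n => H * B n + B n * H).
  apply: to0_eq (to0D (to0Mr B1 HD) (to0Ml B1 HD)) => n.
  by apply: bop_rip => x y; rewrite !bopE !apE anti !ripE; ring.
have BB : to0 (fun n => B n * B n - (1 - H * H)).
  have cH (n : nat) : opnorm H <= 1 by [].
  apply: to0_eq (to0D (to0Mr cH HD) (to0Ml D1 HD)) => n.
  by apply: bop_rip => x y; rewrite !bopE !apE BBE !ripE; ring.
have [[c c0 gap]|nogap] := pselect (exists2 c, 0 < c &
    forall x, c * rip x x <= rip x x - rip (H x) (H x)).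
  have [n Hn] := filter_ex (gap_anticommute sH BD HD HB BB H1 c0 gap e0).
  exists (sgnop (B n)); split => //.
  have /sym_adjoint sJ := sgnop_sym (B n).
  by split; rewrite -sJ sgnop_sqr.
have nogap1 : ~ (exists2 c, 0 < c & forall x, c * rip x x <= rip ((1 - H) x) x).
  by move=> [c c0 Hc]; apply/nogap/(one_sided_gap sH H1 Hinj B1 HB BB c0 Hc).
have sHN := symN sH.
have H1N : opnorm (- H) <= 1 by rewrite opnormN.
have HinjN x : (- H) ((- H) x) = x -> x = 0 by rewrite !bopE apN opprK; exact: Hinj.
have HBN : to0 (fun n => - H * B n + B n * - H).
  by apply: to0_eq (to0N HB) => n; rewrite mulNr mulrN -opprD.
have BBN : to0 (fun n => B n * B n - (1 - - H * - H)).
  by apply: to0_eq BB => n; rewrite mulrNN.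
have nogap2 : ~ (exists2 c, 0 < c & forall x, c * rip x x <= rip ((1 - - H) x) x).
  move=> [c c0 Hc]; apply: nogap.
  have [c' c'0 Hc'] := one_sided_gap sHN H1N HinjN B1 HBN BBN c0 Hc.
  by exists c' => // x; have := Hc' x; rewrite bopN ripNl ripNr opprK.
(* Gluing costs 4 d and replacing D n by H costs twice d / 8, together less than e; the minimum with
   1 / 2 keeps d below 1. *)
pose d := Num.min (e / 8) (1 / 2).
have d01 : 0 < d < 1.
  rewrite /d lt_min !divr_gt0//= gt_min; apply/orP; right; lra.
have [d0 d1] := andP d01.
have de : d <= e / 8 by rewrite /d ge_min lexx.
have d8 : 0 < d / 8 by rewrite divr_gt0.
have [n HDn] := filter_ex (HD _ d8).
have HDnN : opnorm (- H - - D n) <= d / 8 by rewrite -opprD opnormN.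
have BDn := BD n; have BDnN := exact_pairN BDn.
set F := posproj (D n).
have FP : splits (D n) F by exact: splits_posproj BDn.
have FPN := splitsN FP.
have FK : 1 - (1 - F) = F by opring.
have [sP PP] := splits_proj BDn d01 FP.
have [sPN PPN] := splits_proj BDnN d01 FPN; rewrite outerN in sPN PPN.
have fixN x : (outer (D n) d * (1 - F)) x = x -> outer (- D n) d x = x /\ (1 - F) x = x.
  by have := splits_fix BDnN d01 FPN (x := x); rewrite outerN.
have [X bX] := basis_exists (outer (D n) d * F); have [Y bY] := basis_exists (outer (D n) d * (1 - F)).
have Xinf := basis_infinite sH H1 Hinj BDn d01 HDn FP bX nogap1.
have Yinf : infinite_set Y.
  by apply: (basis_infinite sHN H1N HinjN BDnN d01 HDnN FPN _ nogap2); rewrite outerN.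
have XY : (X #<= Y)%card.
  (* Index 0 holds the sign and the successors hold the operators of [transfer], so one countable
     family separates points. *)
  pose C i := if i is m.+1 then B m * posp (cut H (1 - d / 2)) else sgnop (B n).
  apply: (card_basis_le (C := C) sPN PPN _ bX bY Yinf) => x.
  move=> /(splits_fix BDn d01 FP)[Ox Fx] Cx.
  by apply: (transfer sH H1 Hinj B1 HB BB BDn d01 HDn FP Ox Fx) => [|m];
    [exact: (Cx 0%N)|exact: (Cx m.+1)].
have YX : (Y #<= X)%card.
  pose C i := if i is m.+1 then B m * posp (cut (- H) (1 - d / 2)) else sgnop (B n).
  apply: (card_basis_le (C := C) sP PP _ bY bX Xinf) => x.
  move=> /fixN[Ox Fx] Cx.
  have tr := transfer sHN H1N HinjN B1 HBN BBN BDnN d01 HDnN FPN Ox Fx.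
  rewrite FK outerN in tr.
  by apply: tr => [|m]; [exact: (Cx 0%N)|exact: (Cx m.+1)].
have YeqX : (Y #= X)%card by rewrite card_eq_le YX XY.
have [Z [ZZ ZZ']] := equivalent_projections sPN PPN sP PP bY bX YeqX.
have [U [uU HU]] := glued_unitary BDn d01 ZZ ZZ'.
exists U; split => //.
have -> : H * U + U * H = (D n * U + U * D n) + ((H - D n) * U + U * (H - D n)).
  by opring.
rewrite (le_trans (opnormD _ _))//.
have U1 := unitary_le1 uU.
have E1 : opnorm ((H - D n) * U) <= d / 8.
  by rewrite (le_trans (opnormM _ _))// -[leRHS]mulr1 ler_pM ?opnorm_ge0.
have E2 : opnorm (U * (H - D n)) <= d / 8.
  by rewrite (le_trans (opnormM _ _))// -[leRHS]mul1r ler_pM ?opnorm_ge0.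
have := opnormD ((H - D n) * U) (U * (H - D n)).
by move: HU E1 E2 de d0; lra.
Qed.

End AnticommutingUnitaries.

(** * Compression to, and extension from, an orthogonal complement *)

Section Compression.
Variables (R : realType) (V : hilbertType R) (A : set V).
Implicit Types (x y z : V) (u v w : perp A) (T H P Q : 'B(V)) (S : 'B(perp A)).

Let p := projop A.
Let m : 'B(V) := 1 - projop A.

Definition to_perp x : perp A := Perp (projop_mem A x).

Lemma val_to_perp x : \val (to_perp x) = p x. Proof. by []. Qed.

Lemma projop_val u : p (\val u) = \val u.
Proof. exact/projop_id/valP. Qed.

Lemma to_perpK u : to_perp (\val u) = u.
Proof. exact/val_inj/projop_val. Qed.

Lemma rip_val u v : rip u v = rip (\val u) (\val v). Proof. by []. Qed.
Lemma nrm_val u : nrm u = nrm (\val u). Proof. by []. Qed.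

Lemma to_perp_lin (a : R[i]) x y : to_perp (a *: x + y) = a *: to_perp x + to_perp y.
Proof. by apply: val_inj; rewrite val_to_perp apD apZ. Qed.

Lemma projop_idem x : p (p x) = p x.
Proof. exact/projop_id/projop_mem. Qed.

Lemma projop_le1 : opnorm p <= 1.
Proof.
by apply: projection_le1; [exact: projop_sym|apply: bop_ext => x; exact: projop_idem].
Qed.

Lemma compress_subproof T :
  (fun u : perp A => to_perp (T (\val u))) \in @bounded_linear R (perp A).
Proof.
apply: (@bounded_linearP _ _ _ (opnorm T)) => [a u v|u].
  by rewrite -to_perp_lin -apZ -apD.
rewrite !nrm_val val_to_perp; apply: le_trans (opnorm1_nrm _ projop_le1) _.
exact: opnorm_nrm.
Qed.
Definition compress T : 'B(perp A) := Bop (compress_subproof T).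

Lemma extend_subproof S : (fun x => \val (S (to_perp x))) \in @bounded_linear R V.
Proof.
apply: (@bounded_linearP _ _ _ (opnorm S)) => [a x y|x].
  by rewrite to_perp_lin apD apZ.
rewrite -nrm_val (le_trans (opnorm_nrm _ _))// ler_wpM2l ?opnorm_ge0//.
by rewrite nrm_val val_to_perp opnorm1_nrm// projop_le1.
Qed.
Definition extend S : 'B(V) := Bop (extend_subproof S).

Lemma val_compress T u : \val (compress T u) = p (T (\val u)). Proof. by []. Qed.
Lemma extendE S x : extend S x = \val (S (to_perp x)). Proof. by []. Qed.

Lemma compress_sym T : sym T -> sym (compress T).
Proof.
move=> sT u v; rewrite !rip_val !val_compress projop_sym projop_val sT.
by rewrite -[RHS]projop_sym projop_val.
Qed.

Lemma compress_le T : opnorm (compress T) <= opnorm T.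
Proof.
apply: opnorm_leP => [|u]; first exact: opnorm_ge0.
rewrite !nrm_val val_compress (le_trans (opnorm1_nrm _ projop_le1))//.
exact: opnorm_nrm.
Qed.

Lemma compressB T H : compress (T - H) = compress T - compress H.
Proof. by apply: bop_ext => u; apply: val_inj; rewrite val_compress !bopE !apE. Qed.

Lemma to0_compress (T : nat -> 'B(V)) : to0 T -> to0 (fun n => compress (T n)).
Proof. by move=> T0 e /T0; apply: filterS => n; apply/le_trans/compress_le. Qed.

(** As T^2 = 1, the compression has p T p T p = p - (p T m) T p, so its defect is governed by the
    off-diagonal corner. *)
Lemma compress_symmetry (T : nat -> 'B(V)) : (forall n, T n * T n = 1) ->
  (forall n, opnorm (T n) <= 1) -> to0 (fun n => p * T n * m) ->
  to0 (fun n => compress (T n) * compress (T n) - 1).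
Proof.
move=> TT T1 pTm.
have E n : compress (T n) * compress (T n) - 1 = compress (- (p * T n * m * T n)).
  apply: bop_ext => u; apply: val_inj.
  have TTx x : T n (T n x) = x by rewrite -bopM TT.
  rewrite bopD bopN bop1 bopM [RHS]val_compress.
  rewrite -[LHS]/(p (T n (p (T n (\val u)))) - \val u).
  by rewrite /m !bopE !apE TTx !projop_idem projop_val opprB.
apply: to0_eq E _; apply: to0_compress; apply: to0N.
exact: to0Mr T1 pTm.
Qed.

Lemma extend_le S : opnorm (extend S) <= opnorm S.
Proof.
apply: opnorm_leP => [|x]; first exact: opnorm_ge0.
rewrite extendE -nrm_val (le_trans (opnorm_nrm _ _))// ler_wpM2l ?opnorm_ge0//.
by rewrite nrm_val val_to_perp opnorm1_nrm// projop_le1.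
Qed.

Lemma extend_sym S : sym S -> sym (extend S).
Proof.
have E u y : rip (\val u) y = rip u (to_perp y).
  by rewrite rip_val val_to_perp -projop_sym projop_val.
by move=> sS x y; rewrite !extendE E sS (ripC x) E ripC.
Qed.

Lemma extendM S S' x : extend S (extend S' x) = extend (S * S') x.
Proof. by rewrite !extendE to_perpK. Qed.

Lemma projop_extend S x : p (extend S x) = extend S x.
Proof. exact: projop_val. Qed.

Lemma extend_projop S x : extend S (p x) = extend S x.
Proof. by rewrite !extendE; congr (\val (S _)); apply: val_inj; apply: projop_idem. Qed.

Lemma extendB S S' : extend (S - S') = extend S - extend S'.
Proof. exact: bop_ext. Qed.

End Compression.

(** * The part of the space where H^2 is the identity *)

Section UnitPart.
Variables (R : realType) (V : hilbertType R) (H : 'B(V)).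
Implicit Types (x y z : V) (T P Q J : 'B(V)).

Let A := ker (H ^+ 2 - 1).
Let p := projop A.
Let m : 'B(V) := 1 - projop A.

Lemma ker_sqr_sub1 x : A x <-> H (H x) = x.
Proof.
have E : (H ^+ 2 - 1) x = H (H x) - x by rewrite expr2.
rewrite /A /ker /mkset E; split=> [/eqP|->]; last by rewrite subrr.
by rewrite subr_eq0 => /eqP.
Qed.

Hypothesis sH : sym H.

Lemma perp_sqr_stable : perp_stable H A.
Proof. by apply/perp_ker_sqr_stable/sym_adjoint. Qed.

Lemma projop_comm x : p (H x) = H (p x).
Proof.
have sp : sym p := @projop_sym R V A.
have pHp z : p (H (p z)) = H (p z).
  by apply/projop_id/perp_sqr_stable/projop_mem.
by apply: rip_ext => y; rewrite sp sH -(pHp y) -sp -sH -sp pHp.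
Qed.

(** [m] projects onto a double orthogonal complement, so H^2 = 1 there needs an argument: by
    self-adjointness the range of H^2 - 1 is orthogonal to its kernel and hence killed by [m]. *)
Lemma unit_part_sqr x : H (H (m x)) = m x.
Proof.
have sp : sym p := @projop_sym R V A.
have Hy y : p (H (H y) - y) = H (H y) - y.
  apply: projop_id; apply/asboolP => z /ker_sqr_sub1 zA.
  by rewrite linearBl/= !(sym_inner _ _ sH) zA subrr.
apply/eqP; rewrite -subr_eq0; apply/eqP; apply: rip_ext => y; rewrite rip0l.
have -> : rip (H (H (m x)) - m x) y = rip (m x) (H (H y) - y).
  by move: (m x) => z; rewrite !ripE !sH.
by rewrite -Hy /m !bopE ripDl ripNl -/p sp projop_idem subrr.
Qed.

Lemma perp_injective (u : perp A) (HA : perp_stable H A) :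
  restrict HA (restrict HA u) = u -> u = 0.
Proof.
move=> /(congr1 \val); rewrite !restrictE => /ker_sqr_sub1 uA.
apply: ripxx_eq0; rewrite rip_val; have /asboolP/(_ _ uA) u0 := valP u.
by rewrite /rip u0.
Qed.

Lemma restrict_compress (HA : perp_stable H A) : restrict HA = compress A H.
Proof.
apply: bop_ext => u; apply: val_inj; rewrite restrictE val_compress.
by rewrite -/p projop_comm projop_val.
Qed.

Lemma extend_restrict (HA : perp_stable H A) x : extend (restrict HA) x = H (p x).
Proof. by []. Qed.

(** On the range of [m], H is a symmetry commuting with [m], so H m is the difference of the
    projections (1 + H) m / 2 and (1 - H) m / 2, orthogonal to the extended ones. *)
Lemma extend_difference (S : 'B(perp A)) : difference_of_projections S ->
  difference_of_projections (extend S + H * m).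
Proof.
move=> [P [Q [/projectionP[sP PP] /projectionP[sQ QQ] ->]]].
have sp : sym p := @projop_sym R V A.
have sm : sym m by apply: symD => //; exact: symN.
have pp x : p (p x) = p x by exact: projop_idem.
have Hp x : H (p x) = p (H x) by rewrite projop_comm.
have summand T c : sym T -> T * T = T -> p * T = T -> T * p = T -> c ^+ 2 = 1 ->
    orthogonal_projection (T + 2^-1%:C *: ((1 + c%:C *: H) * m)).
  move=> sT TT pT Tp cc; apply/projectionP; split.
    apply: symD => //; apply: symZ; apply: symM => //.
      by apply: symD => //; exact: symZ.
    by apply: bop_rip => x y; rewrite /m !bopE !apE -/p Hp !ripE; ring.
  have {}TT x : T (T x) = T x by rewrite -bopM TT.
  have {}pT x : p (T x) = T x by rewrite -bopM pT.
  have {}Tp x : T (p x) = T x by rewrite -bopM Tp.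
  have Tm x : T (m x) = 0 by rewrite /m !bopE !apE Tp subrr.
  have mT x : m (T x) = 0 by rewrite /m !bopE pT subrr.
  have mm x : m (m x) = m x by rewrite /m !bopE !apE pp subrr subr0.
  have Hm x : H (m x) = m (H x) by rewrite /m !bopE !apE Hp.
  have mHH x : m (H (H x)) = m x by rewrite -!Hm unit_part_sqr.
  move: (m) Tm mT mm Hm mHH => n Tn nT nn Hn nHH.
  apply: bop_rip => x y; rewrite !bopE !apE !(Hn, Tn, nT, nn, nHH, TT, apZ, ap0) !ripE.
  by have : c ^+ 2 * rip (n x) y = rip (n x) y; [rewrite cc mul1r|lra].
have cc : (-1 : R) ^+ 2 = 1 by ring.
exists (extend P + 2^-1%:C *: ((1 + 1%:C *: H) * m)),
  (extend Q + 2^-1%:C *: ((1 + (-1)%:C *: H) * m)); split.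
- apply: summand; rewrite ?expr1n//; first exact: extend_sym.
  + by apply: bop_ext => x; rewrite bopM extendM PP.
  + by apply: bop_ext => x; rewrite bopM; apply: projop_extend.
  + by apply: bop_ext => x; rewrite bopM; apply: extend_projop.
- apply: summand => //; first exact: extend_sym.
  + by apply: bop_ext => x; rewrite bopM extendM QQ.
  + by apply: bop_ext => x; rewrite bopM; apply: projop_extend.
  + by apply: bop_ext => x; rewrite bopM; apply: extend_projop.
rewrite extendB; move: (m) (extend P) (extend Q) => n P' Q'.
by opring.
Qed.

End UnitPart.

(** * Order bounds as contractions, and the two implications *)

Section MainTheorem.
Variables (R : realType).

Lemma sub_symmetric_unitary (V : hilbertType R) (H U : 'B(V)) : unitary U ->
  opnorm (adjoint U * H * U - (- H)) = opnorm (H * U + U * H).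
Proof.
move=> uU; have [UU UU'] := uU.
have U1 := unitary_le1 uU; have U'1 := unitary_le1 (adjoint_unitary uU).
have E x : adjoint U (U x) = x by rewrite -bopM UU.
have E' x : U (adjoint U x) = x by rewrite -bopM UU'.
apply/le_anti/andP; split.
  have -> : adjoint U * H * U - (- H) = adjoint U * (H * U + U * H).
    by move: (adjoint U) E => U' E; apply: bop_rip => x y; rewrite !bopE !apE E !ripE; ring.
  by rewrite (le_trans (opnormM _ _))// ler_piMl ?opnorm_ge0.
have -> : H * U + U * H = U * (adjoint U * H * U - (- H)).
  move: (adjoint U) E' => U' E'.
  by apply: bop_rip => x y; rewrite !bopE !apE E' !ripE; ring.
by rewrite (le_trans (opnormM _ _))// ler_piMl ?opnorm_ge0.
Qed.

Lemma form_inner (V : hilbertType R) (T : 'B(V)) x : sym T ->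
  '[T x, x] = (rip (T x) x)%:C.
Proof.
move=> sT; rewrite inner_rip; suff -> : rip (T x) ('i *: x) = 0 by [].
by have := rip_i (T x) x; rewrite -apZ sT ripC; lra.
Qed.

Lemma contractionP (V : hilbertType R) (H : 'B(V)) :
  op_le (-1) H /\ op_le H 1 <-> sym H /\ opnorm H <= 1.
Proof.
have s1 : sym (1 : 'B(V)) by exact: sym1.
have sN1 : sym (-1 : 'B(V)) by apply: symN.
split=> [[[_ saH H1] [_ _ H2]]|[sH H1]].
  have sH : sym H by apply/sym_adjoint.
  split => //; apply: opnorm_form_le => // x; rewrite mul1r ler_norml.
  have := H1 x; have := H2 x; rewrite !form_inner// !lecR bop1 bopN bop1 ripNl.
  by move=> -> ->.
have Hx x : `|rip (H x) x| <= rip x x.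
  by rewrite (le_trans (rip_norm_le _ _))// ripxx expr2 ler_wpM2r// opnorm1_nrm.
split; split; try exact/sym_adjoint; move=> x; rewrite !form_inner// lecR.
  by rewrite bopN bop1 ripNl; have := Hx x; rewrite ler_norml => /andP[].
by rewrite bop1; have := Hx x; rewrite ler_norml => /andP[].
Qed.

Lemma to0_sym (V : hilbertType R) (T : nat -> 'B(V)) H :
  (forall n, sym (T n)) -> to0 (fun n => T n - H) -> sym H.
Proof.
move=> sT TH; apply/sym_adjoint/eqP; rewrite -subr_eq0; apply/eqP/to0_const.
apply: to0_eq (to0B (to0_adjoint TH) TH) => n.
by rewrite adjointD adjointN; have /sym_adjoint <- := sT n; opring.
Qed.

Lemma restrict_limit (V : hilbertType R) (H : 'B(V)) (D : nat -> 'B(V))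
    (HA : perp_stable H (ker (H ^+ 2 - 1))) : sym H -> opnorm H <= 1 ->
  (forall n, difference_of_projections (D n)) -> to0 (fun n => D n - H) ->
  approx_unitarily_equivalent (restrict HA) (- restrict HA).
Proof.
move=> sH H1 /choice[P /choice[Q PQ]] DH.
have rounding (W : hilbertType R) (s s' t t' h : 'B(W)) :
    2^-1%:C *: (1 + s) - 2^-1%:C *: (1 + s') - h =
    2^-1%:C *: (s - t - (s' - t')) + (2^-1%:C *: (t - t') - h) by opring.
have sandwich (b d k : 'B(V)) : b * b = 1 - d * d -> (forall x, H (H (k x)) = k x) ->
    k * b * (b * k) = k * (- ((d - H) * H + d * (d - H)) * k).
  move=> bb Hk; have {}bb x : b (b x) = x - d (d x) by rewrite -bopM bb.
  by apply: bop_rip => x y; rewrite !bopE !apE !(bb, apD, apN, Hk) !ripE; ring.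
pose A := ker (H ^+ 2 - 1); pose p := projop A; pose m : 'B(V) := 1 - projop A.
have pp x : p (p x) = p x by exact: projop_idem.
have pP n : orthogonal_projection (P n) by case: (PQ n).
have pQ n : orthogonal_projection (Q n) by case: (PQ n).
have DE n : D n = P n - Q n by case: (PQ n).
pose B n := P n + Q n - 1.
have sm : sym m by apply: symD => //; apply/symN/projop_sym.
have p1 : opnorm p <= 1 := projop_le1 A.
have m1 : opnorm m <= 1.
  by apply: projection_le1 => //; apply: bop_ext => x; rewrite /m !bopE !apE -/p pp subrr subr0.
have BD n : exact_pair (B n) (D n).
  by rewrite DE; have [? ? ? ?] := differenceP (pP n) (pQ n); split.
have sB n : sym (B n) by case: (BD n).
have D1 n : opnorm (D n) <= 1 by case: (exact_pair_le1 (BD n)).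
(* The adjoint of B m times B m is m (1 - D^2) m, which tends to m (1 - H^2) m = 0. *)
have Bm : to0 (fun n => B n * m).
  have cH (n : nat) : opnorm H <= 1 by [].
  have cm (n : nat) : opnorm m <= 1 by [].
  apply: (@to0_sqr_le _ _ (fun n => m * (- ((D n - H) * H + D n * (D n - H)) * m))) => [n|].
    apply: le_trans (opnorm_sqr _) _; rewrite adjointM.
    have /sym_adjoint <- := sm; have /sym_adjoint <- := sB n.
    rewrite le_eqVlt; apply/orP; left; apply/eqP; congr opnorm.
    by apply: sandwich => [|x]; [case: (BD n)|exact: unit_part_sqr].
  apply: (to0Ml cm); apply: (to0Mr cm); apply: to0N.
  by apply: to0D; [exact: to0Mr cH DH|exact: to0Ml D1 DH].
(* The off-diagonal corner of D tends to that of H, which is 0 because H commutes with p. *)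
have Dm : to0 (fun n => p * D n * m).
  have cp (n : nat) : opnorm p <= 1 by [].
  have cm (n : nat) : opnorm m <= 1 by [].
  apply: to0_eq (to0Mr cm (to0Ml cp DH)) => n.
  have pHm : p * H * m = 0.
    apply: bop_ext => x; rewrite bopM bopM /p (projop_comm sH) -/A -/p.
    by rewrite /m bopD bopN bop1 apD apN -/p pp subrr ap0.
  have E (a b c k : 'B(V)) : a * k * b = a * (k - c) * b + a * c * b by opring.
  by rewrite (E p m H (D n)) pHm addr0.
have pBm : to0 (fun n => p * (B n * m)).
  have cp (n : nat) : opnorm p <= 1 by [].
  exact: to0Ml cp Bm.
(* These are the reflections 2 P - 1 and 2 Q - 1, whose corners vanish asymptotically with those of
   B and D. *)
pose S n := B n + D n; pose S' n := B n - D n.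
have refl_sqr (T : 'B(V)) : orthogonal_projection T ->
    (2%:C *: T - 1) * (2%:C *: T - 1) = 1 /\ sym (2%:C *: T - 1).
  move=> /projectionP[sT TT]; have E x : T (T x) = T x by rewrite -bopM TT.
  split; last by apply: symD; [exact: symZ|exact: symN].
  by apply: bop_rip => x y; rewrite !bopE !apE E !ripE; ring.
have SE n : S n = 2%:C *: P n - 1 by rewrite /S /B DE; opring.
have S'E n : S' n = 2%:C *: Q n - 1 by rewrite /S' /B DE; opring.
have SS n : S n * S n = 1 by rewrite SE; case: (refl_sqr _ (pP n)).
have S'S' n : S' n * S' n = 1 by rewrite S'E; case: (refl_sqr _ (pQ n)).
have sS n : sym (S n) by rewrite SE; case: (refl_sqr _ (pP n)).
have sS' n : sym (S' n) by rewrite S'E; case: (refl_sqr _ (pQ n)).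
have S1 n : opnorm (S n) <= 1 by exact: symmetry_le1.
have S'1 n : opnorm (S' n) <= 1 by exact: symmetry_le1.
have pSm : to0 (fun n => p * S n * m).
  by apply: to0_eq (to0D pBm Dm) => n; rewrite /S; move: (p) (m) (B n) => *; opring.
have pS'm : to0 (fun n => p * S' n * m).
  by apply: to0_eq (to0B pBm Dm) => n; rewrite /S'; move: (p) (m) (B n) => *; opring.
pose C n := compress A (S n); pose C' n := compress A (S' n).
have sC n : sym (C n) by exact: compress_sym.
have sC' n : sym (C' n) by exact: compress_sym.
have C1 n : opnorm (C n) <= 1 by apply: le_trans (compress_le _ _) _.
have C'1 n : opnorm (C' n) <= 1 by apply: le_trans (compress_le _ _) _.
have CC := sgnop_round sC C1 (compress_symmetry SS S1 pSm).
have CC' := sgnop_round sC' C'1 (compress_symmetry S'S' S'1 pS'm).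
have proj (T : 'B(perp A)) : orthogonal_projection (posproj T).
  by apply/projectionP; split; [exact: posproj_sym|exact: posproj_idem].
(* Rounding each compressed reflection to its sign makes its projection exact at vanishing cost, so
   the differences still approximate H on N. *)
have lim : to0 (fun n => posproj (C n) - posproj (C' n) - restrict HA).
  have DC := to0_compress A DH.
  apply: to0_eq (to0D (to0Z 2^-1 (to0B CC CC')) DC) => n.
  rewrite !posprojE (restrict_compress sH) compressB.
  have -> : compress A (D n) = 2^-1%:C *: (C n - C' n).
    apply: bop_ext => u; apply: val_inj; rewrite val_compress.
    rewrite -[RHS]/(2^-1%:C *: (projop A (S n (\val u)) - projop A (S' n (\val u)))).
    by rewrite /S /S'; apply: rip_ext => y; rewrite !bopE !apE !ripE; field.
  exact: rounding.
have sR : sym (restrict HA) by rewrite restrict_compress//; exact: compress_sym.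
have R1 : opnorm (restrict HA) <= 1.
  by rewrite restrict_compress// (le_trans (compress_le _ _)).
have e0 (n : nat) : 0 < n.+1%:R^-1 :> R by rewrite invr_gt0 ltr0n.
have /choice[U UP] n := anticommuting_unitary sR R1 (@perp_injective _ _ _ ^~ HA)
  (fun n => proj (C n)) (fun n => proj (C' n)) lim (e0 n).
exists U; split; first by move=> n; case: (UP n).
apply/cvg_to0 => e ep; near=> n; rewrite sub_symmetric_unitary; last by case: (UP n).
have [_ /le_trans] := UP n; apply.
rewrite -[leRHS]invrK lef_pV2 ?posrE ?ltr0n ?invr_gt0//.
have : (Num.bound e^-1 <= n)%N by near: n; exists (Num.bound e^-1).
move=> nb; have := @archi_boundP R e^-1; rewrite invr_ge0 ltW// => /(_ isT)/ltW/le_trans; apply.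
by rewrite ler_nat leqW.
Unshelve. all: by end_near. Qed.

Lemma equivalence_limit (V : hilbertType R) (H : 'B(V))
    (HA : perp_stable H (ker (H ^+ 2 - 1))) : sym H -> opnorm H <= 1 ->
  approx_unitarily_equivalent (restrict HA) (- restrict HA) ->
  exists D : nat -> 'B(V),
    (forall n, difference_of_projections (D n)) /\ D @ \oo --> H.
Proof.
move=> sH H1 [U [uU /cvg_to0 UH]].
pose A := ker (H ^+ 2 - 1); pose p := projop A; pose m : 'B(V) := 1 - projop A.
set K := restrict HA in UH *.
have sK : sym K by rewrite /K restrict_compress//; exact: compress_sym.
have K1 : opnorm K <= 1 by rewrite /K restrict_compress// (le_trans (compress_le _ _)).
have {}UH : to0 (fun n => K * U n + U n * K).
  by move=> e /UH; apply: filterS => n; rewrite sub_symmetric_unitary.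
have [J [JP KJ]] := approx_symmetry sK K1 uU UH.
have sJ n : sym (J n) by case: (JP n).
have JJ n x : J n (J n x) = x by have [_ E] := JP n; rewrite -bopM E.
have J1 n : opnorm (J n) <= 1 by have [? ?] := JP n; exact: symmetry_le1.
(* Averaging K with the negative of its conjugate makes the anticommutation with J exact; the change
   is half the norm of the anticommutator, up to the factor J. *)
pose d n := 2^-1%:C *: (K - J n * K * J n).
have diff n : difference_of_projections (d n).
  apply: (anticommuting_difference (J := J n)) => //.
  - apply: symZ; apply: symD => //; apply: symN => x y.
    by rewrite !bopM !(sJ, sK).
  - rewrite opnormZ ger0_norm ?invr_ge0// ler_pdivrMl// mulr1.
    rewrite (le_trans (opnormB _ _))// -[2]/(1 + 1) lerD//.
    rewrite (le_trans (opnormM _ _))// mulr_ile1 ?opnorm_ge0//.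
    by rewrite (le_trans (opnormM _ _))// mulr_ile1 ?opnorm_ge0.
  - by have [] := JP n.
  - by apply: bop_rip => x y; rewrite /d !bopE !apE !JJ !ripE; ring.
have dK : to0 (fun n => d n - K).
  apply: to0_eq (to0Z (- 2^-1) (to0Ml J1 KJ)) => n.
  by apply: bop_rip => x y; rewrite /d !bopE !apE !JJ !ripE; field.
exists (fun n => extend (d n) + H * m); split; first by move=> n; exact: extend_difference.
apply/cvg_to0 => e /dK; apply: filterS => n.
have -> : extend (d n) + H * m - H = extend (d n - K).
  have EK : extend K = H * p by apply: bop_ext => x; exact: extend_restrict.
  by rewrite extendB EK /m -/p; move: (extend _) (p) => E q; opring.
exact/le_trans/extend_le.
Qed.

End MainTheorem.

Theorem theorem5p11 (R : realType) (V : hilbertType R) (H : 'B(V)) :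
  (exists D : nat -> 'B(V),
     (forall n, difference_of_projections (D n)) /\ D @ \oo --> H)
  <->
  (exists (Hge : op_le (-1) H) (Hle : op_le H 1),
     let N := perp (ker (H ^+ 2 - 1)) in
     let H1 : 'B(N) := restrict (op_le_stable Hge) in
     approx_unitarily_equivalent H1 (- H1)).
Proof.
split=> [[D [diffD /cvg_to0 DH]]|[Hge [Hle UH]]]; last first.
  have [sH H1] := (contractionP H).1 (conj Hge Hle).
  exact: equivalence_limit UH.
have pairD n : exists B, exact_pair B (D n).
  have [P [Q [pP pQ ->]]] := diffD n.
  by have [? ? ? ?] := differenceP pP pQ; exists (P + Q - 1); split.
have sD n : sym (D n) by have [B []] := pairD n.
have D1 n : opnorm (D n) <= 1 by have [B /exact_pair_le1[]] := pairD n.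
have sH := to0_sym sD DH; have H1 := to0_le_const DH D1.
have [Hge Hle] := (contractionP H).2 (conj sH H1).
by exists Hge, Hle; apply: restrict_limit diffD DH.
Qed.
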